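(* Let $H\in(0,1)$, $K\in(0,1]$ and let $B_0^{H,K}$ be a bifractional Brownian motion in $\mathbb{R}$ with indices $H$ and $K$. There exist positive constants $c_1$ and $c_2$ such that for all $t_0\in[0,1]$ and $x\in(0,1)$, $$\exp\Big(-\frac{c_1}{x^{1/(HK)}}\Big)\le\mathbb{P}\Big\{\max_{t\in[0,1]}\big|B_0^{H,K}(t)-B_0^{H,K}(t_0)\big|\le x\Big\}\le\exp\Big(-\frac{c_2}{x^{1/(HK)}}\Big).$$
   Context: For $H\in(0,1)$ and $K\in(0,1]$, the bifractional Brownian motion in $\mathbb{R}$ with indices $H,K$ is the centered Gaussian process $B^{H,K}_0=\{B^{H,K}_0(t),\,t\in\mathbb{R}_+\}$ (with continuous sample paths) with $B^{H,K}_0(0)=0$ and covariance function $\frac{1}{2^K}\big[(t^{2H}+s^{2H})^K-|t-s|^{2HK}\big]$. *)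

(* Defs.v *)
From mathcomp Require Import all_boot all_order all_algebra.
From mathcomp Require Import all_classical all_reals all_analysis.

Set Implicit Arguments.
Unset Strict Implicit.
Unset Printing Implicit Defensive.

Import Order.TTheory GRing.Theory Num.Theory.
Import numFieldNormedType.Exports.

Local Open Scope classical_set_scope.
Local Open Scope ring_scope.

(* [normal_prob m 0] is a junk value (the uniform law on [0, 1]), whereas the
   Gaussian law of variance 0 is the Dirac mass at its mean. *)
Definition gaussian_law (R : realType) (m s : R) (A : set R) : \bar R :=
  if s == 0 then \d_m A else normal_prob m s A.

Definition gaussian_rv d (T : measurableType d) (R : realType)
    (P : probability T R) (X : T -> R) : Prop :=
  exists m s : R, forall A : set R, measurable A ->
    P (X @^-1` A) = gaussian_law m s A.

(* The index set is [D]; the variables [X t] with [t] outside [D] are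
   irrelevant. *)
Definition gaussian_process d (T : measurableType d) (R : realType)
    (P : probability T R) (D : set R) (X : R -> {RV P >-> R}) : Prop :=
  forall (n : nat) (t a : 'I_n -> R), (forall i, D (t i)) ->
    gaussian_rv P (fun w => \sum_(i < n) a i * X (t i) w).

Definition bifbm_cov (R : realType) (H K s t : R) : R :=
  (2 `^ K)^-1 *
  ((t `^ (2 * H) + s `^ (2 * H)) `^ K - `|t - s| `^ (2 * H * K)).

Record bifractional_brownian_motion d (T : measurableType d) (R : realType)
    (P : probability T R) (H K : R) (B : R -> {RV P >-> R}) : Prop := {
  bifbm_gaussian : gaussian_process `[0, +oo[ B;
  bifbm_centered : forall t, 0 <= t -> ('E_P[B t] = 0)%E;
  bifbm_covariance : forall s t, 0 <= s -> 0 <= t ->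
    covariance P (B s) (B t) = (bifbm_cov H K s t)%:E;
  bifbm_start : forall w, B 0 w = 0;
  bifbm_continuous : forall w, {within `[0, +oo[, continuous (fun t => B t w)}
}.

(* The supremum is a maximum as soon as the path [t |-> B t w] is continuous
   on [0, 1], as for the paths of a bifractional Brownian motion. *)
Definition max_deviation (R : realType) (T : Type) (B : R -> T -> R)
    (t0 : R) (w : T) : R :=
  sup [set `|B t w - B t0 w| | t in `[0, 1]].

(* Main.v *)
(* Lower bound: on [0, 1] the path stays within x / 2 of 0 as soon as its
   increments over the dyadic intervals of length 2^-j are at most x times a
   weight decreasing geometrically with the distance of j to the scale j0 given
   by 2^j0 ~ x^(-1/(HK)). Sidak's inequality, obtained here from the
   Prekopa-Leindler inequality, bounds the probability of all these constraints
   below by the product of the individual probabilities, whose exponents sum to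
   O(2^j0).
   Upper bound: the second differences Y_i of the path with step
   h ~ x^(1/(HK)), at n ~ 1/h points L h apart, are nearly uncorrelated when L
   is large, so that Var (sum_i v_i Y_i) >= c h^(2HK) sum_i v_i^2. If the path
   oscillates by at most x, then every |Y_i| is at most 4 x and the product of
   the (1 + cos (Y_i / 4 x)) / 2 is at least ((1 + cos 1) / 2)^n; expanding it
   into cosines of Gaussian variables shows that its mean is at most
   ((1 + cos 1 / 2) / 2)^n. *)
From HB Require Import structures.
Require Import Defs.
From mathcomp Require Import all_boot all_order all_algebra.
From mathcomp Require Import all_classical all_reals all_analysis.

From mathcomp Require Import measurable_realfun.
From mathcomp Require Import zify ring lra.

Import Order.TTheory GRing.Theory Num.Theory.
Import numFieldNormedType.Exports.

Local Open Scope classical_set_scope.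
Local Open Scope ring_scope.

Set Implicit Arguments.
Unset Strict Implicit.
Unset Printing Implicit Defensive.

(** Second differences are forced by the covariance. It splits into [(t^(2H) + s^(2H))^K], smooth
    away from the axes, and [|t - s|^(2HK)]. First differences of the latter correlate like distance
    to the power [2HK - 2], which is not summable when [2HK > 1]; second differences give the power
    [2HK - 4], below [-2] in every case. The smooth term leaves an error [h^3] per pair, negligible
    against [h^(2HK)] because [HK < 1], provided that the points stay off the axes: they are taken
    in [[1/2, 3/4]]. A Gaussian vector is known here only through the laws of its linear
    combinations, and its covariance may be singular, so no joint density is used. Independence and
    symmetry come from comparing Fourier transforms on symmetric boxes, and Sidak's inequality
    integrates out one coordinate at a time. Likewise the cosine product needs only a lower bound on
    a quadratic form. Uniformity in [t0] is obtained below by keeping the whole path within [x / 2]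
    of 0, and above because a second difference cancels the constant [B t0]. *)

(** * The normal law on the line: Stein's identity, moments, characteristic function *)

Lemma ge0_integral_normal_prob (R : realType) (m s : R) (s0 : s != 0)
    (f : R -> \bar R) : measurable_fun setT f -> (forall x, (0 <= f x)%E) ->
  (\int[normal_prob m s]_x f x =
   \int[@lebesgue_measure R]_x (f x * (normal_pdf m s x)%:E))%E.
Proof.
move=> mf f0.
have dom := normal_prob_dominates m s.
rewrite -(Radon_Nikodym_SigmaFinite.change_of_variables dom f0 measurableT mf).
apply: ae_eq_integral => //.
- apply: emeasurable_funM => //; apply: (measurable_int (@lebesgue_measure R)).
  exact: (Radon_Nikodym_SigmaFinite.f_integrable dom).
- apply: emeasurable_funM => //; apply/measurable_EFinP.
  exact: measurable_normal_pdf.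
- apply: ae_eqe_mul2l => /=.
  apply: integral_ae_eq => //=.
  + exact: Radon_Nikodym_SigmaFinite.f_integrable.
  + by apply/measurable_EFinP; exact: measurable_normal_pdf.
  + move=> E _ mE.
    by rewrite -Radon_Nikodym_SigmaFinite.f_integral.
Qed.

Section gaussian_variable.
Context d (T : measurableType d) (R : realType) (P : probability T R).
Variables (X : T -> R) (m s : R).
Hypothesis mX : measurable_fun setT X.
Hypothesis lawX : forall A : set R, measurable A ->
  P (X @^-1` A) = gaussian_law m s A.
Hypothesis s0 : s != 0.

Let mu := @lebesgue_measure R.

Lemma ge0_integral_gaussian (f : R -> R) :
  measurable_fun setT f -> (forall x, 0 <= f x) ->
  (\int[P]_w (f (X w))%:E = \int[mu]_x (f x * normal_pdf m s x)%:E)%E.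
Proof.
move=> mf f0.
have mfE : measurable_fun setT (EFin \o f) by exact/measurable_EFinP.
have := @ge0_integral_normal_prob R m s s0 (EFin \o f) mfE.
move=> /(_ (fun x => _)) H.
under [RHS]eq_integral do rewrite EFinM.
rewrite -H; last by move=> x; rewrite lee_fin.
have mX' : measurable_fun setT (X : T -> measurableTypeR R) by [].
pose X' : {mfun T >-> measurableTypeR R} :=
  HB.pack (X : T -> measurableTypeR R) (isMeasurableFun.Build _ _ _ _ _ mX').
have := @ge0_integral_distribution _ _ T (measurableTypeR R) R P X' _ mfE.
move=> /(_ (fun x => _)) H'.
rewrite -[LHS]H'; last by move=> x; rewrite lee_fin.
apply: (eq_measure_integral (normal_prob m s)) => A mA _.
by have := lawX mA; rewrite /gaussian_law (negbTE s0).
Qed.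

Lemma integrable_gaussian (f : R -> R) : measurable_fun setT f ->
  mu.-integrable setT (fun x => (f x * normal_pdf m s x)%:E) ->
  P.-integrable setT (fun w => (f (X w))%:E).
Proof.
move=> mf /integrableP[_ fi]; apply/integrableP; split.
  by apply/measurable_EFinP; exact: (measurableT_comp mf mX).
have -> : (\int[P]_x `|(f (X x))%:E| =
    \int[mu]_x (`|f x| * normal_pdf m s x)%:E)%E.
  rewrite -(ge0_integral_gaussian (f := fun x => `|f x|))//.
  exact: measurableT_comp.
move: fi; congr (_ < _)%E; apply: eq_integral => x _ /=.
by rewrite normrM (ger0_norm (normal_pdf_ge0 _ _ _)).
Qed.

Lemma Rintegral_gaussian (f : R -> R) : measurable_fun setT f ->
  mu.-integrable setT (fun x => (f x * normal_pdf m s x)%:E) ->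
  \int[P]_w f (X w) = \int[mu]_x (f x * normal_pdf m s x).
Proof.
move=> mf fi; congr fine.
have mfp : measurable_fun setT (fun x => Num.max (f x) 0).
  exact: measurable_maxr.
have mfn : measurable_fun setT (fun x => Num.max (- f x) 0).
  by apply: measurable_maxr => //; exact: measurableT_comp.
rewrite integralE [RHS]integralE; congr (_ - _)%E.
  under eq_integral do rewrite funeposE -EFin_max.
  rewrite (ge0_integral_gaussian (f := fun x => Num.max (f x) 0))//.
    apply: eq_integral => x _; rewrite funeposE -EFin_max.
    by rewrite maxr_pMl ?normal_pdf_ge0// mul0r.
  by move=> x; rewrite le_max lexx orbT.
under eq_integral do rewrite funenegE -EFinN -EFin_max.
rewrite (ge0_integral_gaussian (f := fun x => Num.max (- f x) 0))//.
  apply: eq_integral => x _; rewrite funenegE -EFinN -EFin_max.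
  by rewrite maxr_pMl ?normal_pdf_ge0// mul0r mulNr.
by move=> x; rewrite le_max lexx orbT.
Qed.

End gaussian_variable.

Lemma dominated_Rcvg d (T : measurableType d) (R : realType)
    (mu : {measure set T -> \bar R}) (f_ : nat -> T -> R) (f G : T -> R) :
  (forall n, measurable_fun setT (f_ n)) ->
  (forall x, f_ ^~ x @ \oo --> f x) ->
  mu.-integrable setT (EFin \o G) ->
  (forall n x, `|f_ n x| <= G x) ->
  \int[mu]_x f_ n x @[n --> \oo] --> \int[mu]_x f x.
Proof.
move=> mf ff iG fG.
have mf' n : measurable_fun setT (EFin \o f_ n) by exact/measurable_EFinP.
have mlim : measurable_fun setT (EFin \o f).
  apply/measurable_EFinP.
  by apply: (measurable_fun_cvg (h := f_)) => // x _; exact: ff.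
have cvgE x : setT x -> (EFin \o f_ n) x @[n --> \oo] --> (EFin \o f) x.
  by move=> _; apply/fine_cvgP; split; [exact: nearW|exact: ff].
have domE n x : setT x -> (`|(EFin \o f_ n) x| <= (EFin \o G) x)%E.
  by move=> _; rewrite /= lee_fin.
have [intf _] := dominated_convergence measurableT mf' mlim (aeW _ cvgE) iG
  (aeW _ (fun x n => domE n x)).
rewrite -[X in _ --> X]fineK; last exact: integrable_fin_num.
by move/fine_cvg.
Qed.

Section normal_density.
Context (R : realType) (m s : R).
Hypothesis s0 : s != 0.
Let mu := @lebesgue_measure R.
Let phi : R -> R := normal_pdf m s.

Lemma is_derive_normal_pdf (x : R) :
  is_derive x 1 phi (- (x - m) / s ^+ 2 * phi x).
Proof.
have s2 : s ^+ 2 != 0 by rewrite expf_neq0.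
rewrite /phi normal_pdfE// /normal_fun.
apply: is_derive_eq.
rewrite /GRing.scale/=.
by field.
Qed.

(** With [v = (x - m)^2 / (8 s^2)] the two densities carry [exp(-4v)] and [exp(-v)], and
    [1 + v <= exp v] absorbs the weight. The dominating function is again a normal density, so it is
    integrable and the bound can be iterated. *)
Lemma quad_normal_pdf_le (x : R) :
  (1 + (x - m) ^+ 2) * phi x <=
  (1 + 8 * s ^+ 2) * (normal_peak s / normal_peak (2 * s)) *
    normal_pdf m (2 * s) x.
Proof.
have s20 : 2 * s != 0 by rewrite mulf_neq0// pnatr_eq0.
have s2 : 0 < s ^+ 2 by rewrite lt0r sqr_ge0 expf_neq0.
rewrite /phi !normal_pdfE// /normal_fun.
have p0 := normal_peak_gt0 s0; have p20 := normal_peak_gt0 s20.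
set v := (x - m) ^+ 2 / (8 * s ^+ 2).
have v0 : 0 <= v by rewrite divr_ge0 ?sqr_ge0// mulr_ge0// ltW.
have -> : - (x - m) ^+ 2 / (s ^+ 2 *+ 2) = - (4 * v).
  by rewrite /v; field.
have -> : - (x - m) ^+ 2 / ((2 * s) ^+ 2 *+ 2) = - v.
  by rewrite /v; field.
have -> : (x - m) ^+ 2 = 8 * s ^+ 2 * v.
  by rewrite /v; field.
rewrite [leRHS](_ : _ = (1 + 8 * s ^+ 2) * (normal_peak s * expR (- v))); last first.
  by field; rewrite gt_eqF.
rewrite mulrCA [leRHS]mulrCA ler_pM2l//.
have e1 : 1 + v <= expR v by exact: expR_ge1Dx.
have e2 : expR (- (4 * v)) * expR v <= expR (- v).
  by rewrite -expRD ler_expR; lra.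
have e3 := expR_ge0 (- (4 * v)).
have h : (1 + 8 * s ^+ 2 * v) <= (1 + 8 * s ^+ 2) * (1 + v).
  rewrite mulrDr mulr1 mulrDl mul1r; nra.
apply: (@le_trans _ _ ((1 + 8 * s ^+ 2) * ((1 + v) * expR (- (4 * v))))).
  by rewrite mulrA ler_wpM2r.
rewrite ler_pM2l; last by rewrite addr_gt0// mulr_gt0.
by apply: le_trans e2; rewrite mulrC ler_wpM2l.
Qed.

End normal_density.

Section normal_integrals.
Context (R : realType) (m s : R).
Hypothesis s0 : s != 0.
Let mu := @lebesgue_measure R.
Let phi : R -> R := normal_pdf m s.

Lemma integrable_quad_normal (C : R) (f : R -> R) : measurable_fun setT f ->
  (forall x, `|f x| <= C * (1 + (x - m) ^+ 2)) ->
  mu.-integrable setT (fun x => (f x * phi x)%:E).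
Proof.
move=> mf fC.
have C0 : 0 <= C.
  have := fC m; rewrite subrr expr0n/= addr0 mulr1.
  by apply: le_trans; exact: normr_ge0.
set D := (1 + 8 * s ^+ 2) * (normal_peak s / normal_peak (2 * s)).
apply: (@le_integrable _ _ _ mu _ measurableT _
  (fun x => (C * D)%:E * (normal_pdf m (2 * s) x)%:E)%E).
- apply/measurable_EFinP; apply: measurable_funM => //.
  exact: measurable_normal_pdf.
- move=> x _ /=; rewrite lee_fin normrM [leRHS]ger0_norm; last first.
    rewrite mulr_ge0 ?normal_pdf_ge0// mulr_ge0//.
    by rewrite mulr_ge0 ?divr_ge0 ?normal_peak_ge0// addr_ge0// mulr_ge0// sqr_ge0.
  rewrite (ger0_norm (normal_pdf_ge0 _ _ _)).
  apply: (@le_trans _ _ (C * (1 + (x - m) ^+ 2) * phi x)).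
    by rewrite ler_wpM2r// normal_pdf_ge0.
  rewrite -[leLHS]mulrA -[leRHS]mulrA ler_wpM2l//.
  exact: quad_normal_pdf_le.
- by apply: integrableZl => //; exact: integrable_normal_pdf.
Qed.


(** Two rounds of [quad_normal_pdf_le], ending at deviation [4 s]. The decay kills the boundary
    terms in Stein's identity. *)
Lemma quad_normal_pdf_decay : exists2 D : R, 0 <= D & forall x,
  (1 + (x - m) ^+ 2) * phi x <= D / (1 + (x - m) ^+ 2).
Proof.
pose c r : R := (1 + 8 * r ^+ 2) * (normal_peak r / normal_peak (2 * r)).
have c_ge0 r : 0 <= c r.
  rewrite mulr_ge0// ?divr_ge0 ?normal_peak_ge0// addr_ge0// mulr_ge0//.
  exact: sqr_ge0.
exists (c s * (c (2 * s) * normal_peak (2 * (2 * s)))).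
  by apply: mulr_ge0 => //; apply: mulr_ge0 => //; exact: normal_peak_ge0.
move=> x; have q0 : 0 < 1 + (x - m) ^+ 2 by rewrite ltr_pwDl// sqr_ge0.
have s20 : 2 * s != 0 by rewrite mulf_neq0// pnatr_eq0.
rewrite ler_pdivlMr//; apply: (@le_trans _ _ (c s * normal_pdf m (2 * s) x * (1 + (x - m) ^+ 2))).
  by rewrite ler_pM2r//; exact: quad_normal_pdf_le.
rewrite -mulrA ler_wpM2l// mulrC.
apply: le_trans (quad_normal_pdf_le m s20 x) _.
apply: ler_wpM2l; first exact: c_ge0.
by apply: normal_pdf_ub; rewrite mulf_neq0// pnatr_eq0.
Qed.

(* Stein's identity: [(F phi)' = F' phi - (x - m) F phi / s^2] has integral 0. *)
Lemma stein_normal (C : R) (F f : R -> R) :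
  (forall x : R, is_derive x 1 F (f x)) -> continuous f ->
  (forall x, `|F x| <= C * (1 + (x - m) ^+ 2)) ->
  (forall x, `|f x| <= C * (1 + (x - m) ^+ 2)) ->
  (forall x, `|(x - m) * F x| <= C * (1 + (x - m) ^+ 2)) ->
  \int[mu]_x ((x - m) * F x * phi x) = s ^+ 2 * \int[mu]_x (f x * phi x).
Proof.
move=> dF cf FC fC xFC.
have s2 : 0 < s ^+ 2 by rewrite lt0r sqr_ge0 expf_neq0.
have cF : continuous F.
  by move=> x; apply: differentiable_continuous; apply/derivable1_diffP; case: (dF x).
have cphi : continuous phi by exact: continuous_normal_pdf.
have mf : measurable_fun setT f by exact: continuous_measurable_fun.
have mF : measurable_fun setT F by exact: continuous_measurable_fun.
have mxF : measurable_fun setT (fun x : R => (x - m) * F x).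
  by apply: measurable_funM => //; exact: measurable_funB.
have if_ := integrable_quad_normal mf fC.
have ixF := integrable_quad_normal mxF xFC.
pose g x := f x * phi x - (s ^+ 2)^-1 * ((x - m) * F x * phi x).
have ixF' : mu.-integrable setT
    (fun x => ((s ^+ 2)^-1 * ((x - m) * F x * phi x))%:E).
  under eq_fun do rewrite EFinM.
  exact: integrableZl.
have ig : mu.-integrable setT (EFin \o g).
  rewrite (_ : _ \o _ = (fun x => (f x * phi x)%:E - ((s ^+ 2)^-1 * ((x - m) * F x * phi x))%:E)%E) //.
  exact: integrableB.
suff g0 : \int[mu]_x g x = 0.
  move: g0; rewrite /g RintegralB// RintegralZl//.
  move/eqP; rewrite subr_eq0 => /eqP ->.
  by rewrite mulrA divff ?mul1r// gt_eqF.
have cg : continuous g.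
  move=> x; apply: (@cvgB _ R^o); apply: (@cvgM R).
  - exact: cf.
  - exact: cphi.
  - exact: cvg_cst.
  - apply: (@cvgM R); last exact: cphi.
    apply: (@cvgM R); last exact: cF.
    by apply: (@cvgB _ R^o); [exact: cvg_id|exact: cvg_cst].
pose G x := F x * phi x.
have dG (x : R) : is_derive x 1 G (g x).
  have d1 := dF x; have d2 := @is_derive_normal_pdf R m s s0 x.
  apply: (is_derive_eq (is_deriveM _ _)); rewrite /GRing.scale/= /g /phi.
  by field.
have cG : continuous G.
  by move=> x; apply: (@cvgM R); [exact: cF|exact: cphi].
have FTC (n : nat) : \int[mu]_(x in `[m - n.+1%:R, m + n.+1%:R]) g x =
    G (m + n.+1%:R) - G (m - n.+1%:R).
  rewrite /Rintegral (@continuous_FTC2 _ g G)//.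
  - by rewrite ltrD2l gtrN// ltr0n.
  - exact: continuous_subspaceT.
  - split.
    + by move=> x _; case: (dG x).
    + apply: cvg_at_right_filter; exact: cG.
    + apply: cvg_at_left_filter; exact: cG.
  - by move=> x _; rewrite derive1E; have [_ ->] := dG x.
have lim1 : \int[mu]_(x in `[m - n.+1%:R, m + n.+1%:R]) g x @[n --> \oo] --> \int[mu]_x g x.
  under eq_fun do rewrite Rintegral_mkcond.
  apply: (@dominated_Rcvg _ _ _ mu _ _ (fun x => `|g x|)).
  - move=> n; apply/(measurable_restrictT _ _).1 => //.
    by apply: measurable_funTS; exact: continuous_measurable_fun.
  - move=> x; apply: cvg_near_cst.
    near=> n; rewrite patchE mem_set//= in_itv/=.
    rewrite -ler_distl distrC.
    apply: (@le_trans _ _ n%:R); last by rewrite ler_nat.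
    by near: n; exact: nbhs_infty_ger.
  - exact: integrable_abse ig.
  - by move=> n x; rewrite patchE; case: ifPn => // _; rewrite normr0.
have lim2 : (fun n : nat => G (m + n.+1%:R) - G (m - n.+1%:R)) @ \oo --> 0.
  have [D D0 phiD] := quad_normal_pdf_decay.
  have C0 : 0 <= C.
    have := FC m; rewrite subrr expr0n/= addr0 mulr1.
    by apply: le_trans; exact: normr_ge0.
  have Gb x : `|G x| <= C * (D / (1 + (x - m) ^+ 2)).
    rewrite normrM (ger0_norm (normal_pdf_ge0 _ _ _)).
    apply: (@le_trans _ _ (C * (1 + (x - m) ^+ 2) * phi x)).
      by rewrite ler_wpM2r ?normal_pdf_ge0.
    by rewrite -mulrA ler_wpM2l.
  apply/norm_cvg0P.
  apply: (@squeeze_cvgr _ _ _ _ (cst 0) (fun n => 2 * C * D * n.+1%:R^-1)).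
  - apply: nearW => n; rewrite normr_ge0/= (le_trans (ler_normB _ _))//.
    have q : (1 + n.+1%:R ^+ 2 : R)^-1 <= n.+1%:R^-1.
      rewrite lef_pV2 ?posrE ?ltr0n// ?ltr_pwDl ?sqr_ge0//.
      by set a : R := n.+1%:R; have := sqr_ge0 (a - 1); nra.
    have := Gb (m + n.+1%:R); have := Gb (m - n.+1%:R).
    have -> : (m - n.+1%:R - m) ^+ 2 = n.+1%:R ^+ 2 :> R by ring.
    have -> : (m + n.+1%:R - m) ^+ 2 = n.+1%:R ^+ 2 :> R by ring.
    move=> h1 h2.
    have := ler_wpM2l (mulr_ge0 C0 D0) q; move: h1 h2; rewrite !mulrA.
    set a := _^-1; set b := _^-1; lra.
  - exact: cvg_cst.
  - rewrite -[X in _ --> X](mulr0 (2 * C * D)).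
    by apply: (@cvgM R); [exact: cvg_cst|exact: cvg_harmonic].
move: lim1; under eq_fun do rewrite FTC.
by move=> /(cvg_unique _ lim2) <-.
Unshelve. all: end_near. Qed.

End normal_integrals.

Section normal_moments.
Context (R : realType) (m s : R).
Hypothesis s0 : s != 0.
Let mu := @lebesgue_measure R.
Let phi : R -> R := normal_pdf m s.

Lemma Rintegral_normal_pdf : \int[mu]_x (normal_pdf m s x) = 1.
Proof. by rewrite /Rintegral integral_normal_pdf. Qed.

Let norm_le (y : R) : `|y| <= 1 + y ^+ 2.
Proof. have := sqr_ge0 (`|y| - 1); rewrite sqrrB1 real_normK ?num_real//; have := normr_ge0 y; nra. Qed.

Lemma mean_normal : \int[mu]_x ((x - m) * phi x) = 0.
Proof.
have /= := @stein_normal R m s s0 1 (cst 1) (cst 0).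
under eq_Rintegral do rewrite /= mulr1.
move=> ->.
- by rewrite mulrC; under eq_Rintegral do rewrite mul0r; rewrite Rintegral_cst// mul0r mul0r.
- by move=> x; exact: cvg_cst.
- by move=> x; rewrite normr1 mul1r lerDl sqr_ge0.
- by move=> x; rewrite normr0 mul1r addr_ge0// sqr_ge0.
- by move=> x; rewrite mulr1 mul1r.
Qed.

Lemma variance_normal : \int[mu]_x ((x - m) ^+ 2 * phi x) = s ^+ 2.
Proof.
have dF (x : R) : is_derive x 1 (fun x => x - m) 1.
  by apply: is_derive_eq; rewrite subr0.
under eq_Rintegral do rewrite expr2.
rewrite (@stein_normal R m s s0 1 _ _ dF).
- by under eq_Rintegral do rewrite mul1r; rewrite Rintegral_normal_pdf mulr1.
- by move=> x; exact: cvg_cst.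
- by move=> x; rewrite mul1r.
- by move=> x; rewrite normr1 mul1r lerDl sqr_ge0.
- by move=> x; rewrite -expr2 ger0_norm ?sqr_ge0// mul1r lerDr.
Qed.

Lemma gauss_ode (u : R -> R) :
  (forall t : R, is_derive t 1 u (- (s ^+ 2) * t * u t)) ->
  forall t, u t = u 0 * expR (- (s ^+ 2 * t ^+ 2 / 2)).
Proof.
move=> du t.
pose w t := u t * expR (s ^+ 2 * t ^+ 2 / 2).
have dw (x : R) : is_derive x 1 w 0.
  have d1 := du x.
  have d2 : is_derive x 1 (fun t : R => expR (s ^+ 2 * t ^+ 2 / 2))
      (s ^+ 2 * x * expR (s ^+ 2 * x ^+ 2 / 2)).
    by apply: is_derive_eq; rewrite /GRing.scale/=; field.
  apply: (is_derive_eq (is_deriveM _ _)); rewrite /GRing.scale/=; ring.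
have := is_derive_0_is_cst t 0 dw.
rewrite /w expr0n/= mulr0 mul0r expR0 mulr1 => <-.
by rewrite -mulrA -expRD subrr expR0 mulr1.
Qed.

Let dom_trig (F : R -> R) : measurable_fun setT F ->
  (forall x, `|F x| <= 1) -> mu.-integrable setT (fun x => (F x * phi x)%:E).
Proof.
move=> mF F1; apply: (@integrable_quad_normal _ _ _ s0 1) => // x.
by rewrite mul1r (le_trans (F1 x))// lerDl sqr_ge0.
Qed.

(** Differentiating under the integral brings out a factor [x - m], which Stein's identity trades
    for [s^2 t] and one more derivative of [g]. When [g'' = - g] this is the equation solved by
    [gauss_ode]. *)
Let derive_trig (g g' g'' : R -> R) :
  (forall x : R, is_derive x 1 g (g' x)) ->
  (forall x : R, is_derive x 1 g' (g'' x)) -> continuous g'' ->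
  (forall x, `|g x| <= 1) -> (forall x, `|g' x| <= 1) ->
  (forall x, `|g'' x| <= 1) ->
  forall t : R, is_derive t 1 (fun t => \int[mu]_x (g (t * (x - m)) * phi x))
    (s ^+ 2 * t * \int[mu]_x (g'' (t * (x - m)) * phi x)).
Proof.
move=> dg dg' cg'' g1 g'1 g''1 t.
have cont (h h' : R -> R) : (forall x : R, is_derive x 1 h (h' x)) -> continuous h.
  move=> dh x; apply: differentiable_continuous; apply/derivable1_diffP.
  by case: (dh x).
have cl (r : R) : continuous (fun x : R => r * (x - m)).
  move=> x; apply: (@cvgM R); first exact: cvg_cst.
  by apply: (@cvgB _ R^o); [exact: cvg_id|exact: cvg_cst].
have mcomp (h : R -> R) (r : R) : continuous h -> measurable_fun setT (fun x : R => h (r * (x - m))).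
  move=> ch; apply: continuous_measurable_fun => x.
  exact: (@continuous_comp _ _ _ (fun x : R => r * (x - m)) h _ (cl r x) (ch _)).
pose f (r x : R) := g (r * (x - m)) * phi x.
have dlin (x r : R) : is_derive r 1 (fun r => r * (x - m)) (x - m).
  apply: (is_derive_eq (is_deriveM (is_derive_id _ _) (is_derive_cst _ _ _))).
  by rewrite scaler0 add0r; exact: mulr1.
have df (x r : R) : is_derive r 1 (f^~ x) ((x - m) * g' (r * (x - m)) * phi x).
  have d1 := dg (r * (x - m)).
  have d2 := @is_derive1_comp _ g (fun r => r * (x - m)) r _ _ d1 (dlin x r).
  apply: (is_derive_eq (is_deriveM d2 (is_derive_cst _ _ _))).
  by rewrite scaler0 add0r -[LHS]/(phi x * (g' (r * (x - m)) * (x - m))); ring.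
pose G x := (1 + (x - m) ^+ 2) * phi x.
have iG : mu.-integrable setT (EFin \o G).
  apply: (@integrable_quad_normal _ _ _ s0 1 (fun x => 1 + (x - m) ^+ 2)).
    by apply: measurable_funD => //; apply: measurable_funX; exact: measurable_funB.
  by move=> x; rewrite ger0_norm ?mul1r// addr_ge0// sqr_ge0.
have ta : [set` `]t - 1, t + 1[] t.
  by rewrite /= in_itv/= ltrDl ltrBlDr ltrDl ltr01.
have intf (r : R) : [set` `]t - 1, t + 1[] r -> mu.-integrable setT (EFin \o f r).
  by move=> _; apply: dom_trig => //; apply: mcomp; exact: cont dg.
have df1 (r x : R) : [set` `]t - 1, t + 1[] r -> setT x -> derivable (f^~ x) r 1.
  by move=> _ _; case: (df x r).
have pE (r x : R) : partial1of2 f r x = (x - m) * g' (r * (x - m)) * phi x.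
  by rewrite partial1of2E; have [_ ->] := df x r.
have G0 x : 0 <= G x by rewrite mulr_ge0 ?normal_pdf_ge0// addr_ge0// sqr_ge0.
have fG (r x : R) : [set` `]t - 1, t + 1[] r -> setT x -> `|partial1of2 f r x| <= G x.
  move=> _ _; rewrite pE normrM (ger0_norm (normal_pdf_ge0 _ _ _)).
  rewrite ler_wpM2r ?normal_pdf_ge0// normrM.
  apply: (@le_trans _ _ `|x - m|); last exact: norm_le.
  by rewrite ler_piMr.
have der := derivable_under_integral measurableT ta intf df1 G0 iG fG.
have val := differentiation_under_integral measurableT ta intf df1 G0 iG fG.
apply: DeriveDef => //.
rewrite -derive1E val.
under eq_Rintegral do rewrite pE.
have dF (x : R) : is_derive x 1 (fun x => g' (t * (x - m))) (t * g'' (t * (x - m))).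
  have d2 : is_derive x 1 (fun x => t * (x - m)) t.
    by apply: is_derive_eq; rewrite subr0; exact: mulr1.
  rewrite mulrC.
  exact: (@is_derive1_comp _ g' (fun x : R => t * (x - m)) x _ _ (dg' _) d2).
have b x : 1 <= 1 + (x - m) ^+ 2 by rewrite lerDl sqr_ge0.
rewrite (@stein_normal R m s s0 (1 + `|t|) _ _ dF).
- under eq_Rintegral do rewrite -mulrA.
  rewrite RintegralZl//; first by rewrite mulrA.
  by apply: dom_trig => //; exact: mcomp.
- move=> x; apply: (@cvgM R); first exact: cvg_cst.
  exact: (@continuous_comp _ _ _ (fun x : R => t * (x - m)) g'' _ (cl t x) (cg'' _)).
- move=> x; apply: (@le_trans _ _ (1 * 1)); first by rewrite mulr1.
  by apply: ler_pM => //; rewrite lerDl.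
- move=> x; rewrite normrM; apply: ler_pM => //; first by rewrite lerDr.
  exact: le_trans (b x).
- move=> x; rewrite normrM; apply: (@le_trans _ _ (1 * (1 + (x - m) ^+ 2))).
    by rewrite mul1r (le_trans _ (norm_le _))// ler_piMr.
  by rewrite ler_wpM2r ?(le_trans _ (b x))// lerDl.
Qed.

Lemma cos_normal (t : R) :
  \int[mu]_x (cos (t * (x - m)) * phi x) = expR (- (s ^+ 2 * t ^+ 2 / 2)).
Proof.
have b1 (x : R) : `|cos x| <= 1 by rewrite ler_norml cos_geN1 cos_le1.
have b2 (x : R) : `|sin x| <= 1 by rewrite ler_norml sin_geN1 sin_le1.
have mc (r : R) : measurable_fun setT (fun x : R => cos (r * (x - m))).
  apply: continuous_measurable_fun => x.
  apply: (@continuous_comp _ _ _ (fun x : R => r * (x - m)) cos); last exact: continuous_cos.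
  apply: (@cvgM R); first exact: cvg_cst.
  by apply: (@cvgB _ R^o); [exact: cvg_id|exact: cvg_cst].
have du (r : R) : is_derive r 1 (fun t => \int[mu]_x (cos (t * (x - m)) * phi x))
    (- (s ^+ 2) * r * \int[mu]_x (cos (r * (x - m)) * phi x)).
  apply: is_derive_eq.
    apply: (@derive_trig cos (- sin) (- cos)) => //.
    - by move=> x; apply: (@cvgN _ R^o); exact: continuous_cos.
    - by move=> x; rewrite normrN.
    - by move=> x; rewrite normrN.
  under eq_Rintegral do rewrite fctE mulNr -mulN1r.
  rewrite RintegralZl//; first by rewrite mulN1r mulrN !mulNr.
  exact: dom_trig.
rewrite (gauss_ode du) -[RHS]mul1r; congr (_ * _).
by under eq_Rintegral do rewrite mul0r cos0 mul1r; exact: Rintegral_normal_pdf.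
Qed.

Lemma sin_normal (t : R) : \int[mu]_x (sin (t * (x - m)) * phi x) = 0.
Proof.
have b1 (x : R) : `|cos x| <= 1 by rewrite ler_norml cos_geN1 cos_le1.
have b2 (x : R) : `|sin x| <= 1 by rewrite ler_norml sin_geN1 sin_le1.
have mc (r : R) : measurable_fun setT (fun x : R => sin (r * (x - m))).
  apply: continuous_measurable_fun => x.
  apply: (@continuous_comp _ _ _ (fun x : R => r * (x - m)) sin); last exact: continuous_sin.
  apply: (@cvgM R); first exact: cvg_cst.
  by apply: (@cvgB _ R^o); [exact: cvg_id|exact: cvg_cst].
have du (r : R) : is_derive r 1 (fun t => \int[mu]_x (sin (t * (x - m)) * phi x))
    (- (s ^+ 2) * r * \int[mu]_x (sin (r * (x - m)) * phi x)).
  apply: is_derive_eq.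
    apply: (@derive_trig sin cos (- sin)) => //.
    - by move=> x; apply: (@cvgN _ R^o); exact: continuous_sin.
    - by move=> x; rewrite normrN.
  under eq_Rintegral do rewrite fctE mulNr -mulN1r.
  rewrite RintegralZl//; first by rewrite mulN1r mulrN !mulNr.
  exact: dom_trig.
rewrite (gauss_ode du).
under eq_Rintegral do rewrite mul0r sin0 mul0r.
by rewrite Rintegral_cst// !mul0r.
Qed.

End normal_moments.

Lemma Rintegral_cst_probability d (T : measurableType d) (R : realType)
  (P : probability T R) (c : R) : \int[P]_w c = c.
Proof. by rewrite /Rintegral integral_cst//= probability_setT mule1. Qed.

Section gaussian_moments.
Context d (T : measurableType d) (R : realType) (P : probability T R).
Variables (X : T -> R) (m s : R).
Hypothesis mX : measurable_fun setT X.
Hypothesis lawX : forall A : set R, measurable A ->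
  P (X @^-1` A) = gaussian_law m s A.

Let mu := @lebesgue_measure R.

Lemma gaussian_degenerate : s = 0 -> {ae P, forall w, X w = m}.
Proof.
move=> s0; exists (~` (X @^-1` [set m])); split.
- by apply: measurableC; rewrite -[X in measurable X]setTI; exact: mX.
- rewrite [LHS](_ : _ = P (X @^-1` (~` [set m])))//.
  rewrite lawX /gaussian_law ?s0 ?eqxx; last exact: measurableC.
  by rewrite diracE memNset//=; exact.
- by move=> w /=.
Qed.

(** Quadratic growth covers the mean, the variance and the trigonometric moments at once, the Dirac
    case included. *)
Lemma gaussian_expectation (C : R) (f : R -> R) : measurable_fun setT f ->
  (forall x, `|f x| <= C * (1 + (x - m) ^+ 2)) ->
  P.-integrable setT (fun w => (f (X w))%:E) /\
  \int[P]_w f (X w) =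
    if s == 0 then f m else \int[mu]_x (f x * normal_pdf m s x).
Proof.
move=> mf fC.
have mfX : measurable_fun setT (fun w => f (X w)) by exact: (measurableT_comp mf mX).
case: eqP => [s0|/eqP s0].
  have ae1 : ae_eq P setT (fun w => (f (X w))%:E) (cst (f m)%:E).
    by apply: filterS (gaussian_degenerate s0) => w + _ /=; move=> ->.
  have ic := finite_measure_integrable_cst P (f m) measurableT.
  split.
    apply/integrableP; split; first exact/measurable_EFinP.
    rewrite (@ae_eq_integral _ _ _ P setT (cst `|(f m)%:E|%E))//.
    - by move/integrableP : ic => [].
    - by apply: measurableT_comp => //; exact/measurable_EFinP.
    - by apply: filterS ae1 => w h _; rewrite h.
  rewrite /Rintegral (@ae_eq_integral _ _ _ P setT (cst (f m)%:E))//.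
    by rewrite integral_cst//= probability_setT mule1.
  exact/measurable_EFinP.
have ifp := @integrable_quad_normal R m s s0 C f mf fC.
split; first exact: (@integrable_gaussian _ T R P X m s).
exact: (@Rintegral_gaussian _ T R P X m s).
Qed.

Lemma gaussian_mean : P.-integrable setT (fun w => (X w)%:E) /\
  \int[P]_w X w = m.
Proof.
have b (x : R) : `|x - m| <= 1 * (1 + (x - m) ^+ 2).
  rewrite mul1r; have := sqr_ge0 (`|x - m| - 1).
  rewrite sqrrB1 real_normK ?num_real//; have := normr_ge0 (x - m); nra.
have mc : measurable_fun setT (fun x : R => x - m) by exact: measurable_funB.
have [i1 e1] := gaussian_expectation mc b.
have ic := finite_measure_integrable_cst P m measurableT.
have i2 : P.-integrable setT (fun w => (X w)%:E).
  rewrite (_ : (fun w => _) = (fun w => (X w - m)%:E + (EFin \o cst m) w)%E).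
    exact: integrableD.
  by apply/funext => w /=; rewrite -EFinD subrK.
split => //; apply/eqP; rewrite -subr_eq0; apply/eqP.
transitivity (\int[P]_w (X w - m)).
  by rewrite [RHS]RintegralB// Rintegral_cst_probability.
rewrite e1; case: ifPn => [_|s0]; first by rewrite subrr.
exact: mean_normal.
Qed.

Lemma gaussian_variance : P.-integrable setT (fun w => ((X w - m) ^+ 2)%:E) /\
  \int[P]_w ((X w - m) ^+ 2) = s ^+ 2.
Proof.
have b (x : R) : `|(x - m) ^+ 2| <= 1 * (1 + (x - m) ^+ 2).
  by rewrite mul1r ger0_norm ?sqr_ge0// lerDr.
have mc : measurable_fun setT (fun x : R => (x - m) ^+ 2).
  by apply: measurable_funX; exact: measurable_funB.
have [i1 e1] := gaussian_expectation mc b; split => //.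
rewrite e1; case: ifPn => [/eqP->|s0]; first by rewrite subrr !expr0n.
exact: variance_normal.
Qed.

Let measurable_trig (h : R -> R) (t : R) : continuous h ->
  measurable_fun setT (fun x : R => h (t * (x - m))).
Proof.
move=> ch; apply: continuous_measurable_fun => x.
apply: (@continuous_comp _ _ _ (fun x : R => t * (x - m)) h); last exact: ch.
apply: (@cvgM R); first exact: cvg_cst.
by apply: (@cvgB _ R^o); [exact: cvg_id|exact: cvg_cst].
Qed.

Lemma gaussian_cos (t : R) :
  \int[P]_w cos (t * (X w - m)) = expR (- (s ^+ 2 * t ^+ 2 / 2)).
Proof.
have b (x : R) : `|cos (t * (x - m))| <= 1 * (1 + (x - m) ^+ 2).
  rewrite mul1r (@le_trans _ _ 1) ?lerDl ?sqr_ge0//.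
  by rewrite ler_norml cos_geN1 cos_le1.
have [_ ->] := gaussian_expectation (measurable_trig t (@continuous_cos R)) b.
case: ifPn => [/eqP->|s0]; last exact: cos_normal.
by rewrite subrr mulr0 cos0 expr0n/= !mul0r oppr0 expR0.
Qed.

Lemma gaussian_sin (t : R) : \int[P]_w sin (t * (X w - m)) = 0.
Proof.
have b (x : R) : `|sin (t * (x - m))| <= 1 * (1 + (x - m) ^+ 2).
  rewrite mul1r (@le_trans _ _ 1) ?lerDl ?sqr_ge0//.
  by rewrite ler_norml sin_geN1 sin_le1.
have [_ ->] := gaussian_expectation (measurable_trig t (@continuous_sin R)) b.
case: ifPn => [_|s0]; last exact: sin_normal.
by rewrite subrr mulr0 sin0.
Qed.

End gaussian_moments.

(** * Gaussian spaces and their covariance *)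

Section gaussian_space.
Context d (T : measurableType d) (R : realType) (P : probability T R).

(** Joint Gaussianity is encoded by stability under linear combinations together with
    one-dimensional laws. The parameter [s] of [gs_law] is determined up to sign only; [gs_lawE]
    normalizes it. *)
Record gaussian_space (S : set (T -> R)) : Prop := {
  gs_measurable : forall X, S X -> measurable_fun setT X;
  gs_add : forall X Y, S X -> S Y -> S (fun w => X w + Y w);
  gs_scale : forall a X, S X -> S (fun w => a * X w);
  gs_law : forall X, S X -> exists s, forall A : set R, measurable A ->
    P (X @^-1` A) = gaussian_law 0 s A }.

(** The members of a Gaussian space are centered, so their covariance is this second moment. *)
Definition cov (X Y : T -> R) : R := \int[P]_w (X w * Y w).

Variable S : set (T -> R).
Hypothesis gS : gaussian_space S.

Lemma gs_sum n (a : nat -> R) (X : nat -> T -> R) X0 : S X0 ->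
  (forall i, (i < n)%N -> S (X i)) ->
  S (fun w => \sum_(i < n) a i * X i w).
Proof.
move=> SX0; elim: n => [|n IH] SX.
  have := gs_scale gS 0 SX0; congr S; apply/funext => w.
  by rewrite big_ord0 mul0r.
have := gs_add gS (IH (fun i h => SX i (ltnW h))) (gs_scale gS (a n) (SX n (ltnSn n))).
by congr S; apply/funext => w; rewrite big_ord_recr.
Qed.

Lemma gs_sub X Y : S X -> S Y -> S (fun w => X w - Y w).
Proof.
move=> SX SY; have := gs_add gS SX (gs_scale gS (-1) SY).
by congr S; apply/funext => w; rewrite mulN1r.
Qed.

Lemma gs_integrable_sqr X : S X -> P.-integrable setT (fun w => (X w ^+ 2)%:E).
Proof.
move=> SX; have [s law] := gs_law gS SX.
have [+ _] := gaussian_variance (gs_measurable gS SX) law.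
by congr (_.-integrable _ _); apply/funext => w; rewrite subr0.
Qed.

Lemma gs_integrableM X Y : S X -> S Y ->
  P.-integrable setT (fun w => (X w * Y w)%:E).
Proof.
move=> SX SY.
have i := integrableD measurableT (gs_integrable_sqr SX) (gs_integrable_sqr SY).
apply: le_integrable i => //.
  by apply/measurable_EFinP; apply: measurable_funM; exact: (gs_measurable gS).
move=> w _ /=; rewrite lee_fin [leRHS]ger0_norm ?addr_ge0 ?sqr_ge0//.
rewrite normrM -(real_normK (num_real (X w))) -(real_normK (num_real (Y w))).
have := sqr_ge0 (`|X w| - `|Y w|); have := normr_ge0 (X w).
by have := normr_ge0 (Y w); nra.
Qed.

Lemma gs_lawE X : S X -> forall A : set R, measurable A ->
  P (X @^-1` A) = gaussian_law 0 (Num.sqrt (cov X X)) A.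
Proof.
move=> SX A mA; have [s law] := gs_law gS SX.
have [_ +] := gaussian_variance (gs_measurable gS SX) law.
under eq_Rintegral do rewrite subr0 expr2.
rewrite -/(cov X X) => ->; rewrite (law _ mA) sqrtr_sqr.
rewrite /gaussian_law normr_eq0; case: eqP => [_|_]; first reflexivity.
rewrite /normal_prob; apply: eq_integral => x _.
by rewrite /normal_pdf normr_eq0 /normal_peak /normal_fun real_normK ?num_real.
Qed.

Lemma gs_cos X : S X -> \int[P]_w cos (X w) = expR (- (cov X X / 2)).
Proof.
move=> SX; have [s law] := gs_law gS SX.
have mX := gs_measurable gS SX.
have [_ +] := gaussian_variance mX law.
under eq_Rintegral do rewrite subr0 expr2.
rewrite -/(cov X X) => ->.
have := gaussian_cos mX law 1.
under eq_Rintegral do rewrite subr0 mul1r.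
by move=> ->; rewrite expr1n mulr1.
Qed.

Lemma gs_sin X : S X -> \int[P]_w sin (X w) = 0.
Proof.
move=> SX; have [s law] := gs_law gS SX.
have := gaussian_sin (gs_measurable gS SX) law 1.
by under eq_Rintegral do rewrite subr0 mul1r.
Qed.

Lemma covC X Y : cov X Y = cov Y X.
Proof. by apply: eq_Rintegral => w _; rewrite mulrC. Qed.

Lemma covDl X Y Z : S X -> S Y -> S Z ->
  cov (fun w => X w + Y w) Z = cov X Z + cov Y Z.
Proof.
move=> SX SY SZ; rewrite /cov -RintegralD//; last 2 first.
- exact: gs_integrableM.
- exact: gs_integrableM.
by apply: eq_Rintegral => w _; rewrite mulrDl.
Qed.

Lemma covZl a X Z : S X -> S Z -> cov (fun w => a * X w) Z = a * cov X Z.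
Proof.
move=> SX SZ; rewrite /cov -RintegralZl//; last exact: gs_integrableM.
by apply: eq_Rintegral => w _; rewrite mulrA.
Qed.

Lemma cov_suml n (a : nat -> R) (X : nat -> T -> R) Z : S Z ->
  (forall i, (i < n)%N -> S (X i)) ->
  cov (fun w => \sum_(i < n) a i * X i w) Z = \sum_(i < n) a i * cov (X i) Z.
Proof.
move=> SZ; elim: n => [|n IH] SX.
  rewrite big_ord0 /cov; under eq_Rintegral do rewrite big_ord0 mul0r.
  by rewrite Rintegral_cst// mul0r.
rewrite big_ord_recr/= -IH; last by move=> i /ltnW; exact: SX.
rewrite -covZl//; last exact: SX.
rewrite -covDl//.
- by apply: eq_Rintegral => w _; rewrite big_ord_recr.
- by apply: gs_sum => // [|i /ltnW]; [exact: SZ|exact: SX].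
- by apply: gs_scale => //; exact: SX.
Qed.

Lemma cov_sum n (a : nat -> R) (X : nat -> T -> R) Z : S Z ->
  (forall i, (i < n)%N -> S (X i)) ->
  cov (fun w => \sum_(i < n) a i * X i w) (fun w => \sum_(i < n) a i * X i w) =
  \sum_(i < n) \sum_(j < n) a i * a j * cov (X i) (X j).
Proof.
move=> SZ SX; have SS := gs_sum a SZ SX.
rewrite cov_suml//; apply: eq_bigr => i _.
rewrite covC cov_suml//; last exact: SX.
by rewrite mulr_sumr; apply: eq_bigr => j _; rewrite mulrA covC.
Qed.

Lemma cov_ge0 X : 0 <= cov X X.
Proof. by apply: Rintegral_ge0 => w _; rewrite -expr2 sqr_ge0. Qed.

Lemma cov0_ae X : S X -> cov X X = 0 -> {ae P, forall w, X w = 0}.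
Proof.
move=> SX X0; have [s law] := gs_law gS SX.
have [_ +] := gaussian_variance (gs_measurable gS SX) law.
under eq_Rintegral do rewrite subr0 expr2.
rewrite -/(cov X X) X0 => /esym/eqP; rewrite expf_eq0/= => /eqP s0.
exact: (gaussian_degenerate (gs_measurable gS SX) law s0).
Qed.

End gaussian_space.

(** * Fourier uniqueness tested on symmetric boxes *)

Section bounded_measurable.
Context d (T : measurableType d) (R : realType).

Definition bmeas (f : T -> R) : Prop :=
  measurable_fun setT f /\ exists C, forall x, `|f x| <= C.

Lemma bmeas_integrable (P : probability T R) f : bmeas f ->
  P.-integrable setT (fun x => (f x)%:E).
Proof.
move=> [mf [C fC]].
apply: (@le_integrable _ _ _ P _ measurableT _ (EFin \o cst C)).
- exact/measurable_EFinP.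
- by move=> x _ /=; rewrite lee_fin (le_trans (fC x))// ler_norm.
- exact: finite_measure_integrable_cst.
Qed.

Lemma bmeas_cst c : bmeas (cst c).
Proof. by split; [exact: measurable_cst|exists `|c|]. Qed.

Lemma bmeasD f g : bmeas f -> bmeas g -> bmeas (fun x => f x + g x).
Proof.
move=> [mf [C fC]] [mg [D gD]]; split; first exact: measurable_funD.
by exists (C + D) => x; rewrite (le_trans (ler_normD _ _))// lerD.
Qed.

Lemma bmeasM f g : bmeas f -> bmeas g -> bmeas (fun x => f x * g x).
Proof.
move=> [mf [C fC]] [mg [D gD]]; split; first exact: measurable_funM.
by exists (C * D) => x; rewrite normrM ler_pM.
Qed.

Lemma bmeas_cos f : measurable_fun setT f -> bmeas (fun x => cos (f x)).
Proof.
move=> mf; split.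
  apply: (measurableT_comp _ mf).
  by apply: continuous_measurable_fun => x; exact: continuous_cos.
by exists 1 => x; rewrite ler_norml cos_geN1 cos_le1.
Qed.

End bounded_measurable.

(* The class of the functions [f] such that multiplying by [f (U i)], resp.
   [f (V i)], preserves equality of the Fourier transforms is closed under
   sums, products, the map [f |-> 1 / (1 + f)] and bounded pointwise limits. It
   contains cosines, hence the indicators of symmetric intervals. *)
Section fourier_uniqueness.
Context d1 (T1 : measurableType d1) d2 (T2 : measurableType d2) (R : realType).
Variables (P1 : probability T1 R) (P2 : probability T2 R).
Variables (n : nat) (U : nat -> T1 -> R) (V : nat -> T2 -> R).
Hypothesis mU : forall i, (i < n)%N -> measurable_fun setT (U i).
Hypothesis mV : forall i, (i < n)%N -> measurable_fun setT (V i).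
Hypothesis UV : forall (t : nat -> R) (th : R),
  \int[P1]_w cos (\sum_(i < n) t i * U i w + th) =
  \int[P2]_w cos (\sum_(i < n) t i * V i w + th).

Let lin (T : Type) (W : nat -> T -> R) (t : nat -> R) (th : R) w :=
  \sum_(i < n) t i * W i w + th.

(** The free phase [th] lets real cosines carry both the real and the imaginary part of the
    transform. *)
Let good (F : T1 -> R) (G : T2 -> R) : Prop := [/\ bmeas F, bmeas G &
  forall t th, \int[P1]_w (F w * cos (lin U t th w)) =
               \int[P2]_w (G w * cos (lin V t th w))].

Let mult (f : R -> R) : Prop := bmeas f /\ forall i, (i < n)%N ->
  forall F G, good F G -> good (fun w => F w * f (U i w)) (fun w => G w * f (V i w)).

Let mlin d (T : measurableType d) (W : nat -> T -> R) t th :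
  (forall i, (i < n)%N -> measurable_fun setT (W i)) ->
  measurable_fun setT (lin W t th).
Proof.
move=> mW; apply: measurable_funD => //.
by apply: measurable_sum => i; apply: measurable_funM => //; exact: mW.
Qed.

Let bcomp d (T : measurableType d) (f : R -> R) (X : T -> R) :
  bmeas f -> measurable_fun setT X -> bmeas (fun w => f (X w)).
Proof.
by move=> [mf [C fC]] mX; split; [exact: measurableT_comp|exists C => w; exact: fC].
Qed.

Let intU F t th : bmeas F -> P1.-integrable setT (fun w => (F w * cos (lin U t th w))%:E).
Proof. by move=> bF; apply/bmeas_integrable/bmeasM => //; apply: bmeas_cos; exact: mlin. Qed.

Let intV G t th : bmeas G -> P2.-integrable setT (fun w => (G w * cos (lin V t th w))%:E).
Proof. by move=> bF; apply/bmeas_integrable/bmeasM => //; apply: bmeas_cos; exact: mlin. Qed.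

Let goodD F G F' G' : good F G -> good F' G' ->
  good (fun w => F w + F' w) (fun w => G w + G' w).
Proof.
move=> [bF bG FG] [bF' bG' FG']; split; [exact: bmeasD|exact: bmeasD|] => t th.
under eq_Rintegral do rewrite mulrDl.
under [RHS]eq_Rintegral do rewrite mulrDl.
by rewrite !RintegralD//; [rewrite FG FG'|exact: intV|exact: intV|exact: intU|exact: intU].
Qed.

Let goodZ c F G : good F G -> good (fun w => c * F w) (fun w => c * G w).
Proof.
move=> [bF bG FG]; split.
- by apply: bmeasM => //; exact: bmeas_cst.
- by apply: bmeasM => //; exact: bmeas_cst.
move=> t th.
under eq_Rintegral do rewrite -mulrA.
under [RHS]eq_Rintegral do rewrite -mulrA.
by rewrite !RintegralZl//; [rewrite FG|exact: intV|exact: intU].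
Qed.

Let good_eq F G F' G' : good F G -> F =1 F' -> G =1 G' -> good F' G'.
Proof. by move=> + /funext <- /funext <-. Qed.

Let mult_cst c : mult (cst c).
Proof.
split; first exact: bmeas_cst.
by move=> i ni F G /(goodZ c) h; apply: (good_eq h) => w; rewrite mulrC.
Qed.

Let multD f g : mult f -> mult g -> mult (fun x => f x + g x).
Proof.
move=> [bf mf] [bg mg]; split; first exact: bmeasD.
move=> i ni F G h; apply: (good_eq (goodD (mf i ni _ _ h) (mg i ni _ _ h))) => w;
  by rewrite mulrDr.
Qed.

Let multM f g : mult f -> mult g -> mult (fun x => f x * g x).
Proof.
move=> [bf mf] [bg mg]; split; first exact: bmeasM.
move=> i ni F G h; apply: (good_eq (mg i ni _ _ (mf i ni _ _ h))) => w;
  by rewrite mulrA.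
Qed.

Let mult_eq f g : mult f -> f =1 g -> mult g.
Proof. by move=> + /funext <-. Qed.

Let multX f k : mult f -> mult (fun x => f x ^+ k).
Proof.
move=> mf; elim: k => [|k IH].
  by apply: (mult_eq (mult_cst 1)) => x; rewrite expr0.
by apply: (mult_eq (multM mf IH)) => x; rewrite exprS.
Qed.

Let mult_sum (f : nat -> R -> R) N : (forall k, mult (f k)) ->
  mult (fun x => \sum_(k < N) f k x).
Proof.
move=> mf; elim: N => [|N IH].
  by apply: (mult_eq (mult_cst 0)) => x; rewrite big_ord0.
by apply: (mult_eq (multD IH (mf N))) => x; rewrite big_ord_recr.
Qed.

(** Product to sum: the extra cosine shifts the [i]-th frequency by [om] or [- om], and the
    transforms agree at every frequency. *)
Let mult_cos (om : R) : mult (fun x => cos (om * x)).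
Proof.
have mom : measurable_fun setT (fun x : R => om * x) by exact: measurable_funM.
split; first exact: bmeas_cos.
move=> i ni F G [bF bG FG]; split.
- by apply: bmeasM => //; apply: bmeas_cos; apply: measurable_funM => //; exact: mU.
- by apply: bmeasM => //; apply: bmeas_cos; apply: measurable_funM => //; exact: mV.
move=> t th.
pose tp (e : R) j := t j + (if j == i then e * om else 0).
have linE (T : Type) (W : nat -> T -> R) e w :
    lin W (tp e) th w = lin W t th w + e * (om * W i w).
  rewrite /lin addrAC; congr (_ + _).
  under eq_bigr do rewrite mulrDl.
  rewrite big_split/=; congr (_ + _).
  rewrite (bigD1 (Ordinal ni))//= eqxx mulrA big1 ?addr0// => j ji.
  by rewrite ifF ?mul0r//; apply/negbTE; apply: contra ji => /eqP h; apply/eqP/val_inj.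
have prod (a b : R) : cos a * cos b = 2^-1 * (cos (b + 1 * a) + cos (b + (-1) * a)).
  by rewrite mul1r mulN1r cosD cosB; field.
have E (T : Type) (W : nat -> T -> R) (H : T -> R) w :
    H w * cos (om * W i w) * cos (lin W t th w) =
    2^-1 * (H w * cos (lin W (tp 1) th w) + H w * cos (lin W (tp (-1)) th w)).
  by rewrite !linE -mulrA prod; ring.
under eq_Rintegral do rewrite E.
under [RHS]eq_Rintegral do rewrite E.
rewrite !RintegralZl//; last 2 first.
- by apply/bmeas_integrable/bmeasD; apply: bmeasM => //; apply: bmeas_cos; exact: mlin.
- by apply/bmeas_integrable/bmeasD; apply: bmeasM => //; apply: bmeas_cos; exact: mlin.
by rewrite !RintegralD//; [rewrite !FG|exact: intV|exact: intV|exact: intU|exact: intU].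
Qed.

Let mult_lim (f_ : nat -> R -> R) (f : R -> R) (C : R) :
  (forall k, mult (f_ k)) -> (forall k x, `|f_ k x| <= C) ->
  (forall x, f_ k x @[k --> \oo] --> f x) -> mult f.
Proof.
move=> mf fC ff.
have bf : bmeas f.
  split.
    apply: (measurable_fun_cvg (h := f_)) => [k|x _]; last exact: ff.
    by have [[]] := mf k.
  exists C => x; rewrite -(cvg_lim _ (cvg_norm (ff x)))//.
  by apply: limr_le; [apply/cvg_ex; eexists; exact: cvg_norm (ff x)|exact: nearW].
split => // i ni F G gFG.
have [bF bG FG] := gFG.
split.
- by apply: bmeasM => //; apply: bcomp => //; exact: mU.
- by apply: bmeasM => //; apply: bcomp => //; exact: mV.
move=> t th.
have cvgE d (T : measurableType d) (P : probability T R) (W : nat -> T -> R) (H : T -> R) :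
    bmeas H -> (forall i, (i < n)%N -> measurable_fun setT (W i)) ->
    \int[P]_w (H w * f_ k (W i w) * cos (lin W t th w)) @[k --> \oo] -->
    \int[P]_w (H w * f (W i w) * cos (lin W t th w)).
  move=> bH mW; have [_ [D HD]] := bH.
  apply: (dominated_Rcvg (G := cst (D * C))).
  - move=> k.
    have [] : bmeas (fun w => H w * f_ k (W i w) * cos (lin W t th w)) => //.
    apply: bmeasM; last by apply: bmeas_cos; exact: mlin.
    by apply: bmeasM => //; apply: bcomp; [have [] := mf k|exact: mW].
  - move=> w; apply: (@cvgM R); last exact: cvg_cst.
    by apply: (@cvgM R); [exact: cvg_cst|exact: ff].
  - exact: finite_measure_integrable_cst.
  - move=> k w; rewrite /= normrM normrM -[leRHS]mulr1.
    by rewrite ler_pM ?mulr_ge0// ?ler_pM// ler_norml cos_geN1 cos_le1.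
have e k : \int[P1]_w (F w * f_ k (U i w) * cos (lin U t th w)) =
    \int[P2]_w (G w * f_ k (V i w) * cos (lin V t th w)).
  by have [_ /(_ i ni _ _ gFG) [_ _ ->]] := mf k.
have := cvgE _ _ P1 U F bF mU; under eq_fun do rewrite e.
by move/cvg_unique; apply => //; exact: cvgE.
Qed.

(* Geometric series in [(A - f) / (1 + A)], where [A] bounds [f]. *)
Let mult_inv f : mult f -> (forall x, 0 <= f x) -> mult (fun x => (1 + f x)^-1).
Proof.
move=> mf f0; have [[_ [A fA]] _] := mf.
have f1 x : 0 < 1 + f x by rewrite ltr_pwDl.
have A0 : 0 <= A by apply: le_trans (fA 0).
have A1 : 0 < 1 + A by rewrite ltr_pwDl.
have fA' x : f x <= A by rewrite (le_trans _ (fA x))// ler_norm.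
pose q x := (A - f x) / (1 + A).
have q0 x : 0 <= q x by rewrite divr_ge0// ?subr_ge0// ltW.
have q1 x : q x < 1 by rewrite ltr_pdivrMr// mul1r ltrBlDr; have := f0 x; lra.
have mq : mult q.
  apply: (mult_eq (multM (multD (mult_cst A) (multM (mult_cst (-1)) mf)) (mult_cst (1 + A)^-1))).
  by move=> x; rewrite /q /= mulN1r.
have pE N x : (\sum_(k < N) q x ^+ k) / (1 + A) = (1 - q x ^+ N) / (1 + f x).
  have /eqP h := subrX1 (q x) N.
  have e : 1 - q x = (1 + f x) / (1 + A) by rewrite /q; field; rewrite gt_eqF.
  have -> : 1 - q x ^+ N = (1 - q x) * \sum_(k < N) q x ^+ k.
    by apply/eqP; rewrite -(inj_eq oppr_inj) -mulNr !opprB.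
  rewrite e; set S := \sum_(k < N) _; field.
  by rewrite !gt_eqF.
apply: (@mult_lim (fun N x => (\sum_(k < N) q x ^+ k) / (1 + A)) _ 1).
- move=> N; apply: multM; last exact: mult_cst.
  by apply: (@mult_sum (fun k x => q x ^+ k)) => k; exact: multX.
- move=> N x; rewrite pE.
  have h0 : 0 <= 1 - q x ^+ N by rewrite subr_ge0 exprn_ile1// ltW.
  rewrite ger0_norm; last by rewrite divr_ge0// ltW.
  rewrite ler_pdivrMr// mul1r; have := exprn_ge0 N (q0 x); have := f0 x; lra.
- move=> x; rewrite (_ : (fun N => _) = (fun N => (1 - q x ^+ N) / (1 + f x))); last first.
    by apply/funext => N; exact: pE.
  rewrite -[X in _ --> X]mul1r; apply: (@cvgM R); last exact: cvg_cst.
  rewrite -[X in _ --> X]subr0; apply: (@cvgB _ R^o); first exact: cvg_cst.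
  by apply: cvg_expr; rewrite ger0_norm.
Qed.

(** The unbounded [x^2] is approached by [(k+1)^2 sin(x / (k+1))^2], a polynomial in a cosine;
    taking [1 / (1 + f)] before the limit keeps everything bounded by 1. *)
Let mult_quad (lam : R) : 0 < lam -> mult (fun x => (1 + lam * x ^+ 2)^-1).
Proof.
move=> l0.
pose f (k : nat) (x : R) := lam * k.+1%:R ^+ 2 * sin (k.+1%:R^-1 * x) ^+ 2.
have f0 k x : 0 <= f k x.
  by apply: mulr_ge0; [apply: mulr_ge0; [exact: ltW|exact: sqr_ge0]|exact: sqr_ge0].
apply: (@mult_lim (fun k x => (1 + f k x)^-1) _ 1).
- move=> k; apply: mult_inv => //.
  pose c := lam * k.+1%:R ^+ 2.
  apply: (mult_eq (multM (mult_cst c) (multD (mult_cst 1)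
    (multM (mult_cst (-1)) (multX 2 (mult_cos k.+1%:R^-1)))))).
  by move=> x; rewrite /f/= mulN1r sin2cos2.
- move=> k x; rewrite ger0_norm ?invr_ge0 ?addr_ge0//.
  by rewrite invf_le1 ?lerDl// ltr_pwDl.
- move=> x; apply: cvgV.
    by rewrite gt_eqF// ltr_pwDl// mulr_ge0 ?sqr_ge0// ltW.
  apply: (@cvgD _ R^o); first exact: cvg_cst.
  have fE k : f k x = lam * (k.+1%:R * sin (k.+1%:R^-1 * x)) ^+ 2.
    by rewrite exprMn mulrA.
  rewrite (_ : f^~ x = (fun k => lam * (k.+1%:R * sin (k.+1%:R^-1 * x)) ^+ 2)); last exact/funext.
  apply: (@cvgM R); first exact: cvg_cst.
  apply: (@continuous_cvg _ _ _ _ _ _ (fun y : R => y ^+ 2)).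
    exact: exprn_continuous.
  (* The limit of [(k+1) sin(x / (k+1))] is this derivative, read along the steps [1 / (k+1)]. *)
  have [dv vE] : is_derive (0 : R) 1 (fun h : R => sin (h * x)) x.
    have i1 : is_derive (0 * x) 1 sin (cos (0 * x)) by exact: is_derive_sin.
    have i2 : is_derive (0 : R) 1 (fun h : R => h * x) x.
      apply: (is_derive_eq (is_deriveM (is_derive_id _ _) (is_derive_cst _ _ _))).
      by rewrite scaler0 add0r; exact: mulr1.
    have := @is_derive1_comp _ sin (fun h : R => h * x) 0 _ _ i1 i2.
    by rewrite mul0r cos0 mul1r.
  have := dv; rewrite /derivable => /cvg_ex[l lv].
  have lx : l = x by rewrite -vE /derive (cvg_lim _ lv).
  move: lv; rewrite lx => /cvgr_dnbhsP/(_ (fun k => k.+1%:R^-1)) H.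
  have {}H := H (conj (fun k => invr_neq0 (lt0r_neq0 (ltr0Sn R k))) (@cvg_harmonic R)).
  apply: cvg_trans H; apply: near_eq_cvg; near=> k.
  rewrite invrK mul0r sin0 subr0 /=; congr (_ * sin (_ * _)).
  by rewrite addr0 [LHS]mulr1.
Unshelve. all: end_near. Qed.

(** The function [v = 2 x^2 / (x^2 + a^2)] is below, at or above 1 exactly as [|x|] is with respect
    to [a], so [1 / (1 + v^k)] tends to 1, 1/2 or 0. *)
Let mult_pre (a : R) : 0 < a ->
  mult (fun x => if `|x| < a then 1 else if `|x| == a then 2^-1 else 0).
Proof.
move=> a0; pose lam := (a ^+ 2)^-1.
have lam0 : 0 < lam by rewrite invr_gt0 exprn_gt0.
pose v x := 2 * (1 - (1 + lam * x ^+ 2)^-1).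
have lx0 x : 0 <= lam * x ^+ 2 by rewrite mulr_ge0 ?sqr_ge0// ltW.
have v0 x : 0 <= v x.
  by rewrite mulr_ge0// subr_ge0 invf_le1 ?lerDl// ltr_pwDl.
have mv : mult v.
  apply: (mult_eq (multM (mult_cst 2) (multD (mult_cst 1) (multM (mult_cst (-1)) (mult_quad lam0))))).
  by move=> x; rewrite /v/= mulN1r.
have vE x : v x - 1 = (x ^+ 2 - a ^+ 2) / (x ^+ 2 + a ^+ 2).
  rewrite /v /lam; field; rewrite !gt_eqF//=; last by rewrite ltr_wpDl ?sqr_ge0// exprn_gt0.
apply: (@mult_lim (fun k x => (1 + v x ^+ k)^-1) _ 1).
- by move=> k; apply: mult_inv; [exact: multX|move=> x; exact: exprn_ge0].
- move=> k x; rewrite ger0_norm ?invr_ge0 ?addr_ge0 ?exprn_ge0//.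
  by rewrite invf_le1 ?lerDl ?exprn_ge0// ltr_pwDl ?exprn_ge0.
- move=> x.
  have s0 : 0 < x ^+ 2 + a ^+ 2 by rewrite ltr_wpDl ?sqr_ge0// exprn_gt0.
  have [xa|xa|xa] := ltgtP `|x| a.
  + have v1 : v x < 1.
      rewrite -subr_lt0 vE pmulr_llt0 ?invr_gt0// subr_lt0.
      by rewrite -(real_normK (num_real x)) ltr_pXn2r ?nnegrE// ltW.
    rewrite -[X in _ --> X]invr1; apply: cvgV; first exact: oner_neq0.
    rewrite -[X in _ --> X]addr0; apply: (@cvgD _ R^o); first exact: cvg_cst.
    by apply: cvg_expr; rewrite ger0_norm.
  + have v1 : 1 < v x.
      rewrite -subr_gt0 vE pmulr_lgt0 ?invr_gt0// subr_gt0.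
      by rewrite -(real_normK (num_real x)) ltr_pXn2r ?nnegrE// ltW.
    have vp : 0 < v x by apply: lt_trans v1.
    apply: (@squeeze_cvgr _ _ _ _ (cst 0) (fun k => (v x)^-1 ^+ k)).
    * apply: nearW => k; rewrite invr_ge0 addr_ge0 ?exprn_ge0//= exprVn.
      by rewrite lef_pV2 ?posrE ?ltr_pwDl ?exprn_gt0 ?exprn_ge0// lerDr.
    * exact: cvg_cst.
    * by apply: cvg_expr; rewrite ger0_norm ?invr_ge0// invf_lt1.
  + have v1 : v x = 1.
      apply/eqP; rewrite -subr_eq0 vE -xa (real_normK (num_real x)) subrr.
      by rewrite mul0r.
    apply: cvg_near_cst; apply: nearW => k.
    by rewrite v1 expr1n.
Qed.

(** Letting the half-width decrease to [a] removes the value 1/2 at the endpoints and admits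
    [a = 0]. *)
Let mult_itv (a : R) : 0 <= a -> mult (fun x => if `|x| <= a then 1 else 0).
Proof.
move=> a0; have ak (k : nat) : 0 < a + k.+1%:R^-1 by rewrite ltr_wpDl.
apply: (mult_lim (fun k => mult_pre (ak k)) (C := 1)).
- by move=> k x; case: ifPn => _; [rewrite normr1|case: ifPn => _; rewrite ?normr0// ger0_norm// invf_le1// ler1n].
- move=> x; case: leP => xa.
    apply: cvg_near_cst; apply: nearW => k.
    by rewrite (le_lt_trans xa)// ltrDl.
  apply: cvg_near_cst.
  have ex : 0 < `|x| - a by rewrite subr_gt0.
  near=> k.
  have h : a + k.+1%:R^-1 < `|x|.
    rewrite addrC -ltrBrDr; near: k; exact: near_infty_natSinv_lt (PosNum ex).
  by rewrite ltNge ltW// gt_eqF.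
Unshelve. all: end_near. Qed.

(** The indicators of the coordinates are multiplied in one by one; frequency 0 and phase 0 then
    read off the probability. Shifted boxes are covered, since constants may be added to [U] and
    [V]. *)
Theorem fourier_box (a : nat -> R) : (forall i, (i < n)%N -> 0 <= a i) ->
  P1 [set w | forall i, (i < n)%N -> `|U i w| <= a i] =
  P2 [set w | forall i, (i < n)%N -> `|V i w| <= a i].
Proof.
move=> a0.
pose ind i (x : R) : R := if `|x| <= a i then 1 else 0.
have gd k : (k <= n)%N -> good (fun w => \prod_(i < k) ind i (U i w))
    (fun w => \prod_(i < k) ind i (V i w)).
  elim: k => [_|k IH kn].
    have g1 : good (cst 1) (cst 1).
      split; [exact: bmeas_cst|exact: bmeas_cst|] => t th.
      under eq_Rintegral do rewrite mul1r.
      under [RHS]eq_Rintegral do rewrite mul1r.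
      exact: UV.
    by apply: (good_eq g1) => w; rewrite big_ord0.
  have [_ /(_ _ kn _ _ (IH (ltnW kn))) h] := mult_itv (a0 _ kn).
  by apply: (good_eq h) => w; rewrite big_ord_recr.
have [bF bG /(_ (fun=> 0) 0)] := gd n (leqnn n).
have lin0 (T : Type) (W : nat -> T -> R) w : lin W (fun=> 0) 0 w = 0.
  by rewrite /lin addr0 big1// => i _; rewrite mul0r.
under eq_Rintegral do rewrite lin0 cos0 mulr1.
under [in RHS]eq_Rintegral do rewrite lin0 cos0 mulr1.
have PE d (T : measurableType d) (P : probability T R) (W : nat -> T -> R) :
    bmeas (fun w => \prod_(i < n) ind i (W i w)) ->
    (forall i, (i < n)%N -> measurable_fun setT (W i)) ->
    P [set w | forall i, (i < n)%N -> `|W i w| <= a i] =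
    (\int[P]_w (\prod_(i < n) ind i (W i w)))%:E.
  move=> bW mW; set A := [set w | _].
  have E w : \prod_(i < n) ind i (W i w) = \1_A w.
    rewrite indicE; have [/set_mem h|/negP h] := boolP (w \in A).
      by rewrite big1// => i _; rewrite /ind h.
    have : ~ A w by move=> h'; apply: h; rewrite inE.
    move=> /existsNP[i /not_implyP[ni /negP iw]].
    by rewrite (bigD1 (Ordinal ni))//= /ind (negbTE iw) mul0r.
  have mA : measurable A.
    have -> : A = (fun w => \prod_(i < n) ind i (W i w)) @^-1` [set 1].
      apply/seteqP; split => w /=; rewrite E indicE.
        by move=> h; rewrite mem_set.
      by have [/set_mem//|_ /eqP] := boolP (w \in A); rewrite eq_sym oner_eq0.
    by rewrite -[X in measurable X]setTI; apply: bW.1.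
  rewrite /Rintegral fineK; last by apply: integrable_fin_num => //; exact: bmeas_integrable.
  under eq_integral do rewrite E.
  by rewrite integral_indic// setIT.
by rewrite (PE _ _ P1)// (PE _ _ P2)// => ->.
Qed.

End fourier_uniqueness.

Definition box (T : Type) (R : realType) (n : nat) (U : nat -> T -> R)
  (a : nat -> R) : set T := [set w | forall i, (i < n)%N -> `|U i w| <= a i].

Lemma measurable_box d (T : measurableType d) (R : realType) n
    (U : nat -> T -> R) a : (forall i, (i < n)%N -> measurable_fun setT (U i)) ->
  measurable (box n U a).
Proof.
elim: n => [|n IH] mU.
  by rewrite (_ : box _ _ _ = setT)//; apply/seteqP; split.
rewrite (_ : box _ _ _ = box n U a `&` (fun w => `|U n w|) @^-1` `]-oo, a n]).
  apply: measurableI; first by apply: IH => i /ltnW; exact: mU.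
  rewrite -[X in measurable X]setTI.
  by apply: (measurableT_comp _ (mU n (ltnSn n))) => //; exact: measurable_normr.
apply/seteqP; split => w /=.
  move=> h; split; first by move=> i /ltnW; exact: h.
  by rewrite in_itv/= h.
rewrite in_itv/= => -[h hn] i; rewrite ltnS leq_eqVlt => /predU1P[->//|].
exact: h.
Qed.

(** * Independence and symmetry in a Gaussian space *)

Section independence.
Context d (T : measurableType d) (R : realType) (P : probability T R).
Variable S : set (T -> R).
Hypothesis gS : gaussian_space P S.

Lemma gs_cos_shift X th : S X ->
  \int[P]_w cos (X w + th) = cos th * expR (- (cov P X X / 2)).
Proof.
move=> SX; have mX := gs_measurable gS SX.
have bc : bmeas (fun w => cos (X w)) by exact: bmeas_cos.
have bs : bmeas (fun w => sin (X w)).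
  split; first by apply: (measurableT_comp _ mX); apply: continuous_measurable_fun => x; exact: continuous_sin.
  by exists 1 => w; rewrite ler_norml sin_geN1 sin_le1.
under eq_Rintegral do rewrite cosD.
rewrite RintegralB//; last 2 first.
- by apply: bmeas_integrable; apply: bmeasM => //; exact: bmeas_cst.
- by apply: bmeas_integrable; apply: bmeasM => //; exact: bmeas_cst.
rewrite !RintegralZr//; [|exact: bmeas_integrable|exact: bmeas_integrable].
by rewrite (gs_cos gS SX) (gs_sin gS SX) mul0r subr0 mulrC.
Qed.

Lemma cov_lin X W al : S X -> S W -> cov P X W = 0 ->
  cov P (fun w => al * X w + W w) (fun w => al * X w + W w) =
  al ^+ 2 * cov P X X + cov P W W.
Proof.
move=> SX SW XW.
have SaX := gs_scale gS al SX.
have SY := gs_add gS SaX SW.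
rewrite (covDl gS SaX SW SY) (covZl gS al SX SY).
rewrite (covC P X) (covC P W) (covDl gS SaX SW SX) (covDl gS SaX SW SW).
by rewrite !(covZl gS al)// (covC P W X) XW mulr0 addr0 add0r mulrA.
Qed.

Variables (n : nat) (X : T -> R) (W : nat -> T -> R).
Hypothesis SX : S X.
Hypothesis SW : forall j, (j < n)%N -> S (W j).
Hypothesis XW : forall j, (j < n)%N -> cov P X (W j) = 0.

Let cov_sumW (t : nat -> R) : cov P X (fun w => \sum_(j < n) t j * W j w) = 0.
Proof.
rewrite covC (cov_suml gS t SX)// big1// => j _.
by rewrite covC XW ?mulr0.
Qed.

(** The right-hand side is the probability under [P \x P] of the box in which [X] and [W] read
    separate coordinates. As [X] is uncorrelated with every [W j], variances add, and both measures
    give the same Fourier transform. *)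
Lemma gs_independence (al c a : nat -> R) : (forall j, (j < n)%N -> 0 <= a j) ->
  P (box n (fun j w => al j * X w + W j w + c j) a) =
  (\int[P]_w' P (box n (fun j w => (al j * X w' + W j w + c j)%R) a))%E.
Proof.
move=> a0; have mX := gs_measurable gS SX.
have mW j : (j < n)%N -> measurable_fun setT (W j).
  by move=> jn; exact: (gs_measurable gS (SW jn)).
pose V j (z : T * T) := al j * X z.1 + W j z.2 + c j.
have mV j : (j < n)%N -> measurable_fun setT (V j).
  move=> jn; apply: measurable_funD => //; apply: measurable_funD.
    by apply: measurable_funM => //; exact: (measurableT_comp mX measurable_fst).
  exact: (measurableT_comp (mW j jn) measurable_snd).
rewrite -[RHS]/(\int[P]_w' P _)%E.
transitivity ((P \x P)%E (box n V a)); last first.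
  apply: eq_integral => w' _; congr (P _); apply/seteqP.
  by split => w; rewrite /xsection/= inE.
apply: (@fourier_box _ _ _ _ R P (P \x P)%E) => //.
  move=> j jn; apply: measurable_funD => //; apply: measurable_funD; last exact: mW.
  by apply: measurable_funM.
move=> t th.
pose A := \sum_(j < n) t j * al j.
pose Y w := \sum_(j < n) t j * W j w.
pose th' := \sum_(j < n) t j * c j + th.
have SY : S Y by exact: (gs_sum gS t SX).
have linE (x y : T) : \sum_(j < n) t j * (al j * X x + W j y + c j) + th =
    A * X x + Y y + th'.
  rewrite /A /Y /th' mulr_suml addrA; congr (_ + _).
  rewrite -!big_split/=; apply: eq_bigr => j _.
  by rewrite !mulrDr mulrA.
under eq_Rintegral do rewrite linE.
rewrite (gs_cos_shift _ (gs_add gS (gs_scale gS A SX) SY)) cov_lin//; last exact: cov_sumW.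
pose f z := cos (A * X z.1 + Y z.2 + th').
have mY := gs_measurable gS SY.
have mf : measurable_fun setT (fun z : T * T => A * X z.1 + Y z.2 + th').
  apply: measurable_funD => //; apply: measurable_funD.
    by apply: measurable_funM => //; exact: (measurableT_comp mX measurable_fst).
  exact: (measurableT_comp mY measurable_snd).
have bf := bmeas_cos mf.
rewrite /Rintegral.
rewrite [X in _ = fine X](_ : _ = \int[(P \x P)%E]_z (f z)%:E)%E; last first.
  by apply: eq_integral => z _; rewrite linE.
rewrite -integral12_prod_meas1; last exact: bmeas_integrable.
pose K := expR (- (cov P Y Y / 2)).
have inner x : fubini_F P (fun z => (f z)%:E) x = (cos (A * X x + th') * K)%:E.
  rewrite /fubini_F /K -(gs_cos_shift _ SY) /Rintegral fineK.
    by apply: eq_integral => y _; rewrite /f/= addrAC addrC.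
  apply: integrable_fin_num => //; apply: bmeas_integrable; apply: bmeas_cos.
  exact: measurable_funD.
under eq_integral do rewrite inner.
rewrite -/(Rintegral P setT (fun x => cos (A * X x + th') * K)).
rewrite RintegralZr//; last first.
  apply: bmeas_integrable; apply: bmeas_cos; apply: measurable_funD => //.
  exact: measurable_funM.
rewrite (gs_cos_shift _ (gs_scale gS A SX)) -[RHS]mulrA /K -expRD; congr (_ * expR _).
rewrite (covZl gS A SX (gs_scale gS A SX)) covC (covZl gS A SX SX).
by rewrite -opprD -mulrDl expr2 mulrA.
Qed.

End independence.

Section symmetry.
Context d (T : measurableType d) (R : realType) (P : probability T R).
Variable S : set (T -> R).
Hypothesis gS : gaussian_space P S.

(** The transforms of [W] and [- W] coincide, since only variances enter, and the absolute value
    absorbs the remaining sign. *)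
Lemma gs_box_opp n (W : nat -> T -> R) (c a : nat -> R) :
  (forall j, (j < n)%N -> S (W j)) -> (forall j, (j < n)%N -> 0 <= a j) ->
  P (box n (fun j w => W j w - c j) a) = P (box n (fun j w => W j w + c j) a).
Proof.
move=> SW a0.
have mW j : (j < n)%N -> measurable_fun setT (W j).
  by move=> jn; exact: (gs_measurable gS (SW _ jn)).
have -> : box n (fun j w => W j w + c j) a = box n (fun j w => (-1) * W j w - c j) a.
  by apply/seteqP; split => w /= h i /h; rewrite mulN1r -opprD normrN.
(* Without coordinates there is no member of [S] at hand to start [gs_sum]. *)
case: n SW a0 mW => [|n] SW a0 mW; first by congr (P _); apply/seteqP; split.
apply: fourier_box => //.
- by move=> j jn; apply: measurable_funB => //; exact: mW.
- by move=> j jn; apply: measurable_funB => //; apply: measurable_funM => //; exact: mW.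
move=> t th.
pose th' := th - \sum_(j < n.+1) t j * c j.
have SY : S (fun w => \sum_(j < n.+1) t j * W j w).
  by apply: (gs_sum gS t (SW 0%N isT)).
have SY' := gs_scale gS (-1) SY.
have e1 w : \sum_(i < n.+1) t i * (W i w - c i) + th = \sum_(j < n.+1) t j * W j w + th'.
  under eq_bigr do rewrite mulrBr.
  by rewrite sumrB /th'; ring.
have e2 w : \sum_(i < n.+1) t i * (-1 * W i w - c i) + th = -1 * (\sum_(j < n.+1) t j * W j w) + th'.
  under eq_bigr do rewrite mulrBr mulrCA.
  by rewrite sumrB -mulr_sumr /th'; ring.
under eq_Rintegral do rewrite e1.
under [RHS]eq_Rintegral do rewrite e2.
rewrite (gs_cos_shift gS _ SY) (gs_cos_shift gS _ SY').
by rewrite (covZl gS _ SY SY') covC (covZl gS _ SY SY) mulrA mulrNN mulr1 mul1r.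
Qed.

End symmetry.

(** * The Prekopa-Leindler inequality on the line *)

Section powR_mean.
Context (R : realType).
Implicit Types (x y p q : R).

Lemma powR_conjugate x p q : 0 <= x -> 0 < p -> 0 < q -> p + q = 1 ->
  x `^ p * x `^ q = x.
Proof.
move=> x0 p0 q0 pq; have [->|xn0] := eqVneq x 0.
  by rewrite powR0 ?gt_eqF// mul0r.
by rewrite -powRD ?xn0 ?implybT// pq powRr1.
Qed.

Lemma powR_amgm x y p q : 0 <= x -> 0 <= y -> 0 < p -> 0 < q -> p + q = 1 ->
  x `^ p * y `^ q <= p * x + q * y.
Proof.
move=> x0 y0 p0 q0 pq.
have := @conjugate_powR R (x `^ p) (y `^ q) p^-1 q^-1 (powR_ge0 _ _) (powR_ge0 _ _).
rewrite !invr_gt0 !invrK => /(_ p0 q0 pq).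
by rewrite -!powRrM !divff ?gt_eqF// !powRr1// (mulrC x) (mulrC y).
Qed.

End powR_mean.

Section superlevel.
Context (R : realType).
Let mu := @lebesgue_measure R.

Lemma measurable_superlevel (f : R -> R) :
  (forall t, is_interval [set s | t < f s]) -> measurable_fun setT f.
Proof.
move=> itf mT; apply: (measurability _ (RGenOInfty.measurableE R)) => //.
move=> _ [_ [t ->] <-]; rewrite setTI.
have := is_interval_measurable (itf t).
by congr (measurable _); apply/seteqP; split => s /=; rewrite in_itv/= andbT.
Qed.

Lemma layer_cake (f : R -> R) : measurable_fun setT f -> (forall s, 0 <= f s) ->
  let A := [set z : R * R | 0 < z.2 < f z.1] in
  measurable A /\
  (\int[mu]_s (f s)%:E = \int[mu]_t mu (ysection A t))%E.
Proof.
move=> mf f0 A.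
have mA : measurable A.
  have m1 : measurable_fun setT (fun z : R * R => f z.1 - z.2).
    apply: measurable_funB; last exact: measurable_snd.
    exact: (measurableT_comp mf measurable_fst).
  have -> : A = ((fun z : R * R => z.2) @^-1` `]0, +oo[) `&`
                ((fun z : R * R => f z.1 - z.2) @^-1` `]0, +oo[).
    apply/seteqP; split => z /=; rewrite !in_itv/= !andbT subr_gt0.
      by move=> /andP[].
    by move=> [? ?]; apply/andP.
  apply: measurableI.
    by rewrite -[X in measurable X]setTI; apply: measurable_snd.
  by rewrite -[X in measurable X]setTI; apply: m1.
split => //.
have := @indic_fubini_tonelli _ _ _ _ R mu mu A mA.
have FE s : fubini_F mu (EFin \o \1_A) s = mu (xsection A s).
  exact: (congr1 (fun k => k s) (indic_fubini_tonelli_FE mu mA)).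
have GE t : fubini_G mu (EFin \o \1_A) t = mu (ysection A t).
  exact: (congr1 (fun k => k t) (indic_fubini_tonelli_GE mu mA)).
move=> FG; apply: (eq_trans _ (eq_trans FG _)); last first.
  by apply: eq_integral => t _; exact: GE.
apply: eq_integral => s _; apply: (eq_trans _ (esym (FE s))).
rewrite (_ : xsection A s = [set` `]0, f s[]); last first.
  by apply/seteqP; split => t; rewrite /xsection/= inE.
rewrite /mu lebesgue_measure_itv/= lte_fin; case: ltP => [_|fs]; first by rewrite oppr0 adde0.
by apply/eqP; rewrite eqe eq_le fs f0.
Qed.

Lemma lebesgue_diameter (A : set R) (M : R) : measurable A -> A !=set0 ->
  (forall x y, A x -> A y -> y - x <= M) -> (mu A <= M%:E)%E.
Proof.
move=> mA [a0 Aa0] dA.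
have hs : has_sup A.
  by split; [exists a0|exists (a0 + M) => x Ax; have := dA _ _ Aa0 Ax; lra].
have hi : has_inf A.
  by split; [exists a0|exists (a0 - M) => x Ax; have := dA _ _ Ax Aa0; lra].
have sub : A `<=` [set` `[inf A, sup A]].
  move=> x Ax; rewrite /= in_itv/=; apply/andP; split.
    by apply: ge_inf => //; exact: hi.2.
  by apply: ub_le_sup => //; exact: hs.2.
have dle : sup A - inf A <= M.
  rewrite lerBlDr; apply: ge_sup; first by exists a0.
  move=> y Ay; rewrite -lerBlDl; apply: lb_le_inf; first by exists a0.
  by move=> x Ax; have := dA _ _ Ax Ay; lra.
apply: (@le_trans _ _ (mu [set` `[inf A, sup A]])).
  by apply: le_measure; rewrite ?inE.
rewrite /mu lebesgue_measure_itv/= lte_fin; case: ltP => h.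
  by rewrite -EFinB lee_fin.
rewrite lee_fin (le_trans _ dle)// subr_ge0 (le_trans (ge_inf hi.2 Aa0))//.
by apply: ub_le_sup => //; exact: hs.2.
Qed.

(** As [C] is an interval, only diameters matter: two points of [A] and two of [B] yield a segment
    inside [C], and the measure of a set is at most its diameter. Superlevel sets of log-concave
    functions are of this kind. *)
Lemma brunn_minkowski (A B C : set R) (p q : R) : 0 < p -> 0 < q ->
  measurable A -> measurable B -> measurable C ->
  A !=set0 -> B !=set0 -> is_interval C ->
  (forall x y, A x -> B y -> C (p * x + q * y)) ->
  (p%:E * mu A + q%:E * mu B <= mu C)%E.
Proof.
move=> p0 q0 mA mB mC A0 B0 iC ABC.
have [Cy|Cfin] := eqVneq (mu C) +oo%E; first by rewrite Cy leey.
have [c cE] : exists c, mu C = c%:E.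
  have : (0 <= mu C)%E by [].
  by move: Cfin; case: (mu C) => [r _ _|//|//]; exists r.
have key x x' y y' : A x -> A x' -> B y -> B y' ->
    p * (x' - x) + q * (y' - y) <= c.
  move=> Ax Ax' By By'.
  have Cl := ABC _ _ Ax By; have Cr := ABC _ _ Ax' By'.
  set l := p * x + q * y in Cl *; set r := p * x' + q * y' in Cr *.
  have -> : p * (x' - x) + q * (y' - y) = r - l by rewrite /r /l; ring.
  have c0 : 0 <= c by rewrite -lee_fin -cE.
  have [rl|lr] := leP r l; first by rewrite (le_trans _ c0)// subr_le0.
  rewrite -lee_fin -cE.
  apply: (@le_trans _ _ (mu [set` `[l, r]])).
    by rewrite /mu lebesgue_measure_itv/= lte_fin lr -EFinB.
  apply: le_measure; rewrite ?inE// => z /=; rewrite in_itv/= => /andP[lz zr].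
  by apply: (iC l r) => //; rewrite lz zr.
have [y By] := B0.
(* With two points of [B] fixed, the diameter of [A] is bounded; the resulting inequality then
   bounds the diameter of [B] in terms of [mu A]. *)
have diaA y1 y2 : B y1 -> B y2 -> (mu A <= ((c - q * (y2 - y1)) / p)%:E)%E.
  move=> B1 B2; apply: lebesgue_diameter => // x x' Ax Ax'.
  rewrite ler_pdivlMr// lerBrDr mulrC; exact: key.
have [al alE] : exists al, mu A = al%:E.
  have := diaA _ _ By By; have : (0 <= mu A)%E by [].
  by case: (mu A) => [r _ _|//|//]; exists r.
have muB : (mu B <= ((c - p * al) / q)%:E)%E.
  apply: lebesgue_diameter => // y1 y2 B1 B2.
  have := diaA _ _ B1 B2; rewrite alE lee_fin !ler_pdivlMr//.
  by rewrite lerBrDr lerBrDr mulrC addrC [_ * q]mulrC.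
have [be beE] : exists be, mu B = be%:E.
  have := muB; have : (0 <= mu B)%E by [].
  by case: (mu B) => [r _ _|//|//]; exists r.
move: muB; rewrite alE beE cE -!EFinM -EFinD !lee_fin ler_pdivlMr//.
by rewrite lerBrDr addrC [be * q]mulrC.
Qed.

End superlevel.

Section prekopa_leindler.
Context (R : realType).
Let mu := @lebesgue_measure R.
Variables (p q : R) (f g h : R -> R).
Hypotheses (p0 : 0 < p) (q0 : 0 < q) (pq : p + q = 1).
Hypotheses (f0 : forall x, 0 <= f x) (g0 : forall x, 0 <= g x)
  (h0 : forall x, 0 <= h x).
Hypotheses (mf : measurable_fun setT f) (mg : measurable_fun setT g).
Hypothesis ih : forall t, is_interval [set s | t < h s].
Hypothesis fgh : forall x y, f x `^ p * g y `^ q <= h (p * x + q * y).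

Let mh : measurable_fun setT h := measurable_superlevel ih.

(** With both suprema equal to 1, the superlevel sets of [f] and [g] are nonempty at the same
    levels, as the Brunn-Minkowski inequality requires. It is then integrated over the level by the
    layer-cake formula. *)
Lemma prekopa_normalized :
  (forall x, f x <= 1) -> (forall x, g x <= 1) ->
  (forall t, t < 1 -> exists x, t < f x) ->
  (forall t, t < 1 -> exists x, t < g x) ->
  (p%:E * \int[mu]_x (f x)%:E + q%:E * \int[mu]_x (g x)%:E <=
   \int[mu]_x (h x)%:E)%E.
Proof.
move=> f1 g1 fs gs.
have [mA ->] := layer_cake mf f0; have [mB ->] := layer_cake mg g0.
have [mC ->] := layer_cake mh h0.
set A := [set z | _] in mA *; set B := [set z | _] in mB *.
set C := [set z | _] in mC *.
have sE (k : R -> R) t : 0 < t ->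
    ysection [set z : R * R | 0 < z.2 < k z.1] t = [set s | t < k s].
  by move=> t0; apply/seteqP; split => s; rewrite /ysection/= ?inE/= t0.
have s0 (k : R -> R) t : t <= 0 ->
    ysection [set z : R * R | 0 < z.2 < k z.1] t = set0.
  by move=> t0; apply/seteqP; split => s //; rewrite /ysection/= ?inE/= ltNge t0.
rewrite -!ge0_integralZl//; last 4 first.
- exact: measurable_fun_ysection.
- by rewrite lee_fin ltW.
- exact: measurable_fun_ysection.
- by rewrite lee_fin ltW.
rewrite -ge0_integralD//; last 4 first.
- by move=> t _; rewrite mule_ge0// lee_fin ltW.
- by apply: measurable_funeM; exact: measurable_fun_ysection.
- by move=> t _; rewrite mule_ge0// lee_fin ltW.
- by apply: measurable_funeM; exact: measurable_fun_ysection.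
apply: ge0_le_integral => //.
- by move=> t _; rewrite adde_ge0// mule_ge0// lee_fin ltW.
- by apply: emeasurable_funD; apply: measurable_funeM; exact: measurable_fun_ysection.
- exact: measurable_fun_ysection.
move=> t _; have [t0|t0] := leP t 0.
  by rewrite !s0// measure0 !mule0 adde0.
rewrite !sE//; have [t1|t1] := leP 1 t.
  rewrite (_ : [set s | t < f s] = set0); last first.
    by apply/seteqP; split => s //=; rewrite ltNge (le_trans (f1 s)).
  rewrite (_ : [set s | t < g s] = set0); last first.
    by apply/seteqP; split => s //=; rewrite ltNge (le_trans (g1 s)).
  by rewrite measure0 !mule0 adde0.
have mset (k : R -> R) : measurable_fun setT k -> measurable [set s | t < k s].
  move=> mk; have := mk measurableT [set` `]t, +oo[] (measurable_itv _).
  by rewrite setTI; congr (measurable _); apply/seteqP; split => s /=; rewrite in_itv/= andbT.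
apply: brunn_minkowski => //.
- exact: mset.
- exact: mset.
- exact: mset.
- exact: fs.
- exact: gs.
move=> x y /= fx gy; apply: lt_le_trans (fgh x y).
rewrite -[ltLHS](@powR_conjugate _ t p q)//; last exact: ltW.
have tp r : 0 < t `^ r by exact: powR_gt0.
apply: (@lt_le_trans _ _ (f x `^ p * t `^ q)).
  by rewrite ltr_pM2r//; apply: gt0_ltr_powR => //; rewrite ?nnegrE// ltW.
by rewrite ler_wpM2l ?powR_ge0//; apply: ge0_ler_powR; rewrite ?nnegrE// ltW.
Qed.

End prekopa_leindler.

Section prekopa.
Context (R : realType).
Let mu := @lebesgue_measure R.

(** Dividing by the suprema reduces to the normalized additive form. The weighted mean inequality
    turns that into the multiplicative form, which is homogeneous, so the suprema come out again. *)
Theorem prekopa_leindler (p q C : R) (f g h : R -> R) :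
  0 < p -> 0 < q -> p + q = 1 ->
  (forall x, 0 <= f x <= C) -> (forall x, 0 <= g x <= C) ->
  (forall x, 0 <= h x) ->
  measurable_fun setT f -> measurable_fun setT g ->
  (forall t, is_interval [set s | t < h s]) ->
  mu.-integrable setT (EFin \o f) -> mu.-integrable setT (EFin \o g) ->
  mu.-integrable setT (EFin \o h) ->
  (forall x y, f x `^ p * g y `^ q <= h (p * x + q * y)) ->
  (\int[mu]_x f x) `^ p * (\int[mu]_x g x) `^ q <= \int[mu]_x h x.
Proof.
move=> p0 q0 pq fb gb h0 mf mg ih intf intg inth fgh.
have f0 x : 0 <= f x by have /andP[] := fb x.
have g0 x : 0 <= g x by have /andP[] := gb x.
have int0 (k : R -> R) : (forall x, k x = 0) -> \int[mu]_x k x = 0.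
  by move=> /funext ->; rewrite Rintegral_cst// mul0r.
have [/int0 ->|] := pselect (forall x, f x = 0).
  by rewrite powR0 ?gt_eqF// mul0r; exact: Rintegral_ge0.
move=> /existsNP[xf /eqP fxn0].
have [/int0 ->|] := pselect (forall x, g x = 0).
  by rewrite powR0 ?gt_eqF// mulr0; exact: Rintegral_ge0.
move=> /existsNP[xg /eqP gxn0].
have supP (k : R -> R) x0 : (forall x, 0 <= k x <= C) -> k x0 != 0 ->
    [/\ 0 < sup (range k), forall x, k x <= sup (range k) &
      forall t, t < sup (range k) -> exists x, t < k x].
  move=> kb k0.
  have hs : has_sup (range k).
    split; first by exists (k x0); exists x0.
    by exists C => _ [x _ <-]; have /andP[] := kb x.
  have le x : k x <= sup (range k) by apply: ub_le_sup; [exact: hs.2|exists x].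
  split => //; first by apply: lt_le_trans (le x0); rewrite lt0r k0; have /andP[] := kb x0.
  move=> t ts; have [_ [x _ <-] kx] := sup_gt hs.1 ts.
  by exists x.
have [F0 fF Fs] := supP f xf fb fxn0; have [G0 gG Gs] := supP g xg gb gxn0.
set F := sup (range f) in F0 fF Fs; set G := sup (range g) in G0 gG Gs.
pose H := F `^ p * G `^ q.
have H0 : 0 < H by rewrite mulr_gt0// powR_gt0.
have nf x : 0 <= f x / F by rewrite divr_ge0// ltW.
have ng x : 0 <= g x / G by rewrite divr_ge0// ltW.
have nh x : 0 <= h x / H by rewrite divr_ge0// ltW.
have mf' : measurable_fun setT (fun x => f x / F) by exact: measurable_funM.
have mg' : measurable_fun setT (fun x => g x / G) by exact: measurable_funM.
have ih' t : is_interval [set s | t < h s / H].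
  by rewrite (_ : [set s | _] = [set s | t * H < h s])//; apply/seteqP; split => s /=; rewrite ltr_pdivlMr.
have fgh' x y : (f x / F) `^ p * (g y / G) `^ q <= h (p * x + q * y) / H.
  rewrite ler_pdivlMr//; apply: le_trans (fgh x y).
  rewrite /H mulrACA -!powRM ?(ltW F0) ?(ltW G0)//.
  by rewrite !divfK ?gt_eqF.
have := prekopa_normalized p0 q0 pq nf ng nh mf' mg' ih' fgh'.
move=> main.
have {}main : p * \int[mu]_x (f x / F) + q * \int[mu]_x (g x / G) <= \int[mu]_x (h x / H).
  have fin (k : R -> R) c : mu.-integrable setT (EFin \o k) ->
      (\int[mu]_x (k x / c)%:E)%E = (\int[mu]_x (k x / c))%:E.
    move=> ik; rewrite /Rintegral fineK//; apply: integrable_fin_num => //.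
    by under eq_fun do rewrite EFinM; exact: integrableZr.
  rewrite -lee_fin EFinD !EFinM -!fin//; apply: main.
  - by move=> x; rewrite ler_pdivrMr// mul1r.
  - by move=> x; rewrite ler_pdivrMr// mul1r.
  - move=> t t1; have [|x hx] := Fs (t * F); first by rewrite gtr_pMl.
    by exists x; rewrite ltr_pdivlMr.
  - move=> t t1; have [|x hx] := Gs (t * G); first by rewrite gtr_pMl.
    by exists x; rewrite ltr_pdivlMr.
move: main; rewrite !RintegralZr//.
set If := \int[mu]_x f x; set Ig := \int[mu]_x g x; set Ih := \int[mu]_x h x => main.
have If0 : 0 <= If by exact: Rintegral_ge0.
have Ig0 : 0 <= Ig by exact: Rintegral_ge0.
have := le_trans (powR_amgm (divr_ge0 If0 (ltW F0)) (divr_ge0 Ig0 (ltW G0)) p0 q0 pq) main.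
rewrite ler_pdivlMr// /H mulrACA -!powRM ?divr_ge0 ?(ltW F0) ?(ltW G0)//.
by rewrite !divfK ?gt_eqF.
Qed.

End prekopa.

(** * Log-concavity of box probabilities and Sidak's inequality *)

Lemma le_of_eq (R : realType) (x y : R) : x = y -> x <= y.
Proof. by move=> ->. Qed.

Section log_concave.
Context (R : realType).

(** Powers instead of a logarithm let [f] vanish. The weights are positive because a power 0 of 0 is
    1, which would break the inequality at a zero of [f]. *)
Definition log_concave (f : R -> R) : Prop := (forall x, 0 <= f x) /\
  forall p q x y, 0 < p -> 0 < q -> p + q = 1 ->
    f x `^ p * f y `^ q <= f (p * x + q * y).

Lemma log_concave_interval f t : log_concave f -> is_interval [set s | t < f s].
Proof.
move=> [f0 lf] a b /= fa fb x /andP[ax xb].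
have [t0|t0] := ltP t 0; first exact: lt_le_trans (f0 x).
have [->//|xna] := eqVneq x a; have [->//|xnb] := eqVneq x b.
have {}ax : a < x by rewrite lt_neqAle eq_sym xna.
have {}xb : x < b by rewrite lt_neqAle xnb.
have ab : 0 < b - a by rewrite subr_gt0 (lt_trans ax).
pose q := (x - a) / (b - a); pose p := (b - x) / (b - a).
have p0 : 0 < p by rewrite divr_gt0// subr_gt0.
have q0 : 0 < q by rewrite divr_gt0// subr_gt0.
have pq : p + q = 1 by rewrite /p /q; field; rewrite gt_eqF.
have xE : x = p * a + q * b by rewrite /p /q; field; rewrite gt_eqF.
rewrite xE; apply: lt_le_trans (lf _ _ _ _ p0 q0 pq).
rewrite -[ltLHS](@powR_conjugate _ t p q)//.
have fa0 : 0 < f a by exact: le_lt_trans fa.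
apply: (@le_lt_trans _ _ (f a `^ p * t `^ q)).
  rewrite ler_wpM2r ?powR_ge0//; apply: ge0_ler_powR; rewrite ?nnegrE//.
  - exact: ltW.
  - exact: ltW.
rewrite ltr_pM2l ?powR_gt0//; apply: gt0_ltr_powR => //; rewrite ?nnegrE// ltW//.
Qed.

Lemma log_concave_measurable f : log_concave f -> measurable_fun setT f.
Proof. by move=> lf; apply: measurable_superlevel => t; exact: log_concave_interval. Qed.

(** A superlevel set is a symmetric interval: if it contains [y] and [- y], it contains [x]. *)
Lemma log_concave_even (f : R -> R) x y : log_concave f ->
  (forall z, f (- z) = f z) -> `|x| <= `|y| -> f y <= f x.
Proof.
move=> lf ev xy; have ev' z : f `|z| = f z.
  by have [z0|z0] := leP 0 z; [rewrite ger0_norm|rewrite ltr0_norm].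
rewrite -(ev' x) -(ev' y) leNgt; apply/negP => fu.
have := @log_concave_interval f (f `|x|) lf (- `|y|) `|y|.
rewrite /= ev => /(_ fu fu `|x|); rewrite ltxx xy andbT.
have h : - `|y| <= `|x| by apply: (@le_trans _ _ 0); rewrite ?oppr_le0 ?normr_ge0.
by move=> /(_ h).
Qed.

End log_concave.

Lemma normal_pdf_log_concave (R : realType) (s p q x y : R) : s != 0 ->
  0 < p -> 0 < q -> p + q = 1 ->
  normal_pdf 0 s x `^ p * normal_pdf 0 s y `^ q <= normal_pdf 0 s (p * x + q * y).
Proof.
move=> s0 p0 q0 pq; rewrite normal_pdfE// /normal_fun !subr0.
have k0 := normal_peak_gt0 s0.
rewrite !powRM ?expR_ge0 ?(ltW k0)// mulrACA powR_conjugate//; last exact: ltW.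
rewrite ler_pM2l// -!expRM -expRD ler_expR.
have s2 : 0 < s ^+ 2 *+ 2 by rewrite mulrn_wgt0// lt0r sqr_ge0 expf_neq0.
rewrite mulrAC [X in _ + X <= _]mulrAC -mulrDl ler_pM2r ?invr_gt0//.
rewrite !mulNr -opprD lerN2 [_ * p]mulrC [_ * q]mulrC.
have -> : p = 1 - q by rewrite -pq addrK.
rewrite -subr_ge0 (_ : _ - _ = q * (1 - q) * (x - y) ^+ 2); last by ring.
by rewrite mulr_ge0 ?sqr_ge0// mulr_ge0 ?(ltW q0)// -pq addrK ltW.
Qed.

Lemma ae_measure_eq d (T : measurableType d) (R : realType)
    (P : probability T R) (A B : set T) : measurable A -> measurable B ->
  {ae P, forall w, A w <-> B w} -> P A = P B.
Proof.
move=> mA mB AB.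
rewrite -[A]setIT -[B]setIT -!integral_indic//.
apply: ae_eq_integral => //.
- by apply/measurable_EFinP.
- by apply/measurable_EFinP.
apply: filterS AB => w ABw _; rewrite !indicE; congr (_%:R%:E).
by congr nat_of_bool; apply/idP/idP => /set_mem h; apply/mem_set; apply/ABw.
Qed.

Lemma measurable_slab d (T : measurableType d) (R : realType) (X : T -> R) a :
  measurable_fun setT X -> measurable [set w | `|X w| <= a].
Proof.
move=> mX; have := @measurable_box _ _ _ 1 (fun=> X) (fun=> a) (fun _ _ => mX).
by congr (measurable _); apply/seteqP; split => w /= h; [exact: (h 0%N)|move=> i _].
Qed.

Section sidak.
Context d (T : measurableType d) (R : realType) (P : probability T R).
Variable S : set (T -> R).
Hypothesis gS : gaussian_space P S.

(** The dependence on the shift [c] is the point: Sidak's inequality rests on log-concavity in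
    [c]. *)
Definition shifted_box n (Z : nat -> T -> R) (a c : nat -> R) : R :=
  fine (P (box n (fun j w => Z j w + c j) a)).

Lemma box_recr n (Z : nat -> T -> R) (a : nat -> R) :
  box n.+1 Z a = box n Z a `&` [set w | `|Z n w| <= a n].
Proof.
apply/seteqP; split => w /=.
  by move=> h; split; [move=> i /ltnW; exact: h|exact: h].
move=> [h hn] i; rewrite ltnS leq_eqVlt => /predU1P[->//|]; exact: h.
Qed.

Lemma shifted_boxE n (Z : nat -> T -> R) a c : (forall j, (j < n)%N -> measurable_fun setT (Z j)) ->
  P (box n (fun j w => Z j w + c j) a) = (shifted_box n Z a c)%:E.
Proof.
move=> mZ; rewrite fineK// fin_num_measure//; apply: measurable_box => j jn.
by apply: measurable_funD => //; exact: mZ.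
Qed.

Lemma shifted_box_ge0 n Z a c : 0 <= shifted_box n Z a c.
Proof. by rewrite fine_ge0. Qed.

Lemma shifted_box_le1 n (Z : nat -> T -> R) a c : (forall j, (j < n)%N -> measurable_fun setT (Z j)) ->
  shifted_box n Z a c <= 1.
Proof.
move=> mZ; rewrite -lee_fin -shifted_boxE//; apply: probability_le1.
by apply: measurable_box => j jn; apply: measurable_funD => //; exact: mZ.
Qed.

Lemma box_degenerate n (Z : nat -> T -> R) (a c : nat -> R) :
  (forall j, (j < n.+1)%N -> S (Z j)) -> cov P (Z n) (Z n) = 0 ->
  shifted_box n.+1 Z a c = if `|c n| <= a n then shifted_box n Z a c else 0.
Proof.
move=> SZ v0; have mZ j (jn : (j < n.+1)%N) := gs_measurable gS (SZ j jn).
have ae0 := cov0_ae gS (SZ n (ltnSn n)) v0.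
rewrite /shifted_box; set A := box n.+1 _ _; set B := box n _ _.
have mA : measurable A.
  by apply: measurable_box => j jn; apply: measurable_funD => //; exact: mZ.
have mB : measurable B.
  by apply: measurable_box => j /ltnW jn; apply: measurable_funD => //; exact: mZ.
rewrite {}/A {}/B in mA mB *; case: ifPn => cn.
  congr fine; apply: ae_measure_eq => //; apply: filterS ae0 => w Zw.
  by rewrite box_recr; split => [[]//|h]; split => //=; rewrite Zw add0r.
rewrite (@ae_measure_eq _ _ _ P _ set0)// ?measure0//.
apply: filterS ae0 => w Zw; rewrite box_recr; split => // -[_] /=.
by rewrite Zw add0r (negbTE cn).
Qed.


(* [X] is the last coordinate, [W j = Z j - b j * X] is independent of [X] and
   [W n = 0]: the law of [Z] is a mixture over the law of [X]. *)
Section disintegration.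
Variables (n : nat) (Z : nat -> T -> R) (a : nat -> R).
Hypothesis SZ : forall j, (j < n.+1)%N -> S (Z j).
Hypothesis a0 : forall j, (j < n.+1)%N -> 0 <= a j.
Let X := Z n.
Hypothesis v0 : cov P X X != 0.
Let b j := cov P (Z j) X / cov P X X.
Let W j w := Z j w - b j * X w.
Let SX : S X := SZ (ltnSn n).

Lemma residual_gs j : (j < n.+1)%N -> S (W j).
Proof.
by move=> jn; apply: (gs_sub gS (SZ jn)); exact: (gs_scale gS).
Qed.

Lemma residual_cov j : (j < n.+1)%N -> cov P X (W j) = 0.
Proof.
move=> jn; rewrite covC.
have -> : W j = (fun w => Z j w + (- b j) * X w).
  by apply/funext => w; rewrite mulNr.
rewrite (covDl gS (SZ jn) (gs_scale gS _ SX) SX) (covZl gS _ SX SX).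
by rewrite mulNr /b divfK// subrr.
Qed.

Let mW j : (j < n.+1)%N -> measurable_fun setT (W j).
Proof. by move=> jn; apply: (gs_measurable gS); exact: residual_gs. Qed.

(** Two values of [m] serve later: [n.+1] for the whole box and [n] for the box without its last
    constraint, both disintegrated over the same [X]. *)
Lemma shifted_box_residual (c : nat -> R) (m : nat) : (m <= n.+1)%N ->
  P.-integrable setT
    (fun w => (shifted_box m W a (fun j => c j + b j * X w))%:E) /\
  shifted_box m Z a c =
  \int[P]_w shifted_box m W a (fun j => c j + b j * X w).
Proof.
move=> mn.
have lt j : (j < m)%N -> (j < n.+1)%N by move=> /leq_trans; apply.
have mWm j : (j < m)%N -> measurable_fun setT (W j) by move=> /lt; exact: mW.
have mX := gs_measurable gS SX.
have E : P (box m (fun j w => Z j w + c j) a) =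
    (\int[P]_w (shifted_box m W a (fun j => (c j + b j * X w)%R))%:E)%E.
  have := @gs_independence _ T R P S gS m X W SX _ _ b c a.
  move=> /(_ (fun j jm => residual_gs (lt j jm)) (fun j jm => residual_cov (lt j jm))
     (fun j jm => a0 (lt j jm))).
  have -> : box m (fun j w => b j * X w + W j w + c j) a =
            box m (fun j w => Z j w + c j) a.
    by congr (box _ _ _); apply/funext => j; apply/funext => w; rewrite /W; ring.
  move=> ->; apply: eq_integral => w _; rewrite -shifted_boxE//; congr (P (box _ _ _)).
  by apply/funext => j; apply/funext => w'; ring.
have m1 : measurable_fun setT (fun w => (shifted_box m W a (fun j => c j + b j * X w))).
  pose k s := shifted_box m W a (fun j => c j + b j * s).
  suff mk : measurable_fun setT k by exact: (measurableT_comp mk mX).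
  (* Measurability in the shift follows from that of the sections of one measurable set in the
     product. *)
  have mA : measurable [set z : R * T | forall j, (j < m)%N ->
      `|W j z.2 + (c j + b j * z.1)| <= a j].
    apply: (@measurable_box _ _ _ m (fun j (z : R * T) => W j z.2 + (c j + b j * z.1))) => j jm.
    apply: measurable_funD; first exact: (measurableT_comp (mWm j jm) measurable_snd).
    by apply: measurable_funD => //; apply: measurable_funM => //; exact: measurable_fst.
  have := measurableT_comp (@fine_measurable R setT measurableT) (measurable_fun_xsection P mA).
  congr (measurable_fun _ _); apply/funext => s /=; congr (fine (P _)).
  by apply/seteqP; split => w; rewrite /xsection/= inE.
have i1 : P.-integrable setT (fun w => (shifted_box m W a (fun j => c j + b j * X w))%:E).
  apply: bmeas_integrable; split => //; exists 1 => w.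
  by rewrite ger0_norm ?shifted_box_ge0// shifted_box_le1.
by split => //; rewrite /shifted_box E.
Qed.

Lemma shifted_box_last (c : nat -> R) (s : R) :
  shifted_box n.+1 W a (fun j => c j + b j * s) =
  if `|c n + s| <= a n then shifted_box n W a (fun j => c j + b j * s) else 0.
Proof.
have WE : W n = cst 0.
  by apply/funext => w; rewrite /W /b divff// mul1r subrr.
rewrite box_degenerate//; last 2 first.
- exact: residual_gs.
- rewrite WE /cov; under eq_Rintegral do rewrite mul0r.
  by rewrite Rintegral_cst_probability.
by rewrite /b divff// mul1r.
Qed.

End disintegration.

(** Induction on the number of coordinates. Given the value [x] of the last one, the box probability
    [k c x] is log-concave jointly in [c] and [x] by the induction hypothesis; multiplied by the
    normal density it stays so, and Prekopa-Leindler integrates [x] out. A last coordinate of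
    variance 0 contributes only an indicator. *)
Lemma shifted_box_log_concave n (Z : nat -> T -> R) (a c e : nat -> R) (p q : R) :
  (forall j, (j < n)%N -> S (Z j)) -> (forall j, (j < n)%N -> 0 <= a j) ->
  0 < p -> 0 < q -> p + q = 1 ->
  shifted_box n Z a c `^ p * shifted_box n Z a e `^ q <=
  shifted_box n Z a (fun j => p * c j + q * e j).
Proof.
elim: n Z c e p q => [|n IH] Z c e p q SZ a0 p0 q0 pq.
  have E k : shifted_box 0 Z a k = 1.
    rewrite /shifted_box (_ : box _ _ _ = setT); last by apply/seteqP; split.
    by rewrite probability_setT.
  by rewrite !E !powR1 mulr1.
have mid (u v r : R) : `|u| <= r -> `|v| <= r -> `|p * u + q * v| <= r.
  move=> ur vr; rewrite (le_trans (ler_normD _ _))// !normrM (gtr0_norm p0) (gtr0_norm q0).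
  by rewrite -[leRHS]mul1r -pq mulrDl lerD// ler_pM2l.
have SZ' j : (j < n)%N -> S (Z j) by move=> /ltnW; exact: SZ.
have a0' j : (j < n)%N -> 0 <= a j by move=> /ltnW; exact: a0.
have [v0|v0] := eqVneq (cov P (Z n) (Z n)) 0.
  rewrite !(box_degenerate _ _ SZ v0).
  case: ifPn => [cn|_]; last by rewrite powR0 ?gt_eqF// mul0r; case: ifP => // _; exact: shifted_box_ge0.
  case: ifPn => [en|_]; last by rewrite powR0 ?gt_eqF// mulr0; case: ifP => // _; exact: shifted_box_ge0.
  by rewrite mid//; exact: IH.
pose X := Z n; pose b j := cov P (Z j) X / cov P X X.
pose W j w := Z j w - b j * X w.
pose k c s := shifted_box n.+1 W a (fun j => c j + b j * s).
have SW j : (j < n.+1)%N -> S (W j) by exact: residual_gs.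
have SW' j : (j < n)%N -> S (W j) by move=> /ltnW; exact: SW.
have mW j : (j < n.+1)%N -> measurable_fun setT (W j).
  by move=> jn; exact: (gs_measurable gS (SW j jn)).
have k0 c' s : 0 <= k c' s by exact: shifted_box_ge0.
have k1 c' s : k c' s <= 1 by exact: shifted_box_le1.
have kk c1 c2 (p1 q1 x y : R) : 0 < p1 -> 0 < q1 -> p1 + q1 = 1 ->
    k c1 x `^ p1 * k c2 y `^ q1 <= k (fun j => p1 * c1 j + q1 * c2 j) (p1 * x + q1 * y).
  move=> p10 q10 pq1; rewrite /k !(shifted_box_last _ SZ v0).
  have mid1 (u v r : R) : `|u| <= r -> `|v| <= r -> `|p1 * u + q1 * v| <= r.
    move=> ur vr; rewrite (le_trans (ler_normD _ _))// !normrM (gtr0_norm p10) (gtr0_norm q10).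
    by rewrite -[leRHS]mul1r -pq1 mulrDl lerD// ler_pM2l.
  case: ifPn => [cn|_]; last by rewrite powR0 ?gt_eqF// mul0r; case: ifP => // _; exact: shifted_box_ge0.
  case: ifPn => [en|_]; last by rewrite powR0 ?gt_eqF// mulr0; case: ifP => // _; exact: shifted_box_ge0.
  rewrite ifT; last first.
    have -> : p1 * c1 n + q1 * c2 n + (p1 * x + q1 * y) =
        p1 * (c1 n + x) + q1 * (c2 n + y) by ring.
    exact: mid1.
  apply: le_trans (IH W _ _ _ _ SW' a0' p10 q10 pq1) _.
  by apply: le_of_eq; congr (shifted_box _ _ _ _); apply/funext => j; ring.
have [s s0 sE] : exists2 s : R, s != 0 & forall A : set R, measurable A ->
    P (X @^-1` A) = gaussian_law 0 s A.
  have SX := SZ n (ltnSn n).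
  exists (Num.sqrt (cov P X X)); last exact: (gs_lawE gS SX).
  by rewrite sqrtr_eq0 -ltNge lt_neqAle eq_sym v0 cov_ge0.
have mX : measurable_fun setT X by exact: (gs_measurable gS (SZ n (ltnSn n))).
have lk c' : log_concave (k c').
  split=> [x|p1 q1 x y p10 q10 pq1]; first exact: k0.
  apply: le_trans (kk c' c' p1 q1 x y p10 q10 pq1) _.
  apply: le_of_eq; congr (k _ _); apply/funext => j.
  by rewrite -mulrDl pq1 mul1r.
have mk c' : measurable_fun setT (k c') by exact: log_concave_measurable.
pose phi : R -> R := normal_pdf 0 s.
pose f c' x := k c' x * phi x.
have phi0 x : 0 <= phi x by exact: normal_pdf_ge0.
have f0 c' x : 0 <= f c' x by exact: mulr_ge0.
have mf c' : measurable_fun setT (f c').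
  by apply: measurable_funM => //; exact: measurable_normal_pdf.
have fi c' : (@lebesgue_measure R).-integrable setT (EFin \o f c').
  apply: (@le_integrable _ _ _ (@lebesgue_measure R) _ measurableT _ (fun x => (phi x)%:E)).
  - by apply/measurable_EFinP; exact: mf.
  - move=> x _ /=; rewrite lee_fin (ger0_norm (f0 _ _)) (ger0_norm (phi0 _)).
    by rewrite /f ler_piMl.
  - exact: integrable_normal_pdf.
have ff c1 c2 (p1 q1 x y : R) : 0 < p1 -> 0 < q1 -> p1 + q1 = 1 ->
    f c1 x `^ p1 * f c2 y `^ q1 <= f (fun j => p1 * c1 j + q1 * c2 j) (p1 * x + q1 * y).
  move=> p10 q10 pq1; rewrite /f !powRM// mulrACA.
  by rewrite ler_pM ?mulr_ge0 ?powR_ge0//; [exact: kk|exact: normal_pdf_log_concave].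
have lf c' : log_concave (f c').
  split=> [x|p1 q1 x y p10 q10 pq1]; first exact: f0.
  apply: le_trans (ff c' c' p1 q1 x y p10 q10 pq1) _.
  apply: le_of_eq; congr (f _ _); apply/funext => j.
  by rewrite -mulrDl pq1 mul1r.
have BE c' : shifted_box n.+1 Z a c' = \int[@lebesgue_measure R]_x f c' x.
  have [_ ->] := shifted_box_residual SZ a0 v0 c' (leqnn n.+1).
  by rewrite -(Rintegral_gaussian mX sE s0 (mk c') (fi c')).
rewrite !BE.
apply: (@prekopa_leindler R p q (normal_peak s)) => //.
- move=> x; rewrite f0/= (le_trans _ (normal_pdf_ub 0 x s0))//.
  by rewrite /f ler_piMl.
- move=> x; rewrite f0/= (le_trans _ (normal_pdf_ub 0 x s0))//.
  by rewrite /f ler_piMl.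
- by move=> t; apply: log_concave_interval.
- by move=> x y; exact: ff.
Qed.

(** Given the last coordinate, the probability of the other constraints is an even log-concave
    function [k] of it, hence nonincreasing in its absolute value. Restricting the last coordinate
    to a slab around 0 can therefore only raise that probability. *)
Lemma sidak_step n (Z : nat -> T -> R) (a : nat -> R) :
  (forall j, (j < n.+1)%N -> S (Z j)) -> (forall j, (j < n.+1)%N -> 0 <= a j) ->
  fine (P [set w | `|Z n w| <= a n]) * fine (P (box n Z a)) <=
  fine (P (box n.+1 Z a)).
Proof.
move=> SZ a0.
have SZ' j : (j < n)%N -> S (Z j) by move=> /ltnW; exact: SZ.
have a0' j : (j < n)%N -> 0 <= a j by move=> /ltnW; exact: a0.
have B0 m (U : nat -> T -> R) : fine (P (box m U a)) = shifted_box m U a (fun=> 0).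
  rewrite /shifted_box; congr (fine (P (box _ _ _))).
  by apply/funext => j; apply/funext => w; rewrite addr0.
have mXn := gs_measurable gS (SZ n (ltnSn n)).
have mI : measurable [set w | `|Z n w| <= a n] by exact: measurable_slab.
pose pI := fine (P [set w | `|Z n w| <= a n]).
have pI1 : pI <= 1 by rewrite -lee_fin fineK ?fin_num_measure// probability_le1.
rewrite -/pI !B0.
have [v0|v0] := eqVneq (cov P (Z n) (Z n)) 0.
  rewrite (box_degenerate _ _ SZ v0) normr0 a0//.
  by rewrite ler_piMl ?shifted_box_ge0.
pose X := Z n; pose b j := cov P (Z j) X / cov P X X.
pose W j w := Z j w - b j * X w.
have SW j : (j < n.+1)%N -> S (W j) by exact: residual_gs.
have SW' j : (j < n)%N -> S (W j) by move=> /ltnW; exact: SW.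
have mW j : (j < n)%N -> measurable_fun setT (W j).
  by move=> jn; exact: (gs_measurable gS (SW' j jn)).
pose k s := shifted_box n W a (fun j => 0 + b j * s).
have k0 s : 0 <= k s by exact: shifted_box_ge0.
have [_ E1] := shifted_box_residual SZ a0 v0 (fun=> 0) (leqnn n.+1).
have [ik E2] := shifted_box_residual SZ a0 v0 (fun=> 0) (leqnSn n).
rewrite E1 E2 -/(k _).
under [leRHS]eq_Rintegral do rewrite (shifted_box_last _ SZ v0) add0r -/(k _).
have lk : log_concave k.
  split=> [x|p q x y p0 q0 pq]; first exact: k0.
  apply: le_trans (shifted_box_log_concave _ _ SW' a0' p0 q0 pq) _.
  by apply: le_of_eq; congr (shifted_box _ _ _ _); apply/funext => j; ring.
have ek s : k (- s) = k s.
  have := gs_box_opp gS (fun j => b j * s) SW' a0'.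
  rewrite /k /shifted_box => h.
  have e1 : (fun j w => W j w + (0 + b j * - s)) = (fun j w => W j w - b j * s).
    by apply/funext => j; apply/funext => w; ring.
  have e2 : (fun j w => W j w + (0 + b j * s)) = (fun j w => W j w + b j * s).
    by apply/funext => j; apply/funext => w; ring.
  by rewrite e1 e2 h.
pose k1 := k (a n).
have an0 : 0 <= a n by exact: a0.
(* Chebyshev's association inequality, [k] being larger on the slab. *)
pose I w : R := if `|X w| <= a n then 1 else 0.
have IE w : I w = \1_[set w | `|Z n w| <= a n] w.
  by rewrite indicE /I /X; case: ifPn => h; [rewrite mem_set|rewrite memNset//; apply/negP].
have bI : bmeas I.
  split; first by rewrite (_ : I = \1_[set w | `|Z n w| <= a n]); [exact: measurable_indic|apply/funext].
  by exists 1 => w; rewrite /I; case: ifP => _; rewrite ?normr1 ?normr0.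
have bk : bmeas (fun w => k (X w)).
  split; first by apply: (measurableT_comp _ mXn); exact: log_concave_measurable.
  by exists 1 => w; rewrite ger0_norm// shifted_box_le1.
have intI : \int[P]_w I w = pI.
  rewrite /Rintegral /pI; congr fine; under eq_integral do rewrite IE.
  by rewrite integral_indic// setIT.
have key w : (I w - pI) * k1 <= (I w - pI) * k (X w).
  rewrite /I; case: ifPn => h.
    rewrite ler_wpM2l ?subr_ge0//; apply: (log_concave_even lk ek).
    by rewrite (ger0_norm an0).
  rewrite ler_wnM2l//; first by rewrite sub0r oppr_le0 fine_ge0.
  apply: (log_concave_even lk ek); rewrite (ger0_norm an0) ltW//.
  by rewrite ltNge.
have bIp : bmeas (fun w => I w - pI) by apply: bmeasD => //; exact: bmeas_cst.
have bIk : bmeas (fun w => I w * k (X w)) by exact: bmeasM.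
have bpk : bmeas (fun w => pI * k (X w)) by apply: bmeasM => //; exact: bmeas_cst.
have h : 0 <= \int[P]_w ((I w - pI) * k (X w)).
  apply: (@le_trans _ _ (\int[P]_w ((I w - pI) * k1))); last first.
    apply: le_Rintegral => //; apply: bmeas_integrable; apply: bmeasM => //.
    exact: bmeas_cst.
  rewrite RintegralZr//; last exact: bmeas_integrable.
  rewrite RintegralB//; [|exact: bmeas_integrable|exact/bmeas_integrable/bmeas_cst].
  by rewrite Rintegral_cst_probability intI subrr mul0r.
move: h; under eq_Rintegral do rewrite mulrBl.
rewrite RintegralB//; [|exact: bmeas_integrable|exact: bmeas_integrable].
rewrite (RintegralZl _ measurableT (bmeas_integrable P bk)).
rewrite subr_ge0 => /le_trans; apply; apply/le_of_eq/eq_Rintegral => w _.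
by rewrite /I /X; case: ifP => _; rewrite ?mul1r ?mul0r.
Qed.

Theorem sidak n (Z : nat -> T -> R) (a : nat -> R) :
  (forall j, (j < n)%N -> S (Z j)) -> (forall j, (j < n)%N -> 0 <= a j) ->
  \prod_(j < n) fine (P [set w | `|Z j w| <= a j]) <= fine (P (box n Z a)).
Proof.
elim: n => [|n IH] SZ a0.
  rewrite big_ord0 (_ : box _ _ _ = setT); last by apply/seteqP; split.
  by rewrite probability_setT.
rewrite big_ord_recr/= mulrC; apply: le_trans (sidak_step SZ a0).
rewrite ler_wpM2l ?fine_ge0//; apply: IH => j /ltnW; [exact: SZ|exact: a0].
Qed.

End sidak.

(** * Small balls of one Gaussian variable *)

Section normal_bounds.
Context (R : realType).
Let mu := @lebesgue_measure R.

Lemma normal_peak2 (s : R) : normal_peak (2 * s) = normal_peak s / 2.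
Proof.
rewrite /normal_peak exprMn -mulrA -mulrnAr sqrtrM ?sqr_ge0// sqrtr_sqr ger0_norm//.
by rewrite invfM mulrC.
Qed.

(** Comparison with the density of deviation [2 s]: their ratio is [2 exp(-3 x^2 / (8 s^2))], at
    most [2 exp(-y^2 / (4 s^2))] on the tail. *)
Lemma normal_tail (s y : R) : s != 0 -> 0 <= y ->
  (normal_prob 0 s [set x | (y < `|x|)%R] <= (2 * expR (- (y ^+ 2 / (4 * s ^+ 2))))%:E)%E.
Proof.
move=> s0 y0; have s20 : 2 * s != 0 by rewrite mulf_neq0// pnatr_eq0.
have s2 : 0 < s ^+ 2 by rewrite lt0r sqr_ge0 expf_neq0.
set c := expR _; have c0 : 0 < c by exact: expR_gt0.
have mA : measurable [set x : R | y < `|x|].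
  rewrite (_ : [set x | _] = ~` [set x : R | `|x| <= y]); last first.
    by apply/seteqP; split => x /=; rewrite ltNge => /negP.
  by apply: measurableC; exact: (@measurable_slab _ R R id).
rewrite /normal_prob.
apply: (@le_trans _ _ (\int[mu]_(x in [set x | (y < `|x|)%R]) ((2 * c)%:E * (normal_pdf 0 (2 * s) x)%:E))%E).
  apply: ge0_le_integral => //.
  - by move=> x _; rewrite lee_fin normal_pdf_ge0.
  - by apply/measurable_EFinP; apply: measurable_funTS; exact: measurable_normal_pdf.
  - apply: measurable_funeM; apply/measurable_EFinP; apply: measurable_funTS.
    exact: measurable_normal_pdf.
  move=> x /= yx; rewrite -EFinM lee_fin !normal_pdfE// /normal_fun !subr0 normal_peak2.
  rewrite (_ : 2 * c * _ = normal_peak s * (c * expR (- x ^+ 2 / ((2 * s) ^+ 2 *+ 2)))); last by field.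
  rewrite ler_pM2l ?normal_peak_gt0// -expRD ler_expR.
  have yx2 : y ^+ 2 <= x ^+ 2.
    by rewrite -[leRHS](real_normK (num_real x)) lerXn2r ?nnegrE// ltW.
  rewrite -subr_ge0 (_ : _ - _ = (3 * x ^+ 2 - 2 * y ^+ 2) / (8 * s ^+ 2)); last by field.
  by apply: divr_ge0; [have := sqr_ge0 x; lra|rewrite mulr_ge0// ltW].
have i2 := @integrable_normal_pdf R 0 (2 * s).
rewrite integralZl//; last exact: (integrableS measurableT _ _ i2).
rewrite -[leRHS]mule1 lee_wpmul2l//; first by rewrite lee_fin mulr_ge0// ltW.
rewrite -(@integral_normal_pdf R 0 (2 * s)).
apply: ge0_subset_integral => //.
- by apply/measurable_EFinP; exact: measurable_normal_pdf.
- by move=> x _; rewrite lee_fin normal_pdf_ge0.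
Qed.

(** Twice the standard normal density at 1, which is its minimum on [[-1, 1]]. *)
Definition small_ball_const : R := 2 * normal_peak 1 * expR (- 2^-1).

Lemma small_ball_const_gt0 : 0 < small_ball_const.
Proof.
by rewrite /small_ball_const mulr_gt0 ?expR_gt0// mulr_gt0// normal_peak_gt0// oner_neq0.
Qed.

Lemma normal_small_ball (s y : R) : 0 < s -> 0 <= y <= s ->
  ((small_ball_const * (y / s))%:E <= normal_prob 0 s [set x | (`|x| <= y)%R])%E.
Proof.
move=> s0 /andP[y0 ys]; have sn0 : s != 0 by rewrite gt_eqF.
have AE : [set x : R | `|x| <= y] = [set` `[- y, y]].
  by apply/seteqP; split => x /=; rewrite in_itv/= ler_norml.
rewrite AE /normal_prob.
pose c := normal_peak s * expR (- 2^-1).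
apply: (@le_trans _ _ (\int[mu]_(x in [set` `[(- y)%R, y]]) (cst c%:E x))%E).
  rewrite integral_cst// [X in (_ <= _ * X)%E](lebesgue_measure_itv `[- y, y])/= lte_fin.
  have pE : normal_peak s = normal_peak 1 / s.
    rewrite /normal_peak expr1n -mulrnAr sqrtrM ?sqr_ge0// sqrtr_sqr gtr0_norm//.
    by rewrite mul1r invfM mulrC.
  case: ltP => h.
    rewrite -EFinB -EFinM lee_fin /c pE /small_ball_const.
    by apply: le_of_eq; field.
  have -> : y = 0 by apply/eqP; rewrite eq_le y0 andbT; move: h; lra.
  by rewrite mul0r mulr0 mule0.
apply: ge0_le_integral => //.
- by move=> x _; rewrite lee_fin mulr_ge0 ?normal_peak_ge0 ?expR_ge0.
- by apply/measurable_EFinP; apply: measurable_funTS; exact: measurable_normal_pdf.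
move=> x /=; rewrite in_itv/= -ler_norml => xy.
rewrite lee_fin normal_pdfE// /normal_fun subr0 /c ler_pM2l ?normal_peak_gt0//.
rewrite ler_expR mulNr lerN2 -mulr_natr.
rewrite ler_pdivrMr; last by rewrite mulr_gt0// exprn_gt0.
have : x ^+ 2 <= s ^+ 2.
  by rewrite -(real_normK (num_real x)) lerXn2r ?nnegrE ?normr_ge0 ?(ltW s0)// (le_trans xy).
lra.
Qed.

End normal_bounds.

Section small_ball.
Context d (T : measurableType d) (R : realType) (P : probability T R).
Variable S : set (T -> R).
Hypothesis gS : gaussian_space P S.

(** The density bound serves small [u] and the tail bound large [u]. A smaller variance only helps,
    so [s ^+ 2] need only dominate it. The outer minimum with 1 accommodates variance 0, where the
    probability is 1. *)
Lemma small_ball_lower X s u : S X -> 0 < s -> 0 < u -> cov P X X <= s ^+ 2 ->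
  Num.max (Num.min 1 (small_ball_const R * Num.min 1 u)) (1 - 2 * expR (- (u ^+ 2 / 4))) <=
  fine (P [set w | `|X w| <= u * s]).
Proof.
move=> SX s0 u0 vs.
have us0 : 0 <= u * s by rewrite mulr_ge0// ltW.
have mX := gs_measurable gS SX.
have mA : measurable [set w | `|X w| <= u * s] by exact: measurable_slab.
have [v0|vn0] := eqVneq (cov P X X) 0.
  have -> : P [set w | `|X w| <= u * s] = 1%E.
    rewrite -(@probability_setT _ _ _ P); apply: ae_measure_eq => //.
    by apply: filterS (cov0_ae gS SX v0) => w /= ->; rewrite normr0.
  by rewrite /= ge_max ge_min lexx/= lerBlDr lerDl mulr_ge0// expR_ge0.
have v0 : 0 < cov P X X by rewrite lt0r vn0 cov_ge0.
pose r := Num.sqrt (cov P X X).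
have r0 : 0 < r by rewrite sqrtr_gt0.
have rs : r <= s.
  by rewrite -(ler_pXn2r (n := 2)) ?nnegrE ?(ltW s0) ?(ltW r0)// sqr_sqrtr// ltW.
have mB y : measurable [set x : R | `|x| <= y] by exact: (@measurable_slab _ R R id).
have PE : P [set w | `|X w| <= u * s] = normal_prob 0 r [set x | `|x| <= u * s].
  rewrite -[LHS]/(P (X @^-1` [set x | `|x| <= u * s])) (gs_lawE gS SX)//.
  by rewrite /gaussian_law gt_eqF.
rewrite ge_max; apply/andP; split.
  rewrite ge_min; apply/orP; right.
  rewrite -lee_fin fineK ?fin_num_measure// PE.
  pose y := r * Num.min 1 u.
  have yr : 0 <= y <= r.
    apply/andP; split; first by rewrite mulr_ge0 ?(ltW r0)// le_min ler01 ltW.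
    by rewrite ler_piMr ?(ltW r0)// ge_min lexx.
  have := @normal_small_ball R r y r0 yr.
  have -> : y / r = Num.min 1 u by rewrite /y mulrC mulKf ?gt_eqF.
  move=> /le_trans; apply.
  apply: le_measure; [by apply/mem_set; exact: mB|by apply/mem_set; exact: mB|].
  move=> x /= /le_trans; apply.
  apply: (@le_trans _ _ (r * u)); first by rewrite ler_pM2l// ge_min lexx orbT.
  by rewrite mulrC ler_pM2l.
have -> : fine (P [set w | `|X w| <= u * s]) =
    1 - fine (normal_prob 0 r [set x | u * s < `|x|]).
  have -> : [set x : R | u * s < `|x|] = ~` [set x | `|x| <= u * s].
    by apply/seteqP; split => x /=; rewrite ltNge => /negP.
  have e : normal_prob 0 r (~` [set x | `|x| <= u * s]) =
      (1 - P [set w | (`|X w| <= u * s)%R])%E.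
    by rewrite PE; exact: (probability_setC (normal_prob 0 r) (mB (u * s))).
  by rewrite e fineB ?fin_num_measure//= subKr.
rewrite lerD2l lerN2 -lee_fin fineK; last first.
  rewrite fin_num_measure// (_ : [set x | _] = ~` [set x | `|x| <= u * s]); last first.
    by apply/seteqP; split => x /=; rewrite ltNge => /negP.
  by apply: measurableC; exact: mB.
apply: le_trans (normal_tail _ us0) _; first by rewrite gt_eqF.
rewrite lee_fin ler_pM2l// ler_expR lerN2 exprMn.
have r2 : 0 < r ^+ 2 by rewrite exprn_gt0.
rewrite [leRHS](_ : _ = u ^+ 2 / 4 * (s ^+ 2 / r ^+ 2)); last by field; rewrite gt_eqF.
rewrite ler_peMr ?divr_ge0 ?sqr_ge0// ler_pdivlMr// mul1r.
by rewrite lerXn2r ?nnegrE// ltW.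
Qed.

End small_ball.

Section small_ball_exponent.
Context (R : realType).

Lemma expR_powR_le (p u : R) : 0 < u -> 0 <= p ->
  expR (- (u ^+ 2 / 4)) <= expR (p ^+ 2) * u `^ (- p).
Proof.
move=> u0 p0; rewrite /powR gt_eqF// -expRD ler_expR.
have lu : ln u <= u by have := ln_sublinear u0; lra.
have := sqr_ge0 (u / 2 - p); have : p * ln u <= p * u by rewrite ler_wpM2l.
rewrite mulNr sqrrB; lra.
Qed.

(* [- ln P(|X| <= u s)] is at most [C u^(- p)], and [C u^(- 1/2)] for small [u]. *)
Lemma small_ball_exponent (p : R) : 2^-1 <= p -> exists2 C : R, 0 < C &
  forall u, 0 < u ->
    let m := Num.max (Num.min 1 (small_ball_const R * Num.min 1 u))
                     (1 - 2 * expR (- (u ^+ 2 / 4))) in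
    expR (- (C * u `^ (- p))) <= m /\ (u <= 1 -> expR (- (C * u `^ (- 2^-1))) <= m).
Proof.
move=> p2; have p0 : 0 < p by rewrite (lt_le_trans _ p2).
have c0 := small_ball_const_gt0 R; set c := small_ball_const R in c0 *.
pose L : R := `|ln c|.
have L0 : 0 <= L by exact: normr_ge0.
have cL : expR (- L) <= c.
  by rewrite -[leRHS]lnK ?posrE// ler_expR lerNl /L -normrN ler_norm.
pose E : R := expR (p ^+ 2).
have E1 : 1 <= E by rewrite -expR0 ler_expR sqr_ge0.
(* The first summand serves [u <= 1], where the probability is at least [c u] and
   [- ln u <= 2 u^(-1/2)]; the second serves [u > 1], through [exp(-u^2 / 4) <= E u^(-p)]. *)
pose C := (L + 2) + 4 * (L + 1) * E.
have CL : L + 2 <= C by rewrite /C lerDl; nra.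
have CE : 4 * (L + 1) * E <= C by rewrite /C; lra.
have C0 : 0 < C by lra.
exists C => // u u0 m.
have small : u <= 1 -> expR (- (C * u `^ (- 2^-1))) <= m.
  move=> u1; set v := u `^ _.
  have v1 : 1 <= v.
    rewrite /v /powR gt_eqF// -expR0 ler_expR mulNr -mulrN.
    by rewrite mulr_ge0// oppr_ge0 ln_le0.
  have lnu : expR (- (2 * v)) <= u.
    rewrite -[leRHS](@lnK _ u) ?posrE// ler_expR lerNl.
    have -> : ln u = - 2 * ln v by rewrite /v ln_powR; field.
    have v0 : 0 < v by rewrite (lt_le_trans _ v1).
    have := ln_sublinear v0; lra.
  apply: (@le_trans _ _ (expR (- L) * expR (- (2 * v)))).
    rewrite -expRD ler_expR -opprD lerN2.
    apply: (@le_trans _ _ ((L + 2) * v)); first by rewrite [leRHS]mulrDl lerD2r ler_peMr.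
    by rewrite ler_pM2r// (lt_le_trans _ v1).
  rewrite /m le_max le_min (min_idPr u1); apply/orP; left; apply/andP; split.
    by rewrite -expRD -[leRHS]expR0 ler_expR; lra.
  by rewrite ler_pM ?expR_ge0.
split => //.
have [u1|u1] := leP u 1.
  apply: le_trans (small u1); rewrite ler_expR lerN2 ler_pM2l//.
  rewrite /powR gt_eqF// ler_expR !mulNr lerN2 ler_wnM2r// ln_le0//.
set z := expR (- (u ^+ 2 / 4)).
have z0 : 0 < z by exact: expR_gt0.
have zE : z <= E * u `^ (- p) by apply: expR_powR_le => //; exact: ltW.
apply: (@le_trans _ _ (expR (- (4 * (L + 1) * z)))).
  rewrite ler_expR lerN2; apply: (@le_trans _ _ (4 * (L + 1) * (E * u `^ (- p)))).
    by rewrite ler_wpM2l// mulr_ge0// addr_ge0.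
  by rewrite mulrA ler_wpM2r// powR_ge0.
rewrite /m le_max (min_idPl (ltW u1)) mulr1 le_min.
(* If [4 z <= 1], then [1 - 2 z >= 1 / (1 + 4 z) >= exp(-4 z)]. Otherwise the exponent exceeds [L],
   and the constant bound [c] is enough. *)
have [z4|z4] := leP (4 * z) 1.
  apply/orP; right; apply: (@le_trans _ _ (expR (- (4 * z)))).
    by rewrite ler_expR lerN2; nra.
  rewrite expRN; have := expR_ge1Dx (4 * z) => h.
  apply: (@le_trans _ _ (1 + 4 * z)^-1); first by rewrite lef_pV2 ?posrE ?expR_gt0//; lra.
  rewrite -/z -[leLHS]mul1r ler_pdivrMr; last by lra.
  by nra.
apply/orP; left; apply/andP; split.
  by rewrite -[leRHS]expR0 ler_expR oppr_le0 mulr_ge0 ?(ltW z0)// mulr_ge0// addr_ge0.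
apply: le_trans cL; rewrite ler_expR lerN2; nra.
Qed.

End small_ball_exponent.

(** * Increments of the bifractional Brownian motion *)

(** Midpoint concavity of the power [K]: multiply by [m^(1-K)], where [m] is the midpoint, and apply
    the weighted mean inequality to [(a, m)] and [(b, m)]. *)
Lemma powR_midpoint (R : realType) (a b K : R) : 0 <= a -> 0 <= b ->
  0 < K -> K <= 1 -> a `^ K + b `^ K <= 2 * ((a + b) `^ K / 2 `^ K).
Proof.
move=> a0 b0 K0 K1.
have [->|K1'] := eqVneq K 1.
  rewrite !powRr1 ?addr_ge0//; by rewrite mulrCA divff ?mulr1// pnatr_eq0.
have {}K1 : 0 < 1 - K by rewrite subr_gt0 lt_neqAle K1'.
have KK : K + (1 - K) = 1 by ring.
pose m := (a + b) / 2.
have m0 : 0 <= m by rewrite divr_ge0// addr_ge0.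
have -> : (a + b) `^ K / 2 `^ K = m `^ K.
  rewrite /m powRM ?addr_ge0 ?invr_ge0//; congr (_ * _).
  apply: (@mulIf _ (2 `^ K)); first by rewrite gt_eqF// powR_gt0.
  by rewrite mulVf ?gt_eqF ?powR_gt0// -powRM ?invr_ge0// mulVf ?pnatr_eq0// powR1.
have [mz|mn0] := eqVneq m 0.
  have : a + b = 0 by move/eqP: mz; rewrite mulf_eq0 invr_eq0 pnatr_eq0 orbF => /eqP.
  move=> ab; have -> : a = 0 by lra. have -> : b = 0 by lra.
  by rewrite mz powR0 ?gt_eqF// addr0 mulr0.
have mp : 0 < m by rewrite lt0r mn0.
have q0 : 0 < m `^ (1 - K) by rewrite powR_gt0.
rewrite -(ler_pM2r q0) mulrDl -[2 * _ * _]mulrA powR_conjugate//.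
have := powR_amgm a0 m0 K0 K1 KK; have := powR_amgm b0 m0 K0 K1 KK.
have : a + b = 2 * m by rewrite /m; field.
nra.
Qed.

Section bifractional.
Context d (T : measurableType d) (R : realType) (P : probability T R).
Variables (H K : R) (B : R -> {RV P >-> R}).
Hypotheses (H0 : 0 < H) (K0 : 0 < K) (K1 : K <= 1).
Hypothesis bifbmB : bifractional_brownian_motion H K B.

Definition bifbm_span : set (T -> R) := [set X | exists n (t a : 'I_n -> R),
  (forall i, 0 <= t i) /\ X = (fun w => \sum_(i < n) a i * B (t i) w)].

Let B_integrable t : 0 <= t ->
  P.-integrable setT (fun w => (B t w)%:E) /\ \int[P]_w B t w = 0.
Proof.
move=> t0.
have ti (i : 'I_1) : [set` `[0, +oo[] t by rewrite /= in_itv/= t0.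
have [m [s law]] := @bifbm_gaussian _ _ _ _ _ _ _ bifbmB 1%N (fun=> t) (fun=> 1) ti.
have law' (A : set R) : measurable A -> P (B t @^-1` A) = gaussian_law m s A.
  move=> mA; rewrite -law//; congr (P _); apply/seteqP.
  by split => w /=; rewrite big_ord1 mul1r.
have mB : measurable_fun setT (B t) by exact: measurable_funPT.
have [i _] := gaussian_mean mB law'.
split => //; rewrite /Rintegral.
by have := bifbm_centered bifbmB t0; rewrite unlock => ->.
Qed.

Lemma bifbm_gaussian_space : gaussian_space P bifbm_span.
Proof.
have mX n (t a : 'I_n -> R) : measurable_fun setT (fun w => \sum_(i < n) a i * B (t i) w).
  by apply: measurable_sum => i; apply: measurable_funM => //; exact: measurable_funPT.
split.
- by move=> X [n [t [a [_ ->]]]]; exact: mX.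
- move=> X Y [n [t [a [t0 ->]]]] [m [u [b [u0 ->]]]].
  exists (n + m)%N, (fun i => match fintype.split i with inl j => t j | inr j => u j end),
    (fun i => match fintype.split i with inl j => a j | inr j => b j end); split.
    by move=> i; case: fintype.split => j.
  apply/funext => w; rewrite big_split_ord/=; congr (_ + _); apply: eq_bigr => i _.
    by rewrite -[lshift _ _]/(unsplit (inl i)) unsplitK.
  by rewrite -[rshift _ _]/(unsplit (inr i)) unsplitK.
- move=> c X [n [t [a [t0 ->]]]]; exists n, t, (fun i => c * a i); split => //.
  by apply/funext => w; rewrite mulr_sumr; apply: eq_bigr => i _; rewrite mulrA.
- move=> X [n [t [a [t0 ->]]]].
  have ti i : [set` `[0, +oo[] (t i) by rewrite /= in_itv/= t0.
  have [m [s law]] := @bifbm_gaussian _ _ _ _ _ _ _ bifbmB n t a ti.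
  exists s => A mA.
  have [_ mE] := gaussian_mean (mX n t a) law.
  suff m0 : m = 0 by rewrite -[X in gaussian_law X]m0 law.
  rewrite -mE; clear law mE ti.
  have H1 : P.-integrable setT (fun w => (\sum_(i < n) a i * B (t i) w)%:E) /\
      \int[P]_w (\sum_(i < n) a i * B (t i) w) = 0.
    elim: n t a t0 => [|n IH] t a t0.
      under eq_fun do rewrite big_ord0; split; first exact: finite_measure_integrable_cst.
      by under eq_Rintegral do rewrite big_ord0; rewrite Rintegral_cst_probability.
    have [i1 e1] := IH (fun i => t (widen_ord (leqnSn n) i)) (fun i => a (widen_ord (leqnSn n) i)) (fun i => t0 _).
    have [i2 e2] := B_integrable (t0 ord_max).
    have i3 : P.-integrable setT (fun w => (a ord_max * B (t ord_max) w)%:E).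
      by under eq_fun do rewrite EFinM; exact: integrableZl.
    split.
      under eq_fun do rewrite big_ord_recr/= EFinD.
      exact: integrableD.
    under eq_Rintegral do rewrite big_ord_recr/=.
    by rewrite RintegralD// e1 RintegralZl// e2 mulr0 addr0.
  by case: H1.
Qed.

Let gS := bifbm_gaussian_space.

Lemma bifbm_span_B t : 0 <= t -> bifbm_span (B t).
Proof.
move=> t0; exists 1%N, (fun=> t), (fun=> 1); split => //.
by apply/funext => w; rewrite big_ord1 mul1r.
Qed.

Lemma bifbm_covE s t : 0 <= s -> 0 <= t ->
  cov P (B s) (B t) = bifbm_cov H K s t.
Proof.
move=> s0 t0; have := bifbm_covariance bifbmB s0 t0; rewrite unlock.
rewrite !(bifbm_centered bifbmB)// => /(congr1 fine) /= <-.
rewrite /cov unlock; apply: eq_Rintegral => w _ /=.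
by rewrite !fctE/= !subr0.
Qed.

Lemma bifbm_cov_diag t : 0 <= t -> bifbm_cov H K t t = t `^ (2 * H * K).
Proof.
move=> t0; rewrite /bifbm_cov subrr normr0 powR0 ?subr0; last first.
  by rewrite !mulf_neq0 ?gt_eqF.
have -> : t `^ (2 * H) + t `^ (2 * H) = 2 * t `^ (2 * H) by ring.
rewrite (@powRM _ 2)// ?powR_ge0// mulKf; first by rewrite -powRrM.
by rewrite gt_eqF// powR_gt0.
Qed.

(** The variance is [t^(2HK) + s^(2HK) - 2^(1-K) (t^(2H) + s^(2H))^K + 2^(1-K) |t - s|^(2HK)]. By
    [powR_midpoint] the first three terms have a nonpositive sum, and [2^(1-K) <= 2]. *)
Lemma bifbm_increment s t : 0 <= s -> 0 <= t ->
  bifbm_span (fun w => B t w - B s w) /\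
  cov P (fun w => B t w - B s w) (fun w => B t w - B s w) <=
  2 * `|t - s| `^ (2 * H * K).
Proof.
move=> s0 t0; have Ss := bifbm_span_B s0; have St := bifbm_span_B t0.
have SX := gs_sub gS St Ss; split => //.
have E (X Y : T -> R) : bifbm_span X -> bifbm_span Y ->
    cov P (fun w => X w - Y w) (fun w => X w - Y w) =
    cov P X X - 2 * cov P X Y + cov P Y Y.
  move=> SX' SY.
  have -> : (fun w => X w - Y w) = (fun w => (-1) * Y w + X w).
    by apply/funext => w; ring.
  have SN := gs_scale gS (-1) SY; have SD := gs_add gS SN SX'.
  rewrite (covDl gS SN SX' SD) (covZl gS _ SY SD) (covC P Y) (covC P X).
  rewrite (covDl gS SN SX' SY) (covDl gS SN SX' SX') !(covZl gS)//.
  by rewrite (covC P Y X); ring.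
rewrite E// !bifbm_covE// !bifbm_cov_diag//.
rewrite /bifbm_cov [s `^ (2 * H) + _]addrC (distrC s t).
have a0 := powR_ge0 t (2 * H); have b0 := powR_ge0 s (2 * H).
have := powR_midpoint a0 b0 K0 K1; rewrite -!powRrM.
set G := (_ + _) `^ K; set D := `|_| `^ _.
have p2 : 1 <= 2 `^ K.
  by rewrite -[leLHS](powRr0 2); apply: ler_powR; [rewrite ler1n|exact: ltW].
have D0 : 0 <= D by exact: powR_ge0.
have h : (2 `^ K)^-1 * D <= D.
  by rewrite ler_piMl// invf_le1// (lt_le_trans _ p2).
rewrite mulrBr [G / _]mulrC; move: h; set u := (2 `^ K)^-1; lra.
Qed.

End bifractional.

(** * Dyadic control of paths and measurability of the deviation *)

Definition dyadic (R : realType) (j k : nat) : R := k%:R / 2 ^+ j.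

Section dyadic_paths.
Context (R : realType).
Implicit Types f : R -> R.
Local Notation dy := (@dyadic R).

Lemma dyadic_ge0 j k : 0 <= dy j k.
Proof. by rewrite divr_ge0// exprn_ge0. Qed.

Lemma dyadic_le1 j k : (k <= 2 ^ j)%N -> dy j k <= 1.
Proof. by move=> kj; rewrite ler_pdivrMr ?exprn_gt0// mul1r -natrX ler_nat. Qed.

Lemma dyadic_double j k : dy j.+1 k.*2 = dy j k.
Proof.
rewrite /dyadic exprS -muln2 natrM; field.
by rewrite expf_neq0// pnatr_eq0.
Qed.

(** Each level costs at most one increment: an even index is already a point of the previous level,
    and an odd one has such a point as its left neighbour. *)
Lemma dyadic_chain f (y : nat -> R) (J : nat) : f 0 = 0 ->
  (forall j k, (j <= J)%N -> (k < 2 ^ j)%N -> `|f (dy j k.+1) - f (dy j k)| <= y j) ->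
  forall j k, (j <= J)%N -> (k <= 2 ^ j)%N -> `|f (dy j k)| <= \sum_(i < j.+1) y i.
Proof.
move=> f0 fy; have y0 j : (j <= J)%N -> 0 <= y j.
  by move=> jJ; apply: le_trans (fy j 0%N jJ _) => //; rewrite expn_gt0.
elim=> [|j IH] k jJ kj.
  rewrite big_ord1; case: k kj => [_|[_|//]].
    by rewrite /dyadic mul0r f0 normr0 y0.
  by have := fy 0%N 0%N isT isT; rewrite {2}/dyadic mul0r f0 subr0.
rewrite big_ord_recr/=; have jJ' := ltnW jJ.
have k2 : (k./2 <= 2 ^ j)%N.
  by rewrite -(half_double (2 ^ j)%N) half_leq// -mul2n -expnS.
have := IH k./2 jJ' k2; rewrite -dyadic_double => h.
have := odd_double_half k; case: (odd k) => /= kE; last first.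
  by rewrite -kE add0n (le_trans h)// lerDl y0.
have kl : (k./2.*2 < 2 ^ j.+1)%N by rewrite -add1n kE.
have h2 := fy j.+1 _ jJ kl; rewrite -[k in dy _ k]kE add1n.
rewrite -[f (dy _ _.+1)](subrK (f (dy j.+1 k./2.*2))) (le_trans (ler_normD _ _))//.
by rewrite addrC lerD.
Qed.

Lemma dyadic_dense f (c x : R) : {within [set` `[0, +oo[], continuous f} ->
  (forall j k, (k <= 2 ^ j)%N -> `|f (dy j k) - c| <= x) ->
  forall t, 0 <= t <= 1 -> `|f t - c| <= x.
Proof.
move=> /subspace_continuousP cf fx t /andP[t0 t1].
apply/ler_addgt0Pr => e e0.
have := cf t; rewrite /= in_itv/= t0 => /(_ isT) /cvgrPdist_lt /(_ e e0).
rewrite near_withinE => -[/= del del0 H].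
have [j hj] : exists j, (2 ^+ j)^-1 < del.
  have [n _ hn] := near_infty_natSinv_lt (PosNum del0).
  exists n; apply: le_lt_trans (hn n (leqnn n)).
  by rewrite lef_pV2 ?posrE ?exprn_gt0// -natrX ler_nat ltn_expl.
pose k := Num.truncn (t * 2 ^+ j).
have p0 : (0 : R) < 2 ^+ j by rewrite exprn_gt0.
have := truncn_itv (mulr_ge0 t0 (ltW p0)); rewrite -/k => /andP[k1 k2].
have kj : (k <= 2 ^ j)%N.
  rewrite -(ler_nat R) (le_trans k1)// natrX ler_piMl// ltW//.
have kt : dy j k <= t by rewrite ler_pdivrMr.
have tk : t - dy j k < (2 ^+ j)^-1.
  rewrite -(ltr_pM2r p0) mulrBl mulVf ?gt_eqF// divfK ?gt_eqF//.
  by rewrite ltrBlDl natr1.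
have := H (dy j k); rewrite /= ger0_norm ?subr_ge0// => /(_ (lt_trans tk hj)).
rewrite in_itv/= dyadic_ge0 => /(_ isT) h.
rewrite -(subrK (f (dy j k)) (f t)) -addrA (le_trans (ler_normD _ _))//.
by rewrite [leRHS]addrC lerD//; [exact: (ltW h)|exact: fx].
Qed.

End dyadic_paths.

Section max_deviation.
Context d (T : measurableType d) (R : realType) (P : probability T R).
Variables (H K : R) (B : R -> {RV P >-> R}).
Hypothesis bifbmB : bifractional_brownian_motion H K B.

(** Path continuity bounds the deviations on [[0, 1]]; for an unbounded set [sup] would take its
    default value 0 and say nothing about the path. *)
Lemma max_deviation_le (t0 x : R) w :
  max_deviation B t0 w <= x <-> forall t, 0 <= t <= 1 -> `|B t w - B t0 w| <= x.
Proof.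
rewrite /max_deviation; set E := [set _ | _ in _].
have E0 : E !=set0 by exists `|B 0 w - B t0 w|, 0 => //; rewrite /= in_itv/= lexx ler01.
split=> [sx t t01|h]; last first.
  by apply: ge_sup => // _ [t /= t01 <-]; apply: h; rewrite in_itv/= in t01.
apply: le_trans sx; apply: ub_le_sup; last by exists t.
have cB : {within `[0, 1], continuous (fun t => `|B t w - B t0 w|)}.
  have cB : {within [set` `[0, 1]], continuous (fun t => B t w)}.
    apply: (continuous_subspaceW _ (@bifbm_continuous _ _ _ _ _ _ _ bifbmB w)).
    by move=> z /=; rewrite !in_itv/= andbT => /andP[].
  move=> z; apply: (@cvg_norm _ R^o); apply: (@cvgB _ R^o); first exact: cB.
  exact: cvg_cst.
have [c _ hc] := EVT_max ler01 cB.
by exists `|B c w - B t0 w| => _ [s s01 <-]; exact: hc.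
Qed.

Lemma measurable_max_deviation (t0 x : R) : 0 <= t0 ->
  measurable [set w | max_deviation B t0 w <= x].
Proof.
move=> t00.
have -> : [set w | max_deviation B t0 w <= x] =
  \bigcap_(j in [set: nat]) \bigcap_(k in [set k | (k <= 2 ^ j)%N])
    [set w | `|B (dyadic R j k) w - B t0 w| <= x].
  apply/seteqP; split => w /=.
    move=> /max_deviation_le h j _ k /= kj; apply: h.
    by rewrite dyadic_ge0 dyadic_le1.
  move=> h; apply/max_deviation_le; apply: dyadic_dense.
    exact: (@bifbm_continuous _ _ _ _ _ _ _ bifbmB w).
  by move=> j k kj; exact: h.
apply: bigcapT_measurable => j; apply: bigcap_measurable.
  by exists 0%N.
move=> k _; apply: (@measurable_slab _ _ _ (fun w => B (dyadic R j k) w - B t0 w)).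
by apply: measurable_funB; exact: measurable_funPT.
Qed.

End max_deviation.

(** * Sums over dyadic levels and the lower bound *)

Lemma ltr_powR (R : realType) (a x y : R) : 1 < a -> x < y -> a `^ x < a `^ y.
Proof.
move=> a1 xy; have a0 : 0 < a by apply: lt_trans a1.
by rewrite /powR gt_eqF// ltr_expR ltr_pM2r// ln_gt0.
Qed.

Section geometric_sums.
Context (R : realType).

Let dist (i j : nat) := ((i - j) + (j - i))%N.

Lemma natrM_powRN n (a : R) :
  2 `^ (n%:R * - a) = ((2 ^+ n) `^ a)^-1.
Proof. by rewrite mulrN powRN powRrM powR_mulrn. Qed.

Lemma sum_geometric_dist (r : R) (i J : nat) : 0 <= r -> r < 1 ->
  \sum_(j < J) r ^+ dist j i <= 2 / (1 - r).
Proof.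
move=> r0 r1; have q0 : 0 < 1 - r by rewrite subr_gt0.
(* The right-hand side is the same sum over all integers below [J], negative ones included, so that
   the inductive step is an identity. *)
have h : \sum_(j < J) r ^+ dist j i <=
    (if (J <= i)%N then r * r ^+ (i - J) else r + 1 - r ^+ (J - i)) / (1 - r).
  elim: J => [|J IH].
    by rewrite big_ord0 /= divr_ge0 ?(ltW q0)// mulr_ge0// exprn_ge0.
  rewrite big_ord_recr/=; apply: le_trans (lerD IH (lexx _)) _.
  rewrite -[X in _ + X](@mulfK _ (1 - r)) ?gt_eqF// -mulrDl ler_pM2r ?invr_gt0//.
  have [Ji|Ji] := leqP J.+1 i.
    rewrite (ltnW Ji) /dist (eqP (_ : J - i == 0)%N) ?add0n; last by rewrite subn_eq0 ltnW.
    have -> : (i - J = (i - J.+1).+1)%N by rewrite subnSK.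
    by rewrite exprS; apply: le_of_eq; ring.
  have iJ : (i <= J)%N by [].
  rewrite /dist (eqP (_ : i - J == 0)%N) ?addn0 ?subn_eq0// subSn// exprS.
  have [Ji'|_] := leqP J i.
    have -> : J = i by apply/eqP; rewrite eqn_leq Ji'.
    by rewrite subnn expr0; apply: le_of_eq; ring.
  by apply: le_of_eq; ring.
apply: le_trans h _; rewrite ler_pM2r ?invr_gt0//; case: ifP => _.
  by have := exprn_ile1 (i - J)%N r0 (ltW r1); have := exprn_ge0 (i - J)%N r0; nra.
by have := exprn_ge0 (J - i)%N r0; lra.
Qed.

(** Writing [m.+1] as [2^j + k] with [k < 2^j] numbers the dyadic intervals like a binary heap:
    [trunc_log 2] recovers the level [j], which has [2^j] members. The family [Z] below is numbered
    this way. *)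
Lemma sum_heap (g : nat -> R) (J : nat) :
  \sum_(m < (2 ^ J.+1).-1) g (trunc_log 2 m.+1) = \sum_(j < J.+1) 2 ^+ j * g j.
Proof.
elim: J => [|J IH]; first by rewrite expn1 !big_ord1 expr0 mul1r.
rewrite [RHS]big_ord_recr/= -IH.
rewrite -!(big_mkord xpredT (fun m => g (trunc_log 2 m.+1))).
have le2 : ((2 ^ J.+1).-1 <= (2 ^ J.+2).-1)%N.
  by rewrite -!subn1 leq_sub2r// leq_exp2l.
rewrite (big_cat_nat (leq0n _) le2)//=; congr (_ + _).
rewrite (eq_big_nat _ _ (F2 := fun=> g J.+1)); last first.
  move=> m /andP[m1 m2]; congr g; apply: trunc_log_eq => //.
  rewrite -[(2 ^ J.+1)%N]prednK ?expn_gt0// ltnS m1/=.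
  by rewrite -[(2 ^ J.+2)%N]prednK ?expn_gt0// ltnS.
rewrite sumr_const_nat -[LHS]mulr_natl; congr (_ * _).
rewrite -natrX; congr (_%:R).
have e : (0 < 2 ^ J.+1)%N by rewrite expn_gt0.
rewrite (expnS 2 J.+1) mul2n -addnn; move: e; case: (2 ^ J.+1)%N => // n _.
by lia.
Qed.

Lemma exists_dyadic_scale (y : R) : 1 <= y ->
  exists j : nat, 2 ^+ j <= y /\ y < 2 ^+ j.+1.
Proof.
move=> y1; have y0 : 0 <= y by apply: le_trans y1.
have /andP[t1 t2] := truncn_itv y0.
have tp : (0 < Num.truncn y)%N by rewrite truncn_gt0.
exists (trunc_log 2 (Num.truncn y)).
have /andP[h1 h2] := trunc_log_bounds (isT : (1 < 2)%N) tp.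
rewrite -!natrX; split; first by apply: le_trans t1; rewrite ler_nat.
by apply: lt_le_trans t2 _; rewrite ler_nat.
Qed.

End geometric_sums.

Section lower_bound.
Context d (T : measurableType d) (R : realType) (P : probability T R).
Variables (H K : R) (B : R -> {RV P >-> R}).
Hypotheses (H0 : 0 < H) (H1 : H < 1) (K0 : 0 < K) (K1 : K <= 1).
Hypothesis bifbmB : bifractional_brownian_motion H K B.

Let al := H * K.
Let al0 : 0 < al. Proof. exact: mulr_gt0. Qed.
Let al1 : al < 1.
Proof. by rewrite /al (le_lt_trans _ H1)// ler_piMr// ltW. Qed.

(** An increment of level [j] has deviation at most [Num.sqrt 2 * rho ^+ (2 * j)]. With half of the
    Holder exponent, the weights [rho ^+ dist j j0] decay more slowly than these deviations, so fine
    levels become likely. *)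
Let rho : R := 2 `^ (- (al / 2)).
Let rho0 : 0 < rho. Proof. exact: powR_gt0. Qed.
Let rho1 : rho < 1.
Proof.
rewrite /rho -[ltRHS](powRr0 2); apply: ltr_powR; first by rewrite ltr1n.
by rewrite oppr_lt0 divr_gt0.
Qed.

Let rhoX n : rho ^+ n = 2 `^ (- (al / 2) * n%:R).
Proof. by rewrite powRrM powR_mulrn// powR_ge0. Qed.

Let increment j k w := B (dyadic R j k.+1) w - B (dyadic R j k) w.

Let increment_cov j k : bifbm_span B (increment j k) /\
  cov P (increment j k) (increment j k) <= (Num.sqrt 2 * rho ^+ (2 * j)) ^+ 2.
Proof.
have [Si ci] := bifbm_increment H0 K0 K1 bifbmB (dyadic_ge0 R j k) (dyadic_ge0 R j k.+1).
split => //; apply: le_trans ci _.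
rewrite exprMn sqr_sqrtr// ler_pM2l//; apply: le_of_eq.
have -> : dyadic R j k.+1 - dyadic R j k = (2 ^+ j)^-1.
  by rewrite /dyadic -mulrBl -natr1 [_ + 1]addrC addrK mul1r.
rewrite ger0_norm ?invr_ge0 ?exprn_ge0// -exprM rhoX.
rewrite -powR_mulrn// -powRN -powRrM; congr (_ `^ _).
by rewrite /al !natrM; field.
Qed.

(** The factor [(1 - rho) / 4] of [level_y] divided by the [Num.sqrt 2] of the increments;
    [rho ^+ 2] pays for rounding the scale of [x] to a power of 2. *)
Let c0 : R := (1 - rho) * rho ^+ 2 / (4 * Num.sqrt 2).
Let c0_gt0 : 0 < c0.
Proof.
by rewrite divr_gt0 ?mulr_gt0 ?subr_gt0 ?exprn_gt0 ?sqrtr_gt0.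
Qed.
Let c0_le1 : c0 <= 1.
Proof.
have s1 : 1 <= Num.sqrt 2 :> R by rewrite -[leLHS]sqrtr1 ler_wsqrtr// ler1n.
rewrite ler_pdivrMr ?mulr_gt0 ?sqrtr_gt0// mul1r.
have := exprn_ile1 2 (ltW rho0) (ltW rho1).
have := exprn_gt0 2 rho0; have := rho0; have := rho1; nra.
Qed.

Let dist (i j : nat) := ((i - j) + (j - i))%N.

(* Normalized threshold at level [j], the scale of [x] being [2 ^- j0]. *)
Let level_u (j0 j : nat) : R :=
  if (j0 <= j)%N then c0 * rho ^- (j - j0) else c0 * rho ^+ (3 * (j0 - j)).

Let level_u_gt0 j0 j : 0 < level_u j0 j.
Proof.
rewrite /level_u; case: ifP => _; rewrite mulr_gt0 ?invr_gt0 ?exprn_gt0//.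
Qed.

(** The weights sum to at most [2 / (1 - rho)], so the thresholds sum to at most [x / 2]. *)
Let level_y (x : R) (j0 j : nat) : R := x * ((1 - rho) / 4) * rho ^+ dist j j0.

(** Relative to [rho ^+ (2 * j0)], the deviation of a level [n] steps coarser is larger by
    [rho ^- (2 * n)] while its threshold is smaller by [rho ^+ n]: hence the exponent 3 in
    [level_u]. For [n] steps finer the quotient is [rho ^- n]. *)
Let level_u_le x j0 j : rho ^+ (2 * j0.+1) <= x ->
  level_u j0 j * (Num.sqrt 2 * rho ^+ (2 * j)) <= level_y x j0 j.
Proof.
move=> hx; have s2 : Num.sqrt 2 != 0 :> R by rewrite gt_eqF// sqrtr_gt0.
have r0 : rho != 0 by rewrite gt_eqF.
apply: (@le_trans _ _ (rho ^+ (2 * j0.+1) * ((1 - rho) / 4) * rho ^+ dist j j0)); last first.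
  by rewrite /level_y ler_pM2r ?exprn_gt0// ler_pM2r// divr_gt0// subr_gt0.
rewrite /level_u /c0 /dist; case: leqP => jj.
  rewrite (eqP (_ : j0 - j == 0)%N) ?subn_eq0// addn0.
  have -> : (2 * j = 2 * j0 + (j - j0) + (j - j0))%N by clear -jj; lia.
  have -> : (2 * j0.+1 = 2 + 2 * j0)%N by rewrite mulnS.
  rewrite !exprD; apply: le_of_eq; field.
  by rewrite s2 expf_neq0.
rewrite (eqP (_ : j - j0 == 0)%N) ?subn_eq0 ?(ltnW jj)// add0n.
have -> : (2 * j0.+1 = 2 + 2 * j + 2 * (j0 - j))%N by clear -jj; lia.
have -> : (3 * (j0 - j) = 2 * (j0 - j) + (j0 - j))%N by rewrite mulSn addnC.
by rewrite !exprD; apply: le_of_eq; field.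
Qed.

(** Chosen so that [rho^p = 1/4]: at [n] levels finer than [j0] the cost [u^(-p)] is of order
    [4^-n], which beats the [2^n] times more numerous intervals. *)
Let p := 4 / al.
Let p_ge : 2^-1 <= p.
Proof. rewrite /p ler_pdivlMr//; have := al1; have := al0; lra. Qed.

(** Growth of the cost [u^(-1/2)] per coarser level, where [u] is of order [rho^(3n)]. It equals
    [2^(3 al / 4)], below the factor 2 by which the number of intervals shrinks. *)
Let tau : R := rho `^ (- (3 / 2)).
Let tau_lt2 : tau < 2.
Proof.
rewrite /tau /rho -powRrM -[ltRHS]powRr1//; apply: ltr_powR; first by rewrite ltr1n.
have := al1; lra.
Qed.
Let tau_gt0 : 0 < tau. Proof. exact: powR_gt0. Qed.

Let tauX n : tau ^+ n = 2 `^ (- (al / 2) * - (3 / 2) * n%:R).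
Proof. by rewrite !powRrM powR_mulrn// powR_ge0. Qed.

(** Ratio of the total costs of successive levels away from [j0]: [1/2] on the fine side and
    [tau / 2] on the coarse side. *)
Let om : R := Num.max 2^-1 (tau / 2).
Let om_ge0 : 0 <= om. Proof. by rewrite le_max invr_ge0 ler0n. Qed.
Let om_lt1 : om < 1.
Proof. by rewrite gt_max; apply/andP; split; have := tau_lt2; lra. Qed.

(** The factor [2 ^+ j0 / 2 ^+ j] cancels the number [2 ^+ j] of intervals of level [j], leaving a
    geometric series times [2 ^+ j0]. *)
Let level_exponent : exists2 M : R, 0 < M & forall j0 j,
  expR (- (M * (2 ^+ j0 / 2 ^+ j) * om ^+ dist j j0)) <=
  Num.max (Num.min 1 (small_ball_const R * Num.min 1 (level_u j0 j)))
          (1 - 2 * expR (- (level_u j0 j ^+ 2 / 4))).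
Proof.
have [C C0 hC] := small_ball_exponent p_ge.
pose M := C * c0 `^ (- p) + C * c0 `^ (- 2^-1).
have M1 : 0 < C * c0 `^ (- p) by rewrite mulr_gt0// powR_gt0.
have M2 : 0 < C * c0 `^ (- 2^-1) by rewrite mulr_gt0// powR_gt0.
exists M; first by rewrite addr_gt0.
move=> j0 j; have [h1 h2] := hC _ (level_u_gt0 j0 j).
have [jj|jj] := leqP j0 j.
  apply: le_trans h1; rewrite ler_expR lerN2.
  have -> : level_u j0 j `^ (- p) = c0 `^ (- p) * 4^-1 ^+ (j - j0).
    rewrite /level_u jj powRM ?invr_ge0 ?exprn_ge0 ?(ltW rho0) ?(ltW c0_gt0)//.
    congr (_ * _); rewrite rhoX -powRN -powRrM.
    rewrite (_ : _ * - p = (- 2) * (j - j0)%:R); last first.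
      by rewrite /p; field; rewrite gt_eqF.
    rewrite powRrM powR_mulrn ?powR_ge0//; congr (_ ^+ _).
    by rewrite powRN powR_mulrn// -natrX.
  rewrite /dist (eqP (_ : j0 - j == 0)%N) ?subn_eq0// addn0.
  have -> : 2 ^+ j0 / 2 ^+ j = 2^-1 ^+ (j - j0) :> R.
    by rewrite exprVn -[in 2 ^+ j](subnK jj) exprD; field; rewrite !expf_neq0 ?pnatr_eq0.
  have -> : 4^-1 = 2^-1 * 2^-1 :> R by rewrite -invfM -natrM.
  rewrite exprMn !mulrA; set e := 2^-1 ^+ (j - j0).
  have e0 : 0 <= e by rewrite exprn_ge0.
  have eo : e <= om ^+ (j - j0).
    by rewrite lerXn2r ?nnegrE// le_max lexx.
  apply: ler_pM => //; first by rewrite mulr_ge0// ltW.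
  by rewrite ler_wpM2r// /M lerDl ltW.
have u1 : level_u j0 j <= 1.
  rewrite /level_u leqNgt jj/= mulr_ile1 ?exprn_ge0 ?(ltW rho0) ?(ltW c0_gt0)//.
  by rewrite exprn_ile1// ltW.
apply: le_trans (h2 u1); rewrite ler_expR lerN2.
have -> : level_u j0 j `^ (- 2^-1) = c0 `^ (- 2^-1) * tau ^+ (j0 - j).
  rewrite /level_u leqNgt jj/= powRM ?exprn_ge0 ?(ltW rho0) ?(ltW c0_gt0)//.
  rewrite rhoX tauX -powRrM natrM; congr (_ * 2 `^ _).
  by field.
rewrite /dist (eqP (_ : j - j0 == 0)%N) ?subn_eq0 ?(ltnW jj)// add0n.
have -> : 2 ^+ j0 / 2 ^+ j = 2 ^+ (j0 - j) :> R.
  by rewrite -[in 2 ^+ j0](subnK (ltnW jj)) exprD mulfK// expf_neq0// pnatr_eq0.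
rewrite -!mulrA -exprMn mulrA.
apply: ler_pM; rewrite ?exprn_ge0 ?(ltW tau_gt0) ?(ltW M2)//.
  by rewrite /M lerDr ltW.
rewrite lerXn2r ?nnegrE ?(ltW tau_gt0) ?mulr_ge0//.
by rewrite -ler_pdivrMl// mulrC le_max lexx orbT.
Qed.

Let Z m w := increment (trunc_log 2 m.+1) (m.+1 - 2 ^ trunc_log 2 m.+1) w.

Lemma small_ball_lower_bound : exists2 c1 : R, 0 < c1 &
  forall t0 x : R, 0 <= t0 <= 1 -> 0 < x < 1 ->
  ((expR (- (c1 / x `^ (1 / (H * K)))))%:E <=
   P [set w | (max_deviation B t0 w <= x)%R])%E.
Proof.
have [M M0 hM] := level_exponent.
pose c1 := M * (2 / (1 - om)).
have c10 : 0 < c1 by rewrite mulr_gt0// divr_gt0// subr_gt0.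
exists c1 => // t0 x /andP[t00 t01] /andP[x0 x1].
have gS := bifbm_gaussian_space bifbmB.
pose y := x `^ (- (1 / al)).
have y1 : 1 <= y.
  rewrite /y /powR gt_eqF// -expR0 ler_expR mulNr -mulrN mulr_ge0 ?divr_ge0 ?(ltW al0)//.
  by rewrite oppr_ge0 ln_le0 ?ltW.
(* Of the two inequalities, [2 ^+ j0 <= y] bounds the final exponent and [y < 2 ^+ j0.+1] gives
   [hx], which [level_u_le] requires. *)
have [j0 [jy yj]] := exists_dyadic_scale y1.
have hx : rho ^+ (2 * j0.+1) <= x.
  have -> : x = y `^ (- al).
    rewrite /y -powRrM (_ : - _ * _ = 1) ?powRr1 ?ltW//; field; by rewrite gt_eqF.
  rewrite rhoX (_ : _ * _ = j0.+1%:R * - al); last by rewrite natrM; field.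
  have yp : 0 < y by apply: lt_le_trans y1.
  have zp : 0 < 2 ^+ j0.+1 :> R by rewrite exprn_gt0.
  rewrite natrM_powRN (_ : y `^ (- al) = (y `^ al)^-1); last exact: powRN.
  rewrite lef_pV2 ?posrE ?powR_gt0//.
  by apply: ge0_ler_powR; rewrite ?nnegrE ?(ltW al0) ?(ltW yp) ?(ltW zp) ?(ltW yj).
pose a m := level_y x j0 (trunc_log 2 m.+1).
have a0 m : 0 <= a m.
  rewrite /a /level_y !mulr_ge0 ?exprn_ge0 ?(ltW x0) ?(ltW rho0) ?divr_ge0//.
  by rewrite subr_ge0 ltW.
pose kap j := M * (2 ^+ j0 / 2 ^+ j) * om ^+ dist j j0.
have kap0 j : 0 <= kap j by rewrite !mulr_ge0 ?exprn_ge0 ?invr_ge0 ?exprn_ge0 ?(ltW M0).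
have SZ m : bifbm_span B (Z m) by have [] := increment_cov (trunc_log 2 m.+1) (m.+1 - 2 ^ trunc_log 2 m.+1).
have mZ m : measurable_fun setT (Z m) by exact: (gs_measurable gS (SZ m)).
have PZ m : expR (- kap (trunc_log 2 m.+1)) <= fine (P [set w | `|Z m w| <= a m]).
  apply: le_trans (hM _ _) _.
  have [_ cZ] := increment_cov (trunc_log 2 m.+1) (m.+1 - 2 ^ trunc_log 2 m.+1).
  apply: le_trans (small_ball_lower gS (SZ m) _ (level_u_gt0 _ _) cZ) _.
    by rewrite mulr_gt0 ?sqrtr_gt0 ?exprn_gt0.
  rewrite -lee_fin !fineK ?fin_num_measure//; try exact: measurable_slab.
  apply: le_measure; [by apply/mem_set; exact: measurable_slab|by apply/mem_set; exact: measurable_slab|].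
  by move=> w /= /le_trans; apply; exact: level_u_le.
have Pbox n : expR (- (c1 * 2 ^+ j0)) <= fine (P (box n Z a)).
  apply: le_trans (@sidak _ _ _ P _ gS n Z a _ _) => //.
  apply: (@le_trans _ _ (\prod_(m < n) expR (- kap (trunc_log 2 m.+1)))); last first.
    by apply: ler_prod => m _; rewrite expR_ge0/= PZ.
  rewrite -expR_sum ler_expR sumrN lerN2.
  (* The first [n] constraints belong to the complete levels [0] to [n]; since the costs are
     nonnegative, summing these whole levels gives a bound independent of [n]. *)
  have nn : (n <= (2 ^ n.+1).-1)%N by rewrite -ltnS prednK ?expn_gt0// ltnW// ltn_expl.
  apply: (@le_trans _ _ (\sum_(m < (2 ^ n.+1).-1) kap (trunc_log 2 m.+1))).
    rewrite -!(big_mkord xpredT (fun m => kap (trunc_log 2 m.+1))).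
    by rewrite [leRHS](big_cat_nat (leq0n _) nn)//= lerDl sumr_ge0.
  rewrite sum_heap.
  have -> : \sum_(j < n.+1) 2 ^+ j * kap j = M * 2 ^+ j0 * \sum_(j < n.+1) om ^+ dist j j0.
    rewrite mulr_sumr; apply: eq_bigr => j _; rewrite /kap; field.
    by rewrite expf_neq0// pnatr_eq0.
  rewrite /c1 -(mulrA M) -(mulrA M) (mulrC (2 / _)) ler_pM2l// ler_pM2l ?exprn_gt0//.
  exact: sum_geometric_dist.
(* The bound for finitely many constraints is uniform, so continuity from above carries it to all
   dyadic intervals. *)
pose A := \bigcap_n box n Z a.
have mbox n : measurable (box n Z a) by exact: measurable_box.
have mA : measurable A by exact: bigcapT_measurable.
have PA : ((expR (- (c1 * 2 ^+ j0)))%:E <= P A)%E.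
  have cv : P (box n Z a) @[n --> \oo] --> P A.
    apply: nonincreasing_cvg_mu => //.
      by rewrite (le_lt_trans (probability_le1 _ _))// ltry.
    move=> n m nm; apply/subsetPset => w h i im; apply: h; exact: leq_trans nm.
  apply: (cvge_ge _ cv); apply: nearW => n.
  by rewrite -[leRHS]fineK ?fin_num_measure// lee_fin.
apply: (@le_trans _ _ (expR (- (c1 * 2 ^+ j0)))%:E).
  rewrite lee_fin ler_expR lerN2 /c1 (_ : (x `^ (1 / (H * K)))^-1 = y); last first.
    by rewrite /y /al; exact/esym/powRN.
  by rewrite ler_pM2l.
apply: le_trans PA _; apply: le_measure; first by apply/mem_set.
  by apply/mem_set; exact: (measurable_max_deviation bifbmB).
move=> w Aw /=; apply/(max_deviation_le bifbmB) => t t01'.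
have chain : forall j k, (k <= 2 ^ j)%N -> `|B (dyadic R j k) w - 0| <= x / 2.
  move=> j k kj; rewrite subr0.
  apply: le_trans (@dyadic_chain R (fun t => B t w) (level_y x j0) j _ _ j k (leqnn j) kj) _.
  - exact: (bifbm_start bifbmB).
  - move=> i k' ij ki; pose m := (2 ^ i + k').-1.
    have mE : m.+1 = (2 ^ i + k')%N by rewrite prednK// addn_gt0 expn_gt0.
    have tE : trunc_log 2 m.+1 = i.
      by apply: trunc_log_eq => //; rewrite mE leq_addr/= expnS mul2n -addnn ltn_add2l.
    have := Aw m.+1 I m (ltnSn m); rewrite /Z /a tE mE.
    by rewrite addnC addnK.
  rewrite /level_y -mulr_sumr -[leRHS]mulr1 -mulrA -[in leRHS]mulrA ler_pM2l//.
  have := @sum_geometric_dist R rho j0 j.+1 (ltW rho0) rho1.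
  rewrite -/dist ler_pdivlMr ?subr_gt0//.
  lra.
have bound s : 0 <= s <= 1 -> `|B s w| <= x / 2.
  move=> s01; rewrite -[B s w]subr0.
  apply: (dyadic_dense (f := fun t => B t w) _ chain) => //.
  exact: (@bifbm_continuous _ _ _ _ _ _ _ bifbmB w).
rewrite (le_trans (ler_normB _ _))// [leRHS](splitr x) lerD//; apply: bound => //.
by rewrite t00.
Qed.

End lower_bound.

(** * Second differences of smooth functions and of powers *)

Section second_difference.
Context (R : realType).
Implicit Types (f : R -> R) (a b h t x y M : R).

Definition derive_on f f1 a b := forall x, a <= x <= b -> is_derive x 1 f (f1 x).

Lemma mvt_on f f1 a b x y : derive_on f f1 a b -> a <= x <= b -> a <= y <= b ->
  exists2 c, a <= c <= b & f y - f x = f1 c * (y - x).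
Proof.
move=> fd; wlog xy : x y / x <= y => [ih|].
  have [xy|/ltW yx] := leP x y; first exact: ih.
  move=> xab yab; have [c cab e] := ih _ _ yx yab xab; exists c => //.
  by rewrite -opprB e -mulrN opprB.
move=> /andP[ax xb] /andP[ay yb].
have fd' z : z \in `[x, y] -> is_derive z 1 f (f1 z).
  by rewrite in_itv/= => /andP[xz zy]; apply: fd; rewrite (le_trans ax)//= (le_trans zy).
have fo z : z \in `]x, y[ -> is_derive z 1 f (f1 z).
  by move=> /subset_itv_oo_cc; exact: fd'.
have fc : {within [set` `[x, y]], continuous f}.
  by apply: derivable_within_continuous => z zxy; have [] := fd' z zxy.
have [c cxy e] := @MVT_segment R f f1 x y xy fo fc.
move: cxy; rewrite in_itv/= => /andP[xc cy].
by exists c; rewrite // (le_trans ax)//= (le_trans cy).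
Qed.

Definition sdiff f h t := f (t + h) - 2 * f t + f (t - h).

Lemma is_derive_shift f f1 c t : is_derive (t + c) 1 f (f1 (t + c)) ->
  is_derive t 1 (fun s => f (s + c)) (f1 (t + c)).
Proof.
move=> fd; rewrite -[f1 _]mulr1.
apply: (@is_derive1_comp _ f (fun s => s + c) t _ 1 fd).
exact: is_derive_eq (is_deriveD (is_derive_id t 1) (is_derive_cst c t 1)) (addr0 1).
Qed.

Lemma derive_on_sdiff f f1 a b h : 0 <= h -> derive_on f f1 (a - h) (b + h) ->
  derive_on (sdiff f h) (sdiff f1 h) a b.
Proof.
move=> h0 fd t /andP[at_ tb].
have f_ c : - h <= c <= h -> is_derive t 1 (fun s => f (s + c)) (f1 (t + c)).
  move=> /andP[hc ch]; apply: is_derive_shift; apply: fd.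
  by apply/andP; split; lra.
have d1 := f_ h; have d2 := f_ 0; have d3 := f_ (- h).
rewrite /sdiff.
have -> : (fun t => f (t + h) - 2 * f t + f (t - h)) =
  (fun s => f (s + h)) + (-2) \*: (fun s => f (s + 0)) + (fun s => f (s - h)).
  by apply/funext => s; rewrite !fctE /= addr0; congr (_ + _ + _); rewrite scaleNr.
have -> : f1 (t + h) - 2 * f1 t + f1 (t - h) = f1 (t + h) + (-2) *: f1 (t + 0) + f1 (t - h).
  by rewrite addr0 scaleNr.
apply: is_deriveD; first apply: is_deriveD; [|apply: is_deriveZ|].
- by apply: f_; apply/andP; split; lra.
- by apply: f_; apply/andP; split; lra.
- by apply: f_; apply/andP; split; lra.
Qed.

Lemma sdiff_le1 f f1 h t M : 0 <= h -> derive_on f f1 (t - h) (t + h) ->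
  (forall x, t - h <= x <= t + h -> `|f1 x| <= M) -> `|sdiff f h t| <= 2 * M * h.
Proof.
move=> h0 fd fM.
have [||c1 c1t e1] := mvt_on (x := t) (y := t + h) fd; try by apply/andP; split; lra.
have [||c2 c2t e2] := mvt_on (x := t - h) (y := t) fd; try by apply/andP; split; lra.
have -> : sdiff f h t = (f (t + h) - f t) - (f t - f (t - h)) by rewrite /sdiff; ring.
rewrite e1 e2 (_ : _ - _ = (f1 c1 - f1 c2) * h); last by ring.
rewrite normrM (ger0_norm h0) ler_wpM2r// (le_trans (ler_normB _ _))//.
by have := fM _ c1t; have := fM _ c2t; lra.
Qed.

Lemma sdiff_le2 f f1 f2 h t M : 0 <= h ->
  derive_on f f1 (t - h) (t + h) -> derive_on f1 f2 (t - h) (t + h) ->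
  (forall x, t - h <= x <= t + h -> `|f2 x| <= M) -> `|sdiff f h t| <= 2 * M * h ^+ 2.
Proof.
move=> h0 fd1 fd2 fM.
have [||c1 c1t e1] := mvt_on (x := t) (y := t + h) fd1; try by apply/andP; split; lra.
have [||c2 c2t e2] := mvt_on (x := t - h) (y := t) fd1; try by apply/andP; split; lra.
have -> : sdiff f h t = (f (t + h) - f t) - (f t - f (t - h)) by rewrite /sdiff; ring.
rewrite e1 e2 (_ : _ - _ = (f1 c1 - f1 c2) * h); last by ring.
have [c ct ->] := mvt_on fd2 c2t c1t.
rewrite expr2 mulrA normrM (ger0_norm h0) ler_wpM2r// normrM (mulrC 2) -mulrA.
apply: ler_pM => //; first exact: fM.
by move/andP: c1t => [? ?]; move/andP: c2t => [? ?]; rewrite ler_norml; apply/andP; split; lra.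
Qed.

End second_difference.

Section power_differences.
Context (R : realType).
Implicit Types (a b h t x y M p : R).

Lemma powR_le16 x p : 16^-1 <= x <= 16 -> x `^ p <= 16 `^ `|p|.
Proof.
move=> /andP[x1 x2]; have x0 : 0 < x by apply: lt_le_trans x1; rewrite invr_gt0.
rewrite /powR !gt_eqF// ler_expR (le_trans (ler_norm _))// normrM ler_wpM2l//.
have l16 : - ln 16 <= ln x by rewrite -lnV ?posrE// ler_ln ?posrE// invr_gt0.
by rewrite ler_norml l16/= ler_ln ?posrE.
Qed.

Lemma is_derive_powR c p x : 0 < x ->
  is_derive x 1 (fun y : R => c * y `^ p) (c * p * x `^ (p - 1)).
Proof.
move=> x0; have := @is_deriveZ _ _ _ _ c _ _ _ (is_derive1_powR p x0).
by move=> H; apply: is_derive_eq H _; rewrite -mulrA.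
Qed.

(** Four derivatives give [|p (p-1) (p-2) (p-3)| <= 24] times a power [p - 4], taken at points at
    least [c h / 2] because [4 <= c]. Then [(c/2)^(p-4) <= 4 / c^2] as [p < 2], and
    [384 = 2 * 2 * 24 * 4]. The decay in [c] is summable. *)
Lemma sdiff_powR h c p : 0 < p < 2 -> 0 < h -> 4 <= c ->
  `|sdiff (sdiff (fun x => x `^ p) h) h (c * h)| <= 384 * h `^ p / c ^+ 2.
Proof.
move=> /andP[p0 p2] h0 c4; set u := c * h.
have hu : 4 * h <= u by rewrite ler_pM2r.
pose f k x := \prod_(i < k) (p - i%:R) * x `^ (p - k%:R).
have fd k s1 s2 : 0 < s1 -> derive_on (f k) (f k.+1) s1 s2.
  move=> s10 x /andP[sx _]; rewrite /f.
  apply: is_derive_eq (is_derive_powR _ _ (lt_le_trans s10 sx)) _.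
  by rewrite big_ord_recr/= -[in RHS]natr1 opprD addrA.
have f0 : (fun x => x `^ p) = f 0%N.
  by apply/funext => x; rewrite /f big_ord0 mul1r subr0.
have Mle x : u - h - h <= x <= u + h + h -> `|f 4%N x| <= 24 * (u / 2) `^ (p - 4).
  move=> /andP[x1 _]; have ux : u / 2 <= x by lra.
  have u0 : 0 < u / 2 by apply: divr_gt0 => //; lra.
  rewrite normrM ler_pM//.
    rewrite !big_ord_recr/= big_ord0 mul1r subr0 !normrM.
    have -> : 24 = 2 * 2 * 2 * 3 :> R by rewrite -!natrM.
    by rewrite !ler_pM// ler_norml; apply/andP; split; lra.
  rewrite ger0_norm ?powR_ge0//.
  have -> : p - 4%:R = - (4 - p) by ring.
  rewrite !powRN lef_pV2 ?posrE ?powR_gt0//; last by lra.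
  by apply: ge0_ler_powR; rewrite ?nnegrE; lra.
rewrite f0.
have h0' := ltW h0.
apply: (@le_trans _ _ (2 * (2 * (24 * (u / 2) `^ (p - 4)) * h ^+ 2) * h ^+ 2)).
  apply: (@sdiff_le2 _ _ (sdiff (f 1%N) h) (sdiff (f 2%N) h)) => //.
  - by apply: derive_on_sdiff => //; apply: fd; lra.
  - by apply: derive_on_sdiff => //; apply: fd; lra.
  - move=> x /andP[x1 x2].
    apply: (@sdiff_le2 _ _ (f 3%N) (f 4%N)) => //; try (apply: fd; lra).
    move=> z /andP[z1 z2]; apply: Mle; apply/andP; split; lra.
have -> : u / 2 = (c / 2) * h by rewrite /u mulrAC.
rewrite powRM//; last by apply: divr_ge0 => //; lra.
have -> : h `^ (p - 4) = h `^ p / h ^+ 4.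
  rewrite (@powRD _ h) ?powRN ?powR_mulrn//.
  by apply/implyP => _; rewrite gt_eqF.
have c2 : (c / 2) `^ (p - 4) <= 4 / c ^+ 2.
  apply: (@le_trans _ _ ((c / 2) `^ (- 2%:R))).
    by rewrite ler_powR//; lra.
  rewrite powRN powR_mulrn; last by lra.
  by rewrite le_eqVlt; apply/orP; left; apply/eqP; field; rewrite gt_eqF//; lra.
rewrite (_ : 2 * _ * _ = 96 * (c / 2) `^ (p - 4) * h `^ p); last by field; rewrite gt_eqF.
rewrite [leRHS](_ : _ = 96 * (4 / c ^+ 2) * h `^ p); last by field; rewrite gt_eqF//; lra.
by rewrite ler_wpM2r ?powR_ge0// ler_wpM2l.
Qed.

End power_differences.

(* Linear combinations of the functions [(t^e + s^e)^m s^n t^l] are stable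
   under partial derivatives and bounded on compact sets away from the axes;
   a combination is represented by the list of its terms [(c, m, n, l)]. *)
Section power_sums.
Context (R : realType).
Variable e : R.
Hypothesis e02 : 0 < e < 2.
Implicit Types (h t s x y M : R) (k : seq (R * R * R * R)).

Definition psum_term (z : R * R * R * R) (s t : R) : R :=
  let: (c, m, n, l) := z in
  c * ((t `^ e + s `^ e) `^ m * (s `^ n * t `^ l)).

Definition psum k s t := \sum_(z <- k) psum_term z s t.

Definition psum_deriv k := flatten [seq (let: (c, m, n, l) := z in
  [:: (c * m * e, m - 1, n + e - 1, l); (c * n, m, n - 1, l)]) | z <- k].

Definition psum_swap k := [seq (let: (c, m, n, l) := z in (c, m, l, n)) | z <- k].

Lemma psum_swapE k s t : psum (psum_swap k) t s = psum k s t.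
Proof.
rewrite /psum big_map; apply: eq_bigr => -[[[c m] n] l] _ /=.
by rewrite addrC (mulrC (t `^ _)).
Qed.

Lemma is_derive_psum k s t : 0 < s -> 0 < t ->
  is_derive s 1 (fun s => psum k s t) (psum (psum_deriv k) s t).
Proof.
move=> s0 t0; elim: k => [|[[[c m] n] l] k IH].
  rewrite /psum/= big_nil; under eq_fun do rewrite big_nil.
  exact: is_derive_cst.
have -> : psum (psum_deriv ((c, m, n, l) :: k)) s t =
    psum_term (c * m * e, m - 1, n + e - 1, l) s t + psum_term (c * n, m, n - 1, l) s t +
    psum (psum_deriv k) s t by rewrite /psum /psum_deriv/= !big_cons addrA.
have -> : psum ((c, m, n, l) :: k) ^~ t =
    (fun s => psum_term (c, m, n, l) s t) + psum k ^~ t.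
  by apply/funext => x; rewrite /psum big_cons.
apply: is_deriveD => //.
rewrite /psum_term; set q := t `^ e + s `^ e.
have q0 : 0 < q by rewrite addr_gt0// powR_gt0.
have dq : is_derive s 1 (fun s => t `^ e + s `^ e) (e * s `^ (e - 1)).
  by apply: is_derive_eq (is_deriveD (is_derive_cst (t `^ e) s 1) (is_derive1_powR e s0)) (add0r _).
have dqm := @is_derive1_comp R ((@powR R) ^~ m) (fun s => t `^ e + s `^ e) s _ _
  (is_derive1_powR m q0) dq.
have dsn := is_derive1_powR n s0.
have H := is_deriveZ (c * t `^ l) (is_deriveM dqm dsn).
have -> : (fun s => c * ((t `^ e + s `^ e) `^ m * (s `^ n * t `^ l))) =
    (c * t `^ l) \*: (((@powR R) ^~ m \o (fun s => t `^ e + s `^ e)) * (@powR R) ^~ n).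
  apply/funext => x.
  by transitivity (c * t `^ l * ((t `^ e + x `^ e) `^ m * x `^ n)); first ring.
apply: is_derive_eq H _; rewrite -/q.
have -> : s `^ (n + e - 1) = s `^ n * s `^ (e - 1).
  by rewrite -addrA [LHS]powRD// (gt_eqF s0) implybT.
transitivity (c * t `^ l * (q `^ m * (n * s `^ (n - 1)) +
  s `^ n * (m * q `^ (m - 1) * (e * s `^ (e - 1))))) => //; ring.
Qed.

Lemma psum_bound k : exists M, forall s t, 4^-1 <= s <= 1 -> 4^-1 <= t <= 1 ->
  `|psum k s t| <= M.
Proof.
elim: k => [|[[[c m] n] l] k [M IH]].
  by exists 0 => s t _ _; rewrite /psum big_nil normr0.
exists (`|c| * (16 `^ `|m| * (16 `^ `|n| * 16 `^ `|l|)) + M) => s t s1 t1.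
rewrite /psum big_cons (le_trans (ler_normD _ _))// lerD//; last exact: IH.
have rng x : 4^-1 <= x <= 1 -> 16^-1 <= x <= 16 /\ 16^-1 <= x `^ e <= 1.
  move=> /andP[x1 x2]; have x0 : 0 < x by lra.
  have /andP[e0 e2] := e02.
  split; first by apply/andP; split; lra.
  apply/andP; split; last first.
    have e1 : 1 `^ e = 1 :> R by rewrite powR1.
    by rewrite -[leRHS]e1; apply: ge0_ler_powR; rewrite ?nnegrE; lra.
  apply: (@le_trans _ _ (x `^ 2)).
    have : 0 <= (x - 4^-1) * (x + 4^-1) by apply: mulr_ge0; lra.
    by rewrite powR_mulrn ?(ltW x0)//; lra.
  rewrite /powR gt_eqF// ler_expR.
  by have l0 := ln_le0 x2; apply: ler_wnM2r => //; exact: ltW.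
have [s2 /andP[s3 s4]] := rng _ s1; have [t2 /andP[t3 t4]] := rng _ t1.
rewrite /psum_term !normrM !(@ger0_norm _ (_ `^ _)) ?powR_ge0//.
rewrite ler_wpM2l// !ler_pM ?mulr_ge0 ?powR_ge0//; apply: powR_le16 => //.
by apply/andP; split; lra.
Qed.

(** Two derivatives in [s] and one in [t]. The order [h^3] is enough: summed over at most about
    [1/h] points it leaves [h^2], negligible against [h^(2HK)]. *)
Lemma sdiff_psum k : exists2 M, 0 <= M & forall s t h, 0 <= h ->
  4^-1 <= s - h -> s + h <= 1 -> 4^-1 <= t - h -> t + h <= 1 ->
  `|sdiff (fun s => sdiff (psum k s) h t) h s| <= M * h ^+ 3.
Proof.
(* The derivative in [t], obtained from the one in [s] by exchanging the variables. *)
pose kt k' := psum_swap (psum_deriv (psum_swap k')).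
have dt k' s t : 0 < s -> 0 < t ->
    is_derive t 1 (psum k' s) (psum (kt k') s t).
  move=> s0 t0; rewrite psum_swapE.
  have -> : psum k' s = psum (psum_swap k') ^~ s.
    by apply/funext => x; rewrite psum_swapE.
  exact: is_derive_psum.
have ds k' h t a b : 0 < a -> 0 <= h < t ->
    derive_on (fun s => sdiff (psum k' s) h t)
      (fun s => sdiff (psum (psum_deriv k') s) h t) a b.
  move=> a0 /andP[h0 ht] s /andP[as_ _]; have s0 := lt_le_trans a0 as_.
  have D u : 0 < u -> is_derive s 1 (psum k' ^~ u) (psum (psum_deriv k') s u).
    exact: is_derive_psum.
  have th : 0 < t - h by rewrite subr_gt0.
  have th' : 0 < t + h by lra.
  have t0 : 0 < t by lra.
  have H := is_deriveD (is_deriveD (D _ th') (is_deriveZ (-2) (D _ t0))) (D _ th).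
  have -> : (fun s => sdiff (psum k' s) h t) =
      psum k' ^~ (t + h) + (-2) \*: psum k' ^~ t + psum k' ^~ (t - h).
    apply/funext => x.
    transitivity (psum k' x (t + h) + -2 * psum k' x t + psum k' x (t - h)) => //.
    by rewrite /sdiff; ring.
  apply: is_derive_eq H _; rewrite /sdiff.
  transitivity (psum (psum_deriv k') s (t + h) + -2 * psum (psum_deriv k') s t +
    psum (psum_deriv k') s (t - h)) => //.
  by ring.
pose k2 := psum_deriv (psum_deriv k).
have [M MP] := psum_bound (kt k2).
have M0 : 0 <= M.
  by apply: le_trans (MP 1 1 _ _) => //; rewrite lexx invf_le1// ler1n.
exists (4 * M); first by rewrite mulr_ge0.
move=> s t h h0 s1 s2 t1 t2.
have sh0 : 0 < s - h by lra.
have ht : 0 <= h < t by apply/andP; split; lra.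
rewrite (_ : 4 * M * h ^+ 3 = 2 * (2 * M * h) * h ^+ 2); last by ring.
apply: (sdiff_le2 h0 (ds k h t _ _ sh0 ht) (ds _ h t _ _ sh0 ht)) => x /andP[x1 x2].
apply: (sdiff_le1 h0 (f1 := psum (kt k2) x)).
  by move=> y /andP[y1 y2]; apply: dt; lra.
by move=> y /andP[y1 y2]; apply: MP; apply/andP; split; lra.
Qed.

End power_sums.

(** * Diagonal dominance and products of cosines *)

(** Each side of [i] contributes at most 2, by telescoping [1 / (m+1)^2 <= 1/m - 1/(m+1)]. *)
Lemma sum_inv_sqr_dist (R : realType) (i n : nat) :
  \sum_(j < n) (if i == j :> nat then 0 else (((i - j) + (j - i))%:R ^+ 2)^-1) <= 4 :> R.
Proof.
pose f k : R := (k.+1%:R ^+ 2)^-1; pose F m := \sum_(k < m) f k.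
have f0 k : 0 <= f k by rewrite invr_ge0 exprn_ge0.
have FS m : F m.+1 = F m + f m by rewrite /F big_ord_recr.
have F0 m : 0 <= F m by rewrite sumr_ge0.
have F2 m : F m <= 2.
  have: F m.+1 <= 2 - m.+1%:R^-1.
    elim: m => [|m IH]; first by rewrite /F big_ord1 /f expr1n invr1; lra.
    rewrite FS (le_trans (lerD IH (lexx _)))//.
    have m1 : 0 < m.+1%:R :> R by rewrite ltr0n.
    have -> : m.+2%:R = m.+1%:R + 1 :> R by rewrite natr1.
    rewrite /f -[m.+2%:R]natr1; set x := m.+1%:R; rewrite -/x in m1 *.
    rewrite -subr_ge0 (_ : _ - _ = (x * (x + 1) ^+ 2)^-1); last first.
      by field; rewrite !gt_eqF// addr_gt0.
    by rewrite invr_ge0 ltW// mulr_gt0// exprn_gt0// addr_gt0.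
  have m0 : 0 <= m.+1%:R^-1 :> R by rewrite invr_ge0.
  by rewrite FS; move: (m.+1%:R^-1) m0 => z z0; have := f0 m; lra.
have h : \sum_(j < n) (if i == j :> nat then 0 else (((i - j) + (j - i))%:R ^+ 2)^-1) =
    if (n <= i)%N then F i - F (i - n)%N else F i + F (n - i.+1)%N.
  elim: n => [|n IH]; first by rewrite big_ord0 leq0n subn0 subrr.
  rewrite big_ord_recr/= IH; have [ni|ni|->] := ltngtP n i.
  - rewrite (_ : (i - n + (n - i) = (i - n.+1).+1)%N); last by clear -ni; lia.
    by rewrite (_ : (i - n = (i - n.+1).+1)%N) ?FS ?/f; [ring|clear -ni; lia].
  - rewrite (_ : (i - n + (n - i) = (n - i.+1).+1)%N); last by clear -ni; lia.
    by rewrite (_ : (n.+1 - i.+1 = (n - i.+1).+1)%N) ?FS ?/f; [ring|clear -ni; lia].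
  - by rewrite !subnn /F big_ord0 subr0 addr0.
rewrite h; case: ifP => _; first by have := F2 i; have := F0 (i - n)%N; lra.
by have := F2 i; have := F2 (n - i.+1)%N; lra.
Qed.

(** Schur test: [|v i * v j|] is at most half of [v i ^+ 2 + v j ^+ 2], so the symmetric error [e]
    enters only through its row sums. *)
Lemma diagonal_dominance (R : realType) (n : nat) (c e : nat -> nat -> R)
    (D E : R) (v : nat -> R) :
  (forall i j, e i j = e j i) ->
  (forall i j, (i < n)%N -> (j < n)%N ->
     `|c i j - (if i == j then D else 0)| <= e i j) ->
  (forall i, (i < n)%N -> \sum_(j < n) e i j <= E) ->
  (D - E) * \sum_(i < n) v i ^+ 2 <= \sum_(i < n) \sum_(j < n) v i * v j * c i j.
Proof.
move=> eC ce eE.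
have S : \sum_(i < n) \sum_(j < n) v i ^+ 2 * e i j <= E * \sum_(i < n) v i ^+ 2.
  rewrite mulr_sumr; apply: ler_sum => i _.
  by rewrite -mulr_sumr mulrC ler_wpM2r ?sqr_ge0// eE.
have S' : \sum_(i < n) \sum_(j < n) v j ^+ 2 * e i j <= E * \sum_(i < n) v i ^+ 2.
  rewrite exchange_big/=; under eq_bigr do under eq_bigr do rewrite eC.
  exact: S.
apply: (@le_trans _ _ (\sum_(i < n) \sum_(j < n)
    ((if i == j then v i ^+ 2 * D else 0) - 2^-1 * (v i ^+ 2 * e i j) - 2^-1 * (v j ^+ 2 * e i j)))).
  rewrite [leRHS](_ : _ = D * \sum_(i < n) v i ^+ 2 -
      2^-1 * \sum_(i < n) \sum_(j < n) v i ^+ 2 * e i j -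
      2^-1 * \sum_(i < n) \sum_(j < n) v j ^+ 2 * e i j); first by lra.
  rewrite !mulr_sumr -!sumrB; apply: eq_bigr => i _.
  rewrite !sumrB -!mulr_sumr -big_mkcond (big_pred1 i); last first.
    by move=> j; rewrite eq_sym.
  by rewrite mulrC.
apply: ler_sum => i _; apply: ler_sum => j _.
have := ce i j (ltn_ord i) (ltn_ord j); rewrite ler_norml.
have e0 : 0 <= e i j by apply: le_trans (ce i j (ltn_ord i) (ltn_ord j)).
have p1 : 0 <= e i j * (v i - v j) ^+ 2 by rewrite mulr_ge0// sqr_ge0.
have p2 : 0 <= e i j * (v i + v j) ^+ 2 by rewrite mulr_ge0// sqr_ge0.
move=> ceij; set r := c i j - _ in ceij.
have -> : c i j = r + (if i == j :> nat then D else 0) by rewrite /r subrK.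
have b : - (2^-1 * (v i ^+ 2 * e i j) + 2^-1 * (v j ^+ 2 * e i j)) <= v i * v j * r.
  rewrite lerNl; apply: le_trans (ler_norm _) _; rewrite normrN normrM.
  apply: (@le_trans _ _ (`|v i * v j| * e i j)); first by rewrite ler_wpM2l// ler_norml.
  case: ger0P => _; lra.
rewrite mulrDr -(inj_eq val_inj)/=.
case: eqP => [ij|_]; rewrite ?mulr0; last by lra.
by move: b; rewrite ij; lra.
Qed.

Section cosine_products.
Context d (T : measurableType d) (R : realType) (P : probability T R).
Variable S : set (T -> R).
Hypothesis gS : gaussian_space P S.

Lemma bmeas_prod n (f : nat -> T -> R) : (forall i, bmeas (f i)) ->
  bmeas (fun w => \prod_(i < n) f i w).
Proof.
move=> bf; elim: n => [|n IH].
  by under eq_fun do rewrite big_ord0; exact: bmeas_cst.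
by under eq_fun do rewrite big_ord_recr/=; exact: bmeasM.
Qed.

Lemma cosine_product (N : nat) (Y : nat -> T -> R) (s2 lam : R) :
  0 <= s2 -> (forall i, S (Y i)) ->
  (forall v : nat -> R, s2 * \sum_(i < N) v i ^+ 2 <=
     cov P (fun w => \sum_(i < N) v i * Y i w) (fun w => \sum_(i < N) v i * Y i w)) ->
  \int[P]_w (\prod_(i < N) ((1 + cos (lam * Y i w)) / 2)) <=
    ((1 + expR (- (s2 * lam ^+ 2 / 2))) / 2) ^+ N.
Proof.
move=> s20 SY Ycov.
have mY i : measurable_fun setT (Y i) by exact: (gs_measurable gS (SY i)).
pose X (v : nat -> R) w := \sum_(i < N) v i * Y i w.
have SX v : S (X v) by apply: (gs_sum gS v (SY 0%N)) => i _; exact: SY.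
have mX v : measurable_fun setT (X v) by exact: (gs_measurable gS (SX v)).
pose A n w := \prod_(i < n) ((1 + cos (lam * Y i w)) / 2).
have bA n : bmeas (A n).
  apply: (bmeas_prod n (f := fun i w => (1 + cos (lam * Y i w)) / 2)) => i.
  apply: bmeasM; last exact: bmeas_cst.
  apply: bmeasD; first exact: bmeas_cst.
  apply: bmeas_cos.
  by apply: measurable_funM => //; exact: measurable_cst.
have bcA n v : bmeas (fun w => cos (X v w) * A n w) by apply: bmeasM => //; exact: bmeas_cos.
set r := (1 + _) / 2.
(* The induction carries an extra cosine of a combination supported on the indices from [n] on. The
   next factor keeps [v] with weight 1/2 or puts [lam] or [- lam] at an empty coordinate with weight
   1/4 each, which raises the sum of squares by exactly [lam ^+ 2]. *)
suff ind n v : (n <= N)%N -> (forall i, (i < n)%N -> v i = 0) ->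
    \int[P]_w (cos (X v w) * A n w) <= r ^+ n * expR (- (s2 * (\sum_(i < N) v i ^+ 2) / 2)).
  have := ind N (fun=> 0) (leqnn _) (fun _ _ => erefl).
  rewrite big1; last by move=> i _; rewrite expr0n.
  rewrite mulr0 mul0r oppr0 expR0 mulr1; apply: le_trans.
  apply: le_of_eq; apply: eq_Rintegral => w _.
  by rewrite /X [X in cos X]big1 ?cos0 ?mul1r// => i _; rewrite mul0r.
elim: n v => [|n IH] v nN v0.
  rewrite expr0 mul1r.
  have -> : \int[P]_w (cos (X v w) * A 0%N w) = \int[P]_w cos (X v w).
    by apply: eq_Rintegral => w _; rewrite /A big_ord0 mulr1.
  by rewrite (gs_cos gS (SX v)) ler_expR lerN2 ler_pM2r// Ycov.
pose u (b : R) i := if i == n then b else v i.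
have uE b w : X (u b) w = X v w + b * Y n w.
  rewrite /X (bigD1 (Ordinal nN))//= [in RHS](bigD1 (Ordinal nN))//= /u eqxx v0// mul0r add0r addrC.
  congr (_ + _); apply: eq_bigr => i; rewrite -(inj_eq val_inj)/= => /negbTE -> //.
have uS b : \sum_(i < N) u b i ^+ 2 = \sum_(i < N) v i ^+ 2 + b ^+ 2.
  rewrite (bigD1 (Ordinal nN))//= [in RHS](bigD1 (Ordinal nN))//= /u eqxx v0// expr0n add0r addrC.
  by congr (_ + _); apply: eq_bigr => i; rewrite -(inj_eq val_inj)/= => /negbTE ->.
have IHu b := IH (u b) (ltnW nN).
have v0' : forall i, (i < n)%N -> v i = 0 by move=> i ni; apply: v0; exact: ltnW.
have u0 b : forall i, (i < n)%N -> u b i = 0.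
  by move=> i ni; rewrite /u ltn_eqF// v0'.
have -> : \int[P]_w (cos (X v w) * A n.+1 w) =
    2^-1 * \int[P]_w (cos (X v w) * A n w) +
    (4^-1 * \int[P]_w (cos (X (u lam) w) * A n w) +
     4^-1 * \int[P]_w (cos (X (u (- lam)) w) * A n w)).
  have iA v' := bmeas_integrable P (bcA n v').
  have iZ c v' : P.-integrable setT (fun w => (c * (cos (X v' w) * A n w))%:E).
    by apply/bmeas_integrable/bmeasM => //; exact: bmeas_cst.
  have Zl c v' : c * \int[P]_w (cos (X v' w) * A n w) =
      \int[P]_w (c * (cos (X v' w) * A n w)).
    by rewrite RintegralZl//; exact: iA.
  have iD := integrableD measurableT (iZ 4^-1 (u lam)) (iZ 4^-1 (u (- lam))).
  rewrite !Zl -(RintegralD _ (iZ _ _) (iZ _ _))// -(RintegralD _ (iZ _ _) iD)//.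
  apply: eq_Rintegral => w _; rewrite !uE mulNr !cosD cosN sinN.
  rewrite /A big_ord_recr/=; set a := \prod_(i < n) _.
  by field.
have := IH v (ltnW nN) v0'.
have := IHu lam (u0 lam); have := IHu (- lam) (u0 (- lam)).
rewrite !uS sqrrN [r ^+ n.+1]exprSr; set I1 := Rintegral _ _ _; set I2 := Rintegral _ _ _; set I3 := Rintegral _ _ _.
rewrite (_ : expR (- (s2 * (_ + lam ^+ 2) / 2)) =
  expR (- (s2 * (\sum_(i < N) v i ^+ 2) / 2)) * expR (- (s2 * lam ^+ 2 / 2))); last first.
  by rewrite -expRD; congr expR; ring.
set rn := r ^+ n; set E := expR (- (s2 * (\sum_(i < N) v i ^+ 2) / 2)).
rewrite /r; set q := expR _ => h1 h2 h3.
have -> : rn * ((1 + q) / 2) * E = 2^-1 * (rn * E) + 2^-1 * (rn * E * q) by field.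
lra.
Qed.

End cosine_products.

(** * Covariance of the second differences of the process *)

Section second_difference_identities.
Context (R : realType).
Implicit Types (f g : R -> R) (h s t : R).

Lemma sdiff_shift g h c t : sdiff (fun t => g (t - c)) h t = sdiff g h (t - c).
Proof. by rewrite /sdiff [t + h - c]addrAC [t - h - c]addrAC. Qed.

Lemma sdiff_convolution g h s t :
  sdiff (fun s => sdiff (fun t => g (t - s)) h t) h s = sdiff (sdiff g h) h (t - s).
Proof.
rewrite [LHS]/sdiff !sdiff_shift [RHS]/sdiff.
have -> : t - (s + h) = t - s - h by ring.
have -> : t - (s - h) = t - s + h by ring.
ring.
Qed.

Lemma sdiff_even f h t : (forall x, f (- x) = f x) -> sdiff f h (- t) = sdiff f h t.
Proof.
move=> fN; rewrite /sdiff fN -[f (- t + h)]fN -[f (- t - h)]fN !opprD !opprK.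
ring.
Qed.

Lemma sdiff_abs f h t : (forall x, f (- x) = f x) -> sdiff f h `|t| = sdiff f h t.
Proof. by move=> fN; case: ger0P => // _; rewrite sdiff_even. Qed.

Lemma sdiff_eq f g h t : f (t + h) = g (t + h) -> f t = g t -> f (t - h) = g (t - h) ->
  sdiff f h t = sdiff g h t.
Proof. by rewrite /sdiff => -> -> ->. Qed.

Lemma sdiff_lin (c : R) f g h t :
  sdiff (fun t => c * (f t - g t)) h t = c * (sdiff f h t - sdiff g h t).
Proof. by rewrite /sdiff; ring. Qed.

Lemma sdiff_abs_powR h (p c : R) : 0 < p < 2 -> 0 < h -> 4 <= c ->
  `|sdiff (sdiff (fun x => `|x| `^ p) h) h (c * h)| <= 384 * h `^ p / c ^+ 2.
Proof.
move=> p02 h0 c4; have hu : 4 * h <= c * h by rewrite ler_pM2r.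
have pos x : 2 * h <= x -> `|x| `^ p = x `^ p by move=> hx; rewrite ger0_norm//; lra.
have E x : 3 * h <= x ->
    sdiff (fun x => `|x| `^ p) h x = sdiff (fun x => x `^ p) h x.
  by move=> hx; apply: sdiff_eq; apply: pos; lra.
rewrite (@sdiff_eq _ (sdiff (fun x => x `^ p) h)); [exact: sdiff_powR| | |];
  by apply: E; lra.
Qed.

(** Coefficients 1, -4, 6, -4, 1 at the points from [-2h] to [2h]. The constant [8 - 2 * 2^p] is
    positive for [p < 2]; it supplies the variance of one second difference. *)
Lemma sdiff_abs_powR0 h (p : R) : p != 0 -> 0 < h ->
  sdiff (sdiff (fun x => `|x| `^ p) h) h 0 = - ((8 - 2 * 2 `^ p) * h `^ p).
Proof.
move=> p0 h0; rewrite /sdiff !add0r addNr subrr -opprD normrN normr0 powR0//.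
rewrite normrN (gtr0_norm h0) (_ : h + h = 2 * h); last by ring.
by rewrite (gtr0_norm (mulr_gt0 _ h0))// powRM ?(ltW h0)//; ring.
Qed.

(** Here [1536 = 4 * 384]: the constant of [sdiff_powR] times the bound of [sum_inv_sqr_dist]. *)
Lemma exists_spacing (D : R) : 0 < D -> exists2 L, 4 <= L & 1536 / L ^+ 2 <= D / 4.
Proof.
move=> D0; exists (4 + 6144 / D); set L := 4 + _.
  by rewrite /L lerDl (divr_ge0 (ler0n _ _) (ltW D0)).
have L4 : 4 <= L by rewrite /L lerDl (divr_ge0 (ler0n _ _) (ltW D0)).
have L0 : 0 < L by apply: lt_le_trans L4.
rewrite ler_pdivrMr ?exprn_gt0//.
have : D / 4 * L <= D / 4 * L ^+ 2.
  by rewrite ler_pM2l ?divr_gt0// expr2 ler_peMl ?(ltW L0)// (le_trans _ L4)// ler1n.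
apply: le_trans; rewrite /L mulrDr.
rewrite (_ : D / 4 * (6144 / D) = 1536); last by field; rewrite gt_eqF.
by rewrite lerDr mulr_ge0 ?divr_ge0 ?(ltW D0) ?ler0n.
Qed.

Lemma exists_mesh (p D M : R) : 0 < p < 2 -> 0 < D -> 0 <= M ->
  exists2 h0, 0 < h0 <= 4^-1 &
    forall h, 0 < h <= h0 -> M * h ^+ 2 <= D / 4 * h `^ p.
Proof.
move=> /andP[p0 p2] D0 M0; pose q := (D / (4 * (M + 1))) `^ (2 - p)^-1.
have M1 : 0 < M + 1 by lra.
have p2' : 0 < 2 - p by lra.
have q0 : 0 < q by rewrite powR_gt0// divr_gt0// mulr_gt0.
exists (Num.min 4^-1 q).
  by rewrite ge_min lexx lt_min q0 invr_gt0 ltr0n.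
move=> h /andP[hp hh0].
have /andP[h4 hq] : (h <= 4^-1) && (h <= q) by rewrite -le_min.
have -> : h ^+ 2 = h `^ (2 - p) * h `^ p.
  by rewrite -powRD ?subrK ?powR_mulrn ?(ltW hp)// (gt_eqF hp) implybT.
rewrite mulrA ler_wpM2r ?powR_ge0//.
have hqp : h `^ (2 - p) <= D / (4 * (M + 1)).
  rewrite [leRHS](_ : _ = q `^ (2 - p)); last first.
    by rewrite /q -powRrM mulVf ?gt_eqF// powRr1// divr_ge0 ?mulr_ge0 ?(ltW D0) ?(ltW M1).
  by apply: ge0_ler_powR; rewrite ?nnegrE ?(ltW p2') ?(ltW hp) ?(ltW q0).
have h'0 := powR_ge0 h (2 - p).
apply: (@le_trans _ _ ((M + 1) * h `^ (2 - p))); first by rewrite ler_wpM2r// lerDl.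
rewrite -ler_pdivlMl//.
by apply: le_trans hqp _; apply: le_of_eq; field; rewrite gt_eqF.
Qed.

Lemma mesh_ge0 h z : h <= 4^-1 -> 0 <= z -> 0 <= 2^-1 + z - h.
Proof. lra. Qed.

Lemma mesh_range h z : 0 <= h -> h <= 4^-1 -> 0 <= z -> z <= 4^-1 ->
  4^-1 <= 2^-1 + z - h /\ 2^-1 + z + h <= 1.
Proof. lra. Qed.

(** The smooth term and the off-diagonal power term each use a quarter of the diagonal [D * y], so
    half of it survives. *)
Lemma row_sum_bound (n L h M D y : R) : 0 <= n -> 4 <= L -> 0 <= h ->
  n * L * h <= 4^-1 -> 0 <= M -> 0 <= y ->
  M * h ^+ 2 <= D / 4 * y -> 1536 / L ^+ 2 <= D / 4 ->
  n * M * h ^+ 3 + 384 * y / L ^+ 2 * 4 <= D / 2 * y.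
Proof.
move=> n0 L4 h0 nLh M0 y0 hM LD.
have a1 : n * M * h ^+ 3 <= D / 4 * y.
  apply: le_trans hM; rewrite (_ : _ * h ^+ 3 = n * h * (M * h ^+ 2)); last by ring.
  rewrite ler_piMl ?mulr_ge0 ?sqr_ge0//.
  have : n * h * 4 <= n * h * L by rewrite ler_wpM2l// mulr_ge0.
  by move: nLh; rewrite mulrAC; lra.
have a2 : 384 * y / L ^+ 2 * 4 <= D / 4 * y.
  rewrite (_ : _ * 4 = 1536 / L ^+ 2 * y); first by rewrite ler_wpM2r.
  by field; rewrite gt_eqF// (lt_le_trans _ L4).
lra.
Qed.

End second_difference_identities.

Section second_difference_covariance.
Context d (T : measurableType d) (R : realType) (P : probability T R).
Variables (H K : R) (B : R -> {RV P >-> R}).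
Hypotheses (H0 : 0 < H) (H1 : H < 1) (K0 : 0 < K) (K1 : K <= 1).
Hypothesis bifbmB : bifractional_brownian_motion H K B.

Let gS := bifbm_gaussian_space bifbmB.
Let p := 2 * H * K.
Let p02 : 0 < p < 2.
Proof.
apply/andP; split; first by rewrite /p !mulr_gt0.
apply: (@le_lt_trans _ _ (2 * H)); first by rewrite /p ler_piMr// mulr_ge0// ltW.
by have := H1; lra.
Qed.

Definition bifbm_sdiff h t w := sdiff (fun t => B t w) h t.

Lemma bifbm_span_sdiff h t : 0 <= h -> 0 <= t - h -> bifbm_span B (bifbm_sdiff h t).
Proof.
move=> h0 th.
have S1 : bifbm_span B (B (t + h)) by apply: bifbm_span_B; lra.
have S2 : bifbm_span B (B t) by apply: bifbm_span_B; lra.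
have S3 : bifbm_span B (B (t - h)) by apply: bifbm_span_B; lra.
have := gs_add gS (gs_add gS S1 (gs_scale gS (-2) S2)) S3.
by congr (bifbm_span B _); apply/funext => w; rewrite /bifbm_sdiff /sdiff mulNr.
Qed.

Let cov_sdiffl h t Z : 0 <= h -> 0 <= t - h -> bifbm_span B Z ->
  cov P (bifbm_sdiff h t) Z = sdiff (fun t => cov P (B t) Z) h t.
Proof.
move=> h0 th SZ.
have S1 : bifbm_span B (B (t + h)) by apply: bifbm_span_B; lra.
have S2 : bifbm_span B (B t) by apply: bifbm_span_B; lra.
have S3 : bifbm_span B (B (t - h)) by apply: bifbm_span_B; lra.
have S2' := gs_scale gS (-2) S2.
have -> : bifbm_sdiff h t = (fun w => (B (t + h) w + -2 * B t w) + B (t - h) w).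
  by apply/funext => w; rewrite /bifbm_sdiff /sdiff mulNr.
rewrite (covDl gS (gs_add gS S1 S2') S3 SZ) (covDl gS S1 S2' SZ) (covZl gS _ S2 SZ).
by rewrite /sdiff mulNr.
Qed.

(** The list [[:: (1, K, 0, 0)]] encodes [(t^(2H) + s^(2H))^K]. Differencing [|t - s|^p] in both
    variables amounts to a fourth difference of [|x|^p] at [t - s]. *)
Lemma cov_bifbm_sdiff h s t : 0 <= h -> 0 <= s - h -> 0 <= t - h ->
  cov P (bifbm_sdiff h s) (bifbm_sdiff h t) = (2 `^ K)^-1 *
    (sdiff (fun s => sdiff (psum (2 * H) [:: (1, K, 0, 0)] s) h t) h s -
     sdiff (sdiff (fun x => `|x| `^ p) h) h (t - s)).
Proof.
move=> h0 sh th; rewrite (cov_sdiffl h0 sh (bifbm_span_sdiff h0 th)).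
have inner a : 0 <= a ->
    cov P (B a) (bifbm_sdiff h t) = (2 `^ K)^-1 *
    (sdiff (psum (2 * H) [:: (1, K, 0, 0)] a) h t - sdiff (fun t => `|t - a| `^ p) h t).
  move=> a0; rewrite covC (cov_sdiffl h0 th (bifbm_span_B B a0)) -sdiff_lin.
  have E b : 0 <= b -> cov P (B b) (B a) =
      (2 `^ K)^-1 * (psum (2 * H) [:: (1, K, 0, 0)] a b - `|b - a| `^ p).
    move=> b0; rewrite (bifbm_covE bifbmB)// /bifbm_cov /psum !big_seq1 /psum_term.
    have -> : (b `^ (2 * H) + a `^ (2 * H)) `^ K * (a `^ 0 * b `^ 0) =
        (a `^ (2 * H) + b `^ (2 * H)) `^ K.
      by rewrite (powRr0 a) (powRr0 b) !mulr1 (addrC (a `^ _)).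
    by rewrite mul1r (distrC b a).
  by apply: sdiff_eq; apply: E; lra.
have conv := sdiff_convolution (fun x => `|x| `^ p) h s t.
have lin := sdiff_lin (2 `^ K)^-1
  (fun s => sdiff (psum (2 * H) [:: (1, K, 0, 0)] s) h t)
  (fun s => sdiff (fun t => `|t - s| `^ p) h t) h s.
rewrite conv in lin; rewrite -lin.
have s1 : 0 <= s + h by lra.
have s2 : 0 <= s by lra.
apply: sdiff_eq; [exact: (inner _ s1)|exact: (inner _ s2)|exact: (inner _ sh)].
Qed.

(** The points start at 1/2 and span at most 1/4, so with [h <= 1/4] all evaluations fall in
    [[1/4, 1]], where [sdiff_psum] applies. The spacing [L] tames the power term, the mesh bound
    [h0] the smooth one. *)
Lemma sdiff_variance_lower : exists L h0 c : R,
  [/\ 4 <= L, 0 < h0 <= 4^-1, 0 < c & forall n h, 0 < h <= h0 -> n%:R * L * h <= 4^-1 ->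
   forall v : nat -> R, c * h `^ p * \sum_(i < n) v i ^+ 2 <=
    cov P (fun w => \sum_(i < n) v i * bifbm_sdiff h (2^-1 + i%:R * L * h) w)
          (fun w => \sum_(i < n) v i * bifbm_sdiff h (2^-1 + i%:R * L * h) w)].
Proof.
have /andP[p0 p2] := p02.
have e02 : 0 < 2 * H < 2 by have := H0; have := H1 => *; apply/andP; split; lra.
have [M M0 hM] := sdiff_psum e02 [:: (1, K, 0, 0)].
pose D : R := 8 - 2 * 2 `^ p.
have D0 : 0 < D.
  have : 2 `^ p < 2 `^ 2 :> R by apply: ltr_powR; rewrite ?ltr1n.
  by rewrite powR_mulrn// /D => h; lra.
have [L L4 LD] := exists_spacing D0.
have L0 : 0 < L by apply: lt_le_trans L4.
have [h0 h04 hM2'] := exists_mesh p02 D0 M0.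
exists L, h0, ((2 `^ K)^-1 * (D / 2)); split => //.
  by rewrite mulr_gt0 ?invr_gt0 ?powR_gt0// divr_gt0.
move=> n h hh0 nLh v.
have hM2 := hM2' h hh0.
have /andP[hp hh0'] := hh0.
have h4 : h <= 4^-1 by apply: le_trans hh0' _; case/andP: h04.
pose Y i := bifbm_sdiff h (2^-1 + i%:R * L * h).
have hi i : 0 <= i%:R * L * h by rewrite !mulr_ge0// ltW.
have SY i : bifbm_span B (Y i).
  apply: bifbm_span_sdiff; first exact: ltW.
  exact: mesh_ge0.
rewrite (cov_sum gS (X := Y) v (SY 0%N)); last by move=> i _; exact: SY.
pose kk := (2 `^ K)^-1 : R; have kk0 : 0 < kk by rewrite invr_gt0 powR_gt0.
(* The first summand is the smooth error, common to all pairs; the second bounds the power term and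
   vanishes on the diagonal, where that term is known exactly. *)
pose e (i j : nat) : R := kk * (M * h ^+ 3) + kk * (384 * h `^ p / L ^+ 2) *
  (if i == j then 0 else (((i - j) + (j - i))%:R ^+ 2)^-1).
have -> : (2 `^ K)^-1 * (D / 2) * h `^ p = kk * (D * h `^ p) - kk * (D / 2 * h `^ p).
  by rewrite -/kk; field.
apply: (@diagonal_dominance R n (fun i j => cov P (Y i) (Y j)) e).
- by move=> i j; rewrite /e eq_sym addnC.
- move=> i j ni nj.
  have ti k : (k < n)%N -> k%:R * L * h <= 4^-1.
    move=> kn; apply: le_trans nLh; rewrite ler_wpM2r ?(ltW hp)// ler_wpM2r ?(ltW L0)//.
    by rewrite ler_nat ltnW.
  have [s0 s1] := mesh_range (ltW hp) h4 (hi i) (ti _ ni).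
  have [t0 t1] := mesh_range (ltW hp) h4 (hi j) (ti _ nj).
  rewrite /Y cov_bifbm_sdiff ?(ltW hp) ?mesh_ge0//.
  set s := i%:R * L * h in s0 s1 *; set t := j%:R * L * h in t0 t1 *.
  rewrite -/kk (_ : kk * _ - _ = kk * sdiff (fun s => sdiff (psum (2 * H) [:: (1, K, 0, 0)] s) h (2^-1 + t)) h (2^-1 + s)
    - kk * (sdiff (sdiff (fun x => `|x| `^ p) h) h (2^-1 + t - (2^-1 + s)) +
      (if i == j then D * h `^ p else 0))); last first.
    by case: eqP => _; ring.
  rewrite (le_trans (ler_normB _ _))// !normrM (gtr0_norm kk0) /e -[kk * _ * (if _ then _ else _)]mulrA lerD//.
    by rewrite ler_pM2l//; apply: hM => //; exact: ltW.
  rewrite ler_pM2l//; case: eqP => [ij|/eqP ij].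
    rewrite /s /t ij subrr sdiff_abs_powR0//; last by rewrite gt_eqF.
    by rewrite addNr normr0 mulr0.
  rewrite addr0 -sdiff_abs; last first.
    by move=> x; apply: sdiff_even => y; rewrite normrN.
  pose dd := (i - j + (j - i))%N.
  have -> : `|2^-1 + t - (2^-1 + s)| = dd%:R * L * h.
    have -> : 2^-1 + t - (2^-1 + s) = (j%:R - i%:R) * L * h by rewrite /s /t; ring.
    rewrite !normrM (gtr0_norm hp) (gtr0_norm L0); congr (_ * _ * _).
    rewrite /dd; have [ji|ji] := leqP j i.
      by rewrite distrC -natrB// ger0_norm// (eqP (_ : j - i == 0)%N) ?subn_eq0// addn0.
    by rewrite -natrB ?(ltnW ji)// ger0_norm// (eqP (_ : i - j == 0)%N) ?subn_eq0 ?(ltnW ji).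
  have dd1 : 1 <= dd%:R :> R by rewrite ler1n /dd; move: ij; clear; lia.
  have ddL : 4 <= dd%:R * L by apply: le_trans L4 _; rewrite ler_peMl// ltW.
  apply: le_trans (sdiff_abs_powR p02 hp ddL) _.
  by apply: le_of_eq; rewrite -/dd; field; rewrite !gt_eqF//; lra.
- move=> i ni; rewrite /e big_split/= sumr_const card_ord -mulr_sumr.
  have S := sum_inv_sqr_dist R i n.
  apply: (@le_trans _ _ (kk * (n%:R * M * h ^+ 3) + kk * (384 * h `^ p / L ^+ 2) * 4)).
    apply: lerD; first by apply: le_of_eq; rewrite -mulr_natr; ring.
    apply: ler_wpM2l S; apply: mulr_ge0; first exact: ltW.
    apply: divr_ge0; last exact: sqr_ge0.
    by apply: mulr_ge0; [exact: ler0n|exact: powR_ge0].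
  rewrite -[kk * _ * 4]mulrA -mulrDr (ler_pM2l kk0).
  by apply: row_sum_bound; rewrite ?(ltW hp) ?powR_ge0.
Qed.

End second_difference_covariance.

(** * The upper bound *)

Lemma measurable_norm_le (R : realType) (y : R) :
  measurable [set x : R | `|x| <= y].
Proof.
have -> : [set x : R | `|x| <= y] = [set` `[- y, y]].
  by apply/seteqP; split => x /=; rewrite in_itv/= ler_norml.
exact: measurable_itv.
Qed.

Lemma normal_slab_lt1 (R : realType) :
  fine (normal_prob 0 1 [set x : R | `|x| <= 2]) < 1.
Proof.
pose N := @normal_prob R 0 1.
pose J : set R := [set` `[3, 4]].
pose c := normal_peak (1 : R) * expR (- 8).
have c0 : 0 < c by rewrite mulr_gt0 ?expR_gt0// normal_peak_gt0// oner_neq0.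
have mJ : measurable J by exact: measurable_itv.
have mA := measurable_norm_le (2 : R).
have NJ : (c%:E <= N J)%E.
  rewrite /N /normal_prob.
  apply: (@le_trans _ _ (\int[lebesgue_measure]_(x in J) (cst c%:E x))%E).
    rewrite integral_cst// [X in (_ <= _ * X)%E](lebesgue_measure_itv `[3, 4])/= lte_fin.
    have -> : (3 : R) < 4 by lra.
    by rewrite -EFinB -EFinM lee_fin (_ : 4 - 3 = 1) ?mulr1//; ring.
  apply: ge0_le_integral => //.
  - by move=> x _; rewrite lee_fin ltW.
  - by apply/measurable_EFinP; apply: measurable_funTS; exact: measurable_normal_pdf.
  move=> x; rewrite /J /= in_itv/= => /andP[x3 x4].
  rewrite lee_fin normal_pdfE ?oner_neq0// /normal_fun subr0 /c ler_pM2l ?normal_peak_gt0 ?oner_neq0//.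
  rewrite ler_expR mulNr lerN2 expr1n -mulr_natr mul1r.
  by rewrite ler_pdivrMr//; nra.
have AJ : (N [set x : R | (`|x| <= 2)%R] <= N (~` J))%E.
  apply: le_measure; [by apply/mem_set|by apply/mem_set; exact: measurableC|].
  move=> x xA; rewrite /J /= in_itv/= => /andP[x3 _].
  by move: (le_trans (ler_norm x) xA); lra.
have NC : N (~` J) = (1 - N J)%E by exact: (@probability_setC _ _ _ (@normal_prob R 0 1) _ mJ).
rewrite NC in AJ.
rewrite -lte_fin fineK ?fin_num_measure//.
apply: le_lt_trans AJ _.
rewrite -[X in (_ - X)%E]fineK ?fin_num_measure// -EFinB lte_fin.
have : c <= fine (N J) by rewrite -lee_fin fineK ?fin_num_measure.
lra.
Qed.

Lemma cos1_le (R : realType) (z : R) : `|z| <= 1 -> cos 1 <= cos z.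
Proof.
move=> z1; rewrite -(cos_norm z) leNgt; apply/negP.
have p2 := pi_ge2 R.
rewrite ltr_cos ?in_itv/= ?normr_ge0 ?ler01//=; lra.
Qed.

Lemma cos1_lt1 (R : realType) : cos 1 < 1 :> R.
Proof.
rewrite -[ltRHS](@cos0 R) ltr_cos ?ltr01// in_itv/= ?lexx ?ler01/= ?pi_ge0//.
by have := pi_ge2 R; lra.
Qed.

(** The mesh is [h = b x^(1/al)], with [b] chosen so that [s h^(2 al) = Q x^2], and [n] is the
    integer part of [1 / (4 L h)]. Requiring [h <= 1 / (8 L)] makes this quotient at least 2, so
    rounding costs at most a factor 2. *)
Lemma exists_points (R : realType) (al L h0 s Q : R) :
  0 < al -> 4 <= L -> 0 < h0 -> 0 < s -> 0 < Q ->
  exists k x0 : R, [/\ 0 < k, 0 < x0 & forall x, 0 < x <= x0 ->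
    exists n h, [/\ 0 < h <= h0, n%:R * L * h <= 4^-1,
      k / x `^ (1 / al) <= n%:R & Q * x ^+ 2 <= s * h `^ (2 * al)]].
Proof.
move=> al0 L4 h00 s0 Q0; have L0 : 0 < L by apply: lt_le_trans L4.
have al2 : 0 < 2 * al by rewrite mulr_gt0.
pose b := (Q / s) `^ (2 * al)^-1.
have b0 : 0 < b by rewrite powR_gt0// divr_gt0.
have bE : s * b `^ (2 * al) = Q.
  by rewrite /b -powRrM mulVf ?gt_eqF// powRr1 ?divr_ge0 ?(ltW Q0) ?(ltW s0)// mulrC divfK ?gt_eqF.
pose h1 := Num.min h0 (8 * L)^-1.
have h10 : 0 < h1 by rewrite lt_min h00 invr_gt0 mulr_gt0.
exists (8 * L * b)^-1, ((h1 / b) `^ al); split.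
- by rewrite invr_gt0 !mulr_gt0.
- by rewrite powR_gt0// divr_gt0.
move=> x /andP[x0 xx0]; set u := x `^ (1 / al).
have u0 : 0 < u by rewrite powR_gt0.
have uh : u <= h1 / b.
  rewrite [leRHS](_ : _ = ((h1 / b) `^ al) `^ (1 / al)); last first.
    by rewrite -powRrM mul1r divff ?gt_eqF// powRr1// divr_ge0// ltW.
  by apply: ge0_ler_powR; rewrite ?nnegrE ?powR_ge0 ?(ltW x0)// divr_ge0// ltW.
pose h := b * u; have hp : 0 < h by rewrite mulr_gt0.
have hh : h <= h1 by rewrite /h mulrC -ler_pdivlMr.
have /andP[hh0 h8] : (h <= h0) && (h <= (8 * L)^-1) by rewrite -le_min.
have Lh : 0 < 4 * L * h by rewrite !mulr_gt0.
have z0 : 0 <= (4 * L * h)^-1 by rewrite invr_ge0 ltW.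
exists (Num.truncn (4 * L * h)^-1), h; split.
- by rewrite hp.
- have : (Num.truncn (4 * L * h)^-1)%:R <= (4 * L * h)^-1 by rewrite truncn_le.
  rewrite -[X in _ <= X]mul1r ler_pdivlMr//; lra.
- pose z := (4 * L * h)^-1.
  have zt : z < (Num.truncn z)%:R + 1 by rewrite natr1; exact: truncnS_gt.
  have : 2 <= (4 * L * h)^-1.
    rewrite -[leLHS]invrK lef_pV2 ?posrE// ?invr_gt0//.
    move: h8; rewrite -[X in _ <= X]mul1r ler_pdivlMr ?mulr_gt0//; lra.
  have -> : (8 * L * b)^-1 / u = (4 * L * h)^-1 / 2.
    by rewrite /h; field; rewrite !gt_eqF.
  by rewrite -/z; move: zt; set m := (Num.truncn z)%:R; lra.
- rewrite /h powRM ?(ltW b0) ?(ltW u0)// mulrA bE /u -powRrM.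
  rewrite (_ : 1 / al * (2 * al) = 2); last by field; rewrite gt_eqF.
  by rewrite powR_mulrn// ltW.
Qed.

Section upper_bound.
Context d (T : measurableType d) (R : realType) (P : probability T R).
Variables (H K : R) (B : R -> {RV P >-> R}).
Hypotheses (H0 : 0 < H) (H1 : H < 1) (K0 : 0 < K) (K1 : K <= 1).
Hypothesis bifbmB : bifractional_brownian_motion H K B.

Let gS := bifbm_gaussian_space bifbmB.
Let p := 2 * H * K.

Let rho0 : R := (1 + cos 1 / 2) / (1 + cos 1).
Let rho00 : 0 < rho0.
Proof. by rewrite divr_gt0// ?addr_gt0// ?divr_gt0 ?cos1_gt0. Qed.
Let rho01 : rho0 < 1.
Proof.
rewrite ltr_pdivrMr ?mul1r ?addr_gt0 ?cos1_gt0//.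
by have := cos1_gt0 R; lra.
Qed.

(* [rho0] bounds the ratio of the mean of one factor [(1 + cos (Y / 4 x)) / 2],
   which is nearly [1 / 2] when [Y / x] has a large variance, to its minimum on
   the event [|Y| <= 4 x]. *)
Lemma small_ball_upper_step (n : nat) (L h c x t0 : R) :
  0 <= t0 <= 1 -> 0 < x -> 0 < h -> h <= 4^-1 -> 4 <= L -> 0 <= c ->
  n%:R * L * h <= 4^-1 ->
  (forall v : nat -> R, c * \sum_(i < n) v i ^+ 2 <=
    cov P (fun w => \sum_(i < n) v i * bifbm_sdiff B h (2^-1 + i%:R * L * h) w)
          (fun w => \sum_(i < n) v i * bifbm_sdiff B h (2^-1 + i%:R * L * h) w)) ->
  expR (- (c * (4 * x)^-1 ^+ 2 / 2)) <= cos 1 / 2 ->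
  (P [set w | (max_deviation B t0 w <= x)%R] <= (rho0 ^+ n)%:E)%E.
Proof.
move=> /andP[t00 t01] x0 h0 h4 L4 c0 nLh cv ec.
have L0 : 0 < L by apply: lt_le_trans L4.
pose Y i := bifbm_sdiff B h (2^-1 + i%:R * L * h).
have hi i : 0 <= i%:R * L * h by rewrite !mulr_ge0// ltW.
have SY i : bifbm_span B (Y i).
  by apply: (bifbm_span_sdiff bifbmB); [exact: ltW|exact: mesh_ge0].
have mY i : measurable_fun setT (Y i) by exact: (gs_measurable gS (SY i)).
have := cosine_product gS (Y := Y) (4 * x)^-1 c0 SY cv.
set f := fun w => \prod_(i < n) _ => fle.
set r := (1 + expR _) / 2 in fle.
pose q : R := (1 + cos 1) / 2.
have q0 : 0 < q by rewrite divr_gt0// addr_gt0// cos1_gt0.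
have f0 w : 0 <= f w.
  apply: prodr_ge0 => i _; exact: divr_ge0.
have bf : bmeas f.
  apply: (bmeas_prod n (f := fun i w => (1 + cos ((4 * x)^-1 * Y i w)) / 2)) => i.
  apply: bmeasM; last exact: bmeas_cst.
  apply: bmeasD; first exact: bmeas_cst.
  by apply: bmeas_cos; apply: measurable_funM => //; exact: measurable_cst.
set A := [set w | _].
have mA : measurable A by exact: (measurable_max_deviation bifbmB).
have Af w : A w -> q ^+ n <= f w.
  move=> /(max_deviation_le bifbmB) Aw.
  rewrite -[n in q ^+ n]card_ord -prodr_const; apply: ler_prod => i _.
  rewrite (ltW q0)/= /q ler_pM2r ?invr_gt0// lerD2l; apply: cos1_le.
  have ti : i%:R * L * h <= 4^-1.
    apply: le_trans nLh; rewrite ler_wpM2r ?(ltW h0)// ler_wpM2r ?(ltW L0)//.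
    by rewrite ler_nat ltnW.
  have [s1 s2] := mesh_range (ltW h0) h4 (hi i) ti.
  rewrite normrM ger0_norm ?invr_ge0 ?mulr_ge0 ?(ltW x0)//.
  rewrite mulrC ler_pdivrMr ?mulr_gt0// mul1r /Y /bifbm_sdiff /sdiff.
  set t := 2^-1 + i%:R * L * h in s1 s2 *.
  have a1 : 0 <= t + h <= 1 by rewrite s2 andbT; lra.
  have a2 : 0 <= t <= 1 by apply/andP; split; lra.
  have a3 : 0 <= t - h <= 1 by apply/andP; split; lra.
  (* The coefficients 1, -2, 1 sum to 0, so [B t0] cancels, and their absolute values sum to 4. *)
  have := Aw _ a1; have := Aw _ a2; have := Aw _ a3.
  rewrite !ler_norml => /andP[? ?] /andP[? ?] /andP[? ?].
  by apply/andP; split; lra.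
(* Markov's inequality for the nonnegative product [f], which is at least [q ^+ n] on [A]. *)
have qPA : ((q ^+ n)%:E * P A <= (r ^+ n)%:E)%E.
  rewrite -(integral_cst P mA).
  apply: (@le_trans _ _ (\int[P]_w (f w)%:E)%E).
    apply: (@le_trans _ _ (\int[P]_(w in A) (f w)%:E)%E).
      apply: ge0_le_integral => //.
      - by move=> w _; rewrite lee_fin exprn_ge0// ltW.
      - by apply/measurable_EFinP; apply: measurable_funTS; exact: bf.1.
    apply: ge0_subset_integral => //; first by apply/measurable_EFinP; exact: bf.1.
    by move=> w _; rewrite lee_fin; exact: f0.
  rewrite -[leLHS]fineK; last exact: integrable_fin_num (bmeas_integrable P bf).
  by rewrite lee_fin.
rewrite -[P A]fineK ?fin_num_measure// lee_fin.
move: qPA; rewrite -[P A in leLHS]fineK ?fin_num_measure// -EFinM lee_fin.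
rewrite mulrC -ler_pdivlMr ?exprn_gt0// => /le_trans; apply.
rewrite -exprVn -exprMn lerXn2r ?nnegrE ?(ltW rho00)//.
  by rewrite mulr_ge0 ?invr_ge0 ?(ltW q0)// divr_ge0// addr_ge0 ?expR_ge0.
rewrite ler_pdivrMr// (_ : rho0 * q = (1 + cos 1 / 2) / 2); last first.
  by rewrite /rho0 /q; field; rewrite gt_eqF// addr_gt0// cos1_gt0.
by rewrite /r ler_pM2r ?invr_gt0// lerD2l.
Qed.

Lemma small_ball_upper_small : exists k x0 : R, [/\ 0 < k, 0 < x0 &
  forall t0 x, 0 <= t0 <= 1 -> 0 < x <= x0 ->
  (P [set w | (max_deviation B t0 w <= x)%R] <= (expR (- (k / x `^ (1 / (H * K)))))%:E)%E].
Proof.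
have [L [h0 [s [L4 /andP[h00 h04] s0 var]]]] := sdiff_variance_lower H0 H1 K0 K1 bifbmB.
(* With [2 * (4 x)^2 = 32 x^2], the condition [Q x^2 <= s h^p] says that the exponential in
   [small_ball_upper_step] is at most [cos 1 / 2]. *)
pose Q : R := - ln (cos 1 / 2) * 32.
have c1 := cos1_gt0 R; have c2 := cos1_lt1 R.
have Q0 : 0 < Q by rewrite /Q mulr_gt0// oppr_gt0 ln_lt0// divr_gt0//=; lra.
have al0 : 0 < H * K by rewrite mulr_gt0.
have [k [x0 [k0 x00 pts]]] := exists_points al0 L4 h00 s0 Q0.
have lr : 0 < - ln rho0 by rewrite oppr_gt0 ln_lt0// rho00.
exists (- ln rho0 * k), x0; split => //; first by rewrite mulr_gt0.
move=> t0 x t01 xx0; have /andP[x_gt0 _] := xx0.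
have [n [h [hh nLh kn Qx]]] := pts x xx0.
have /andP[hp hh0] := hh.
have c0 : 0 <= s * h `^ p by rewrite mulr_ge0 ?powR_ge0 ?(ltW s0).
apply: le_trans (small_ball_upper_step t01 x_gt0 hp (le_trans hh0 h04) L4 c0 nLh (var n h hh nLh) _) _.
  rewrite -[leRHS]lnK ?posrE ?divr_gt0// ler_expR lerNl.
  rewrite (_ : - ln (cos 1 / 2) = Q / 32); last by rewrite /Q mulfK.
  move: Qx; rewrite mulrA -/p => Qx.
  have x2 : 0 < x ^+ 2 by rewrite exprn_gt0.
  rewrite (_ : _ * _ / 2 = s * h `^ p / x ^+ 2 / 32); last by field; rewrite gt_eqF.
  by rewrite ler_pM2r ?invr_gt0// ler_pdivlMr.
rewrite lee_fin -[rho0 in leLHS]lnK ?posrE// -expRM_natl ler_expR.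
rewrite -[leLHS]opprK lerN2 -mulrN -mulrA (mulrC _ (- ln rho0)) ler_pM2l//.
Qed.

Lemma small_ball_upper_bound : exists2 c2 : R, 0 < c2 &
  forall t0 x : R, 0 <= t0 <= 1 -> 0 < x < 1 ->
  (P [set w | (max_deviation B t0 w <= x)%R] <= (expR (- (c2 / x `^ (1 / (H * K)))))%:E)%E.
Proof.
have [k [x0 [k0 x00 small]]] := small_ball_upper_small.
(* For [x0 < x < 1] a fixed bound [q < 1] on the probability is enough, because [x^(1/(HK))] stays
   above [v]. The maximum with 1/2 keeps [q] positive, so that [lnK] applies to it. *)
pose q : R := Num.max 2^-1 (fine (normal_prob 0 1 [set x : R | `|x| <= 2])).
have q0 : 0 < q by rewrite lt_max invr_gt0 ltr0n.
have q1 : q < 1 by rewrite gt_max normal_slab_lt1 andbT; lra.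
have lq : 0 < - ln q by rewrite oppr_gt0 ln_lt0// q0.
pose v := x0 `^ (1 / (H * K)); have v0 : 0 < v by rewrite powR_gt0.
pose c := Num.min k (- ln q * v).
have c0 : 0 < c by rewrite lt_min k0 mulr_gt0.
exists c => // t0 x t01 /andP[xp x1]; set u := x `^ (1 / (H * K)).
have u0 : 0 < u by rewrite powR_gt0.
have [xx0|x0x] := leP x x0.
  apply: le_trans (small t0 x t01 _) _; first by rewrite xp.
  by rewrite lee_fin ler_expR lerN2 ler_pM2r ?invr_gt0// ge_min lexx.
apply: (@le_trans _ _ q%:E); last first.
  rewrite lee_fin -[leLHS]lnK ?posrE// ler_expR -[leLHS]opprK lerN2.
  rewrite ler_pdivrMr//; apply: (@le_trans _ _ (- ln q * v)); first by rewrite ge_min lexx orbT.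
  rewrite ler_pM2l//; apply: ge0_ler_powR; rewrite ?nnegrE ?(ltW xp) ?(ltW x0x) ?(ltW x00)//.
  by rewrite divr_ge0 ?ler01 ?mulr_ge0 ?(ltW H0) ?(ltW K0).
have /andP[t00 _] := t01.
have S1 : bifbm_span B (B 1) by apply: bifbm_span_B; exact: ler01.
have mB : measurable_fun setT (B 1) by exact: (gs_measurable gS S1).
(* Since [B 0 = 0], comparing the times 0 and 1 with [t0] gives [|B 1| <= 2 x < 2], and [B 1] is a
   standard normal variable. *)
apply: (@le_trans _ _ (P [set w | (`|B 1 w| <= 2)%R])).
  apply: le_measure; [|by apply/mem_set; exact: measurable_slab|].
    by apply/mem_set; exact: (measurable_max_deviation bifbmB).
  move=> w /(max_deviation_le bifbmB) Aw /=.
  have := Aw 1 _; have := Aw 0 _; rewrite (bifbm_start bifbmB) !lexx ler01 sub0r normrN.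
  move=> /(_ isT) h1 /(_ isT) h2.
  have := ler_normD (B 1 w - B t0 w) (B t0 w); rewrite subrK; lra.
have mA := measurable_norm_le (2 : R).
have -> : P [set w | (`|B 1 w| <= 2)%R] = normal_prob 0 1 [set x : R | (`|x| <= 2)%R].
  rewrite -[LHS]/(P (B 1 @^-1` [set x : R | `|x| <= 2])) (gs_lawE gS S1 mA).
  rewrite (bifbm_covE bifbmB) ?ler01// (bifbm_cov_diag H0 K0)// powR1 sqrtr1.
  by rewrite /gaussian_law oner_eq0.
rewrite -[leLHS]fineK ?fin_num_measure// lee_fin.
by rewrite /q le_max lexx orbT.
Qed.

End upper_bound.

Unset Implicit Arguments.

Theorem lemma3p2 (R : realType) (d : measure_display) (T : measurableType d)
    (P : probability T R) (H K : R) (B : R -> {RV P >-> R})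
    (H_gt0 : 0 < H) (H_lt1 : H < 1) (K_gt0 : 0 < K) (K_le1 : K <= 1)
    (bifbmB : bifractional_brownian_motion H K B) :
  exists c1 c2 : R, [/\ 0 < c1, 0 < c2 &
    forall t0 x : R, 0 <= t0 <= 1 -> 0 < x < 1 ->
      ((expR (- (c1 / x `^ (1 / (H * K)))))%:E
         <= P [set w | (max_deviation B t0 w <= x)%R]
         <= (expR (- (c2 / x `^ (1 / (H * K)))))%:E)%E].
Proof.
have [c1 c10 lower] := small_ball_lower_bound H_gt0 H_lt1 K_gt0 K_le1 bifbmB.
have [c2 c20 upper] := small_ball_upper_bound H_gt0 H_lt1 K_gt0 K_le1 bifbmB.
by exists c1, c2; split => // t0 x t01 x01; rewrite lower// upper.
Qed.
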